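(* Let $\psi(x,z)$ be the normalized Baker--Akhiezer function for $R$ and $m=\{m_\alpha\}$. Let $\omega\in P$ and $\pi\in P^\vee$ be a (quasi)minuscule weight and a (quasi)minuscule coweight for $R$. Then $\psi$ solves the bispectral system of difference equations $$D^\omega_z\psi=\mathfrak m_\omega(x)\psi,\qquad D^\pi_x\psi=\mathfrak m_\pi(z)\psi,$$ where $\mathfrak m_\lambda(y)=\sum_{\tau\in W\lambda}q^{2(\tau,y)}$, $D^\pi_x$ is the Macdonald operator for $R$ in the variable $x$ and $D^\omega_z$ is the Macdonald operator for $R^\vee$ in the variable $z$, both with $t_\alpha=q^{-m_\alpha}$.
   Context: $V=\mathbb R^n$ is a Euclidean space with scalar product $(\cdot,\cdot)$, extended complex-bilinearly to $V\otimes\mathbb C$; variables $x,z$ range over $V\otimes\mathbb C$. $R\subset V$ is a reduced irreducible root system of rank $n$, $R_+$ positive roots, $W$ the Weyl group, $\alpha^\vee=2\alpha/(\alpha,\alpha)$, $P=\{\pi:(\pi,\alpha^\vee)\in\mathbb Z\ \forall\alpha\in R\}$, $P^\vee=\{\pi:(\pi,\alpha)\in\mathbb Z\ \forall\alpha\in R\}$. $q\in\mathbb C^\times$ is not a root of unity, $\log q$ is fixed, $q^a=e^{a\log q}$, $[a]=q^a-q^{-a}$. $m_\alpha\in\mathbb Z_{\ge0}$ are $W$-invariant, $\rho=\frac12\sum_{\alpha\in R_+}m_\alpha\alpha$, $\rho^\vee=\frac12\sum_{\alpha\in R_+}m_\alpha\alpha^\vee$. A coweight $\pi\in P^\vee$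 is minuscule if $-1\le(\pi,\alpha)\le1$ for all $\alpha\in R$, quasiminuscule if $\pi\in R^\vee$ and $-1\le(\pi,\alpha)\le1$ for all $\alpha\in R\setminus\{\pm\pi^\vee\}$, $\pi^\vee=2\pi/(\pi,\pi)$; (quasi)minuscule means nonzero and one of these; (quasi)minuscule weights of $R$ are the (quasi)minuscule coweights of $R^\vee$. With $T^v$ the shift by $v$, $$D_x^\pi=\sum_{\tau\in W\pi}a_\tau(T_x^\tau-1)+\sum_{\tau\in W\pi}q^{2(\rho,\tau)},\quad a_\tau(x)=\prod_{\alpha\in R,(\alpha,\tau)>0}\frac{[(\alpha,x)-m_\alpha]}{[(\alpha,x)]}\prod_{\alpha\in R,(\alpha,\tau)=2}\frac{[(\alpha,x)-m_\alpha+1]}{[(\alpha,x)+1]},$$ $$D_z^\omega=\sum_{\tau\in W\omega}b_\tau(T_z^\tau-1)+\sum_{\tau\in W\omega}q^{-2(\rho^\vee,\tau)},\quad b_\tau(z)=\prod_{\alpha\in R,(\alpha^\vee,\tau)>0}\frac{[(\alpha^\vee,z)-m_\alpha]}{[(\alpha^\vee,z)]}\prod_{\alpha\in R,(\alpha^\vee,\tau)=2}\frac{[(\alpha^\vee,z)-m_\alpha+1]}{[(\alpha^\vee,z)+1]}.$$ With $\mathcal N=\{\rho^\vee-\sum_{\alpha\in R_+}l_\alpha\alpha^\vee:0\le l_\alpha\le m_\alpha\}$, the normalized Baker--Akhiezer function is the unique function $\psi(x,z)=q^{2(x,z)}\sum_{\nu\in\mathcal N\cap P^\vee}\psi_\nu(x)q^{2(\nu,z)}$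 such that $\psi(x,z+\frac12s\alpha)=\psi(x,z-\frac12s\alpha)$ whenever $q^{2(\alpha^\vee,z)}=1$, for all $\alpha\in R$, $s=1,\dots,m_\alpha$, and $\psi_{\rho^\vee}(x)=\prod_{\alpha\in R_+}\prod_{j=1}^{m_\alpha}[j-(\alpha,x)]$. *)

(* Defs.v *)
From HB Require Import structures.
From mathcomp Require Import all_boot all_order all_algebra finmap.
From mathcomp Require Import complex.
From mathcomp Require Import all_classical all_reals all_analysis.

Set Implicit Arguments.
Unset Strict Implicit.
Unset Printing Implicit Defensive.

Import Order.TTheory GRing.Theory Num.Theory.
Import numFieldNormedType.Exports.

Local Open Scope classical_set_scope.
Local Open Scope ring_scope.
Local Open Scope complex_scope.

Section ComplexPowers.
Context {K : realType}.

Definition cexp (w : K[i]) : K[i] :=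
  (expR (complex.Re w))%:C
  * (cos (complex.Im w) +i* sin (complex.Im w)).

(* The base q enters only through the fixed value logq of its logarithm. *)
Definition qpow (logq a : K[i]) : K[i] := cexp (a * logq).

Definition qbracket (logq a : K[i]) : K[i] := qpow logq a - qpow logq (- a).

End ComplexPowers.

Section RootSystems.
Context {K : realType} {n : nat}.
Local Notation V := 'rV[K]_n.
Local Notation VC := 'rV[K[i]]_n.

(* Scalar products on V = K^n are given by their Gram matrix G. *)
Definition euclidean (G : 'M[K]_n) : Prop :=
  G^T = G /\ forall v : V, v != 0 -> 0 < (v *m G *m v^T) 0 0.

Variable G : 'M[K]_n.

Definition dot (u v : V) : K := (u *m G *m v^T) 0 0.

Definition toVC (v : V) : VC := map_mx (real_complex K) v.

Definition dotC (x z : VC) : K[i] :=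
  (x *m map_mx (real_complex K) G *m z^T) 0 0.

Definition coroot (a : V) : V := (2 / dot a a) *: a.

Definition reflection (a v : V) : V := v - dot v (coroot a) *: a.

Record reduced_irreducible_root_system (R : {fset V}) : Prop := {
  root_span : (<<R>> = fullv)%VS;
  root_neq0 : forall a, a \in R -> a != 0;
  root_refl : forall a b, a \in R -> b \in R -> reflection a b \in R;
  root_int : forall a b, a \in R -> b \in R -> dot b (coroot a) \is a Num.int;
  root_reduced : forall a (c : K), a \in R -> c *: a \in R -> c = 1 \/ c = -1;
  root_nonempty : R != fset0;
  root_irreducible : forall A B : {fset V}, R = (A `|` B)%fset ->
    (forall a b, a \in A -> b \in B -> dot a b = 0) ->
    A = fset0 \/ B = fset0 }.

Definition positive_roots (R Rp : {fset V}) : Prop :=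
  exists2 d : V, (forall a, a \in R -> dot a d != 0) &
    Rp = [fset a in R | 0 < dot a d]%fset.

Variable R : {fset V}.

Definition dual_roots : {fset V} := [fset coroot a | a in R]%fset.

Definition weight_lattice : set V :=
  [set p | forall a, a \in R -> dot p (coroot a) \is a Num.int].

Definition coweight_lattice : set V :=
  [set p | forall a, a \in R -> dot p a \is a Num.int].

(* The reflections are involutions, so the Weyl group they generate consists
   of their finite products. *)
Definition weyl_group : set (V -> V) :=
  [set w | exists2 s : seq V, {subset s <= R}
         & w = fun v => foldr reflection v s].

Definition weyl_orbit (v : V) : set V := [set w v | w in weyl_group].

Definition weyl_invariant (m : V -> nat) : Prop :=
  forall w a, weyl_group w -> a \in R -> m (w a) = m a.

Definition minuscule (p : V) : Prop :=
  forall a, a \in R -> -1 <= dot p a <= 1.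

Definition quasiminuscule (p : V) : Prop :=
  p \in dual_roots /\
  forall a, a \in R -> a != coroot p -> a != - coroot p -> -1 <= dot p a <= 1.

Definition quasi_or_minuscule (p : V) : Prop :=
  p != 0 /\ (minuscule p \/ quasiminuscule p).

Variables (logq : K[i]) (m : V -> nat).

Local Notation qp := (qpow logq).
Local Notation "[< a >]" := (qbracket logq a) (at level 0).

Definition orbit_sum (l : V) (y : VC) : K[i] :=
  \sum_(t \in weyl_orbit l) qp (2 * dotC (toVC t) y).

Section DifferenceOperator.
(* [h] is the identity for the operator attached to R, and [coroot] for the
   operator attached to the dual root system. *)
Variable h : V -> V.

Definition macdonald_coef (t : V) (y : VC) : K[i] :=
  (\prod_(a <- R | 0 < dot (h a) t)
     ([< dotC (toVC (h a)) y - (m a)%:R >] / [< dotC (toVC (h a)) y >]))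
  * (\prod_(a <- R | dot (h a) t == 2)
     ([< dotC (toVC (h a)) y - (m a)%:R + 1 >]
      / [< dotC (toVC (h a)) y + 1 >])).

Definition macdonald_op (r p : V) (f : VC -> K[i]) (y : VC) : K[i] :=
  \sum_(t \in weyl_orbit p) macdonald_coef t y * (f (y + toVC t) - f y)
  + (\sum_(t \in weyl_orbit p) qp (2 * dotC (toVC r) (toVC t))) * f y.

(* The points where no denominator of the coefficients vanishes. *)
Definition macdonald_regular (p : V) (y : VC) : Prop :=
  forall t a, weyl_orbit p t -> a \in R ->
    (0 < dot (h a) t -> [< dotC (toVC (h a)) y >] != 0) /\
    (dot (h a) t = 2 -> [< dotC (toVC (h a)) y + 1 >] != 0).

End DifferenceOperator.

Variable Rp : {fset V}.

Definition rho : V := 2^-1 *: \sum_(a <- Rp) (m a)%:R *: a.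

Definition rhov : V := 2^-1 *: \sum_(a <- Rp) (m a)%:R *: coroot a.

Definition macdonald_x : V -> (VC -> K[i]) -> VC -> K[i] :=
  macdonald_op id rho.

Definition macdonald_z : V -> (VC -> K[i]) -> VC -> K[i] :=
  macdonald_op coroot (- rhov).

(* The l_a range over the reals: this is a polytope, and its intersection with
   the coweight lattice is in general larger than for integral l_a. *)
Definition support_polytope : set V :=
  [set nu | exists2 l : V -> K,
      (forall a, a \in Rp -> 0 <= l a <= (m a)%:R)
    & nu = rhov - \sum_(a <- Rp) l a *: coroot a].

(* For x in a certain nowhere dense set the conditions on psi x do not
   determine it (in rank one, m = 1, the coefficient at -rhov is free when
   (a, x) = 1), so that uniqueness has to be understood in a class of
   functions of x that are determined by their values on a dense set:
   continuity of the coefficients is the only regularity required here. *)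
Definition normalized_BA (psi : VC -> VC -> K[i]) : Prop :=
  exists c : V -> VC -> K[i],
    [/\ forall nu, (support_polytope `&` coweight_lattice) nu ->
          continuous (c nu : 'rV[K[i]^o]_n -> K[i]^o),
        forall x z, psi x z = qp (2 * dotC x z) *
          \sum_(nu \in support_polytope `&` coweight_lattice)
             c nu x * qp (2 * dotC (toVC nu) z),
        forall a s x z, a \in R -> (1 <= s <= m a)%N ->
          qp (2 * dotC (toVC (coroot a)) z) = 1 ->
          psi x (z + toVC ((s%:R / 2) *: a)) = psi x (z - toVC ((s%:R / 2) *: a))
      & forall x, c rhov x =
          \prod_(a <- Rp) \prod_(1 <= j < (m a).+1)
             [< j%:R - dotC (toVC a) x >]].

End RootSystems.

(* Main.v *)
Require Import Defs.
From mathcomp Require Import all_boot all_order all_algebra finmap.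
From mathcomp Require Import complex.
From mathcomp Require Import generic_quotient fraction.
From mathcomp Require Import all_classical all_reals all_analysis.
From mathcomp Require Import zify ring lra.

Set Implicit Arguments.
Unset Strict Implicit.
Unset Printing Implicit Defensive.

Import Order.TTheory GRing.Theory Num.Theory.
Import numFieldNormedType.Exports.

Local Open Scope ring_scope.

(** For fixed $x$, $\psi$ is $q^{2(x,z)}$ times an exponential sum in $z$ with exponents in a
    zonotope whose vertices are the Weyl images of $\rho^\vee$. Characters that agree on the wall
    $q^{2(\alpha^\vee,z)}=1$ differ by integral multiples of $\alpha^\vee$, so quasi-invariance at
    $\alpha$ splits into conditions on the coefficients along each coset of $\mathbb Z\alpha^\vee$.
    For generic $x$ they amount to $m_\alpha$ vanishing moments at distinct nodes, so that a coset
    meeting the support contains two support points at least $m_\alpha$ steps apart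
    ([anti_strings]). A finite subset of the zonotope with such strings in all root directions that
    misses a vertex is empty ([strings_nil]): on a walk from chamber to chamber, the string at each
    wall is at least as long as the edge of the zonotope crossed there, so a defect at one vertex
    would push the set out of the zonotope at another. This uniqueness principle carries the rest.

    In $x$: both $\sum_\tau a_\tau(x)\psi(x+\tau,z)$ and $\mathfrak m_\pi(z)\psi(x,z)$ are
    quasi-invariant in $z$. The coefficients of $\psi$ at all vertices are explicit products
    ([vertex_coef]), matched by $a_\tau$ ([xcoef_vcoef]). Together with the scarcity of lattice
    points in the hull of a (quasi)minuscule orbit ([orbit_hull]), uniqueness shows that the two
    sums differ by a multiple $k(x)\psi$ ([x_operator_eigen]). The factor $k(x)$ is read off at
    $z=\rho$, because $\psi(x,\rho)$ is a nonzero constant ([F_const], [kappa_neq0]): on a suitable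
    line in $x$ it is a polynomial in $T=q^t$ by continuity, and $\psi(x,\rho)=\psi(x,-\rho)$
    ([psi_opp_rho]) bounds its degree by zero.

    In $z$: after multiplication by $\prod[(\alpha^\vee,z)]$, and after division of
    $\psi(x,z+\tau)-\psi(x,z)$ by the further denominator occurring when $\tau$ is a root, the
    equation becomes the vanishing of an exponential sum. That sum is skew across every wall for the
    shifts $0,\dots,m_\alpha$, which gives strings of length $m_\alpha+1$; its exponents lie in the
    zonotope with multiplicities $m_\alpha+1$, and one vertex coefficient is zero. By uniqueness it
    vanishes ([GG_eq0]).

    Both arguments need generic $x$; continuity of the coefficients along rays extends the
    identities ([x_operator_identity], [z_operator_identity]). *)

(** * Scalar products and vectors in general position *)

Section Euclid.
Context {K : realType} {n : nat}.
Local Notation V := 'rV[K]_n.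
Variables (G : 'M[K]_n) (hG : euclidean G).
Local Notation dt := (dot G).

Lemma dot_sym u v : dt u v = dt v u.
Proof.
have [GT _] := hG; rewrite /dot -[in RHS]GT.
have -> : v *m G^T *m u^T = (u *m G *m v^T)^T by rewrite !trmx_mul trmxK mulmxA.
by rewrite [RHS]mxE.
Qed.

Lemma dotDl u v w : dt (u + v) w = dt u w + dt v w.
Proof. by rewrite /dot !mulmxDl mxE. Qed.
Lemma dotZl a u w : dt (a *: u) w = a * dt u w.
Proof. by rewrite /dot -!scalemxAl mxE. Qed.
Lemma dotDr u v w : dt w (u + v) = dt w u + dt w v.
Proof. by rewrite !(dot_sym w) dotDl. Qed.
Lemma dotZr a u w : dt w (a *: u) = a * dt w u.
Proof. by rewrite !(dot_sym w) dotZl. Qed.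
Lemma dotNl u w : dt (- u) w = - dt u w.
Proof. by rewrite -scaleN1r dotZl mulN1r. Qed.
Lemma dotNr u w : dt w (- u) = - dt w u.
Proof. by rewrite -scaleN1r dotZr mulN1r. Qed.
Lemma dotBl u v w : dt (u - v) w = dt u w - dt v w.
Proof. by rewrite dotDl dotNl. Qed.
Lemma dotBr u v w : dt w (u - v) = dt w u - dt w v.
Proof. by rewrite dotDr dotNr. Qed.
Lemma dot0l w : dt 0 w = 0.
Proof. by rewrite -(scale0r 0) dotZl mul0r. Qed.
Lemma dot0r w : dt w 0 = 0.
Proof. by rewrite dot_sym dot0l. Qed.
Lemma dot_suml (I : Type) (r : seq I) (P : pred I) (F : I -> V) w :
  dt (\sum_(i <- r | P i) F i) w = \sum_(i <- r | P i) dt (F i) w.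
Proof. by elim/big_rec2: _ => [|i y z _ <-]; rewrite ?dot0l ?dotDl. Qed.
Lemma dot_sumr (I : Type) (r : seq I) (P : pred I) (F : I -> V) w :
  dt w (\sum_(i <- r | P i) F i) = \sum_(i <- r | P i) dt w (F i).
Proof. by rewrite dot_sym dot_suml; apply: eq_bigr => i _; rewrite dot_sym. Qed.
Lemma dot_gt0 v : v != 0 -> 0 < dt v v.
Proof. by case: hG => _ /(_ v). Qed.
Lemma dot_ge0 v : 0 <= dt v v.
Proof. by have [->|/dot_gt0/ltW//] := eqVneq v 0; rewrite dot0l. Qed.
Lemma dot_le0 v : dt v v <= 0 -> v = 0.
Proof. by have [->//|/dot_gt0] := eqVneq v 0; rewrite ltNge => /negP. Qed.

Definition dotE := (dotDl, dotDr, dotBl, dotBr, dotZl, dotZr, dotNl, dotNr,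
  dot0l, dot0r).

(** A sign survives when [e] times |b| stays below |a|; the bound |a| / (1 + |b|) makes this strict
    and never divides by zero. *)
Lemma small_shift (s : seq (K * K)) : exists2 eps : K, 0 < eps &
  forall e p, 0 < e <= eps -> p \in s -> p.1 != 0 ->
    Num.sg (p.1 + e * p.2) = Num.sg p.1.
Proof.
elim: s => [|[a b] s [eps e0 He]]; first by exists 1.
pose d := `|a| / (1 + `|b|).
have b0 : 0 < 1 + `|b| by rewrite ltr_pwDl ?normr_ge0.
have [a0|a0] := eqVneq a 0.
  exists eps => // e p ee; rewrite inE => /orP[/eqP->/=|]; first by rewrite a0 eqxx.
  exact: He.
have d0 : 0 < d by rewrite divr_gt0 ?normr_gt0.
exists (Num.min eps d); first by rewrite lt_min e0.
move=> e p /andP[ep]; rewrite le_min => /andP[ee ed].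
rewrite inE => /orP[/eqP->/= _|ps p0]; last by apply: He => //; rewrite ep.
have : e * `|b| < `|a|.
  move: ed; rewrite ler_pdivlMr// mulrDr mulr1 => ed.
  by apply: lt_le_trans ed; rewrite ltrDr.
rewrite -(gtr0_norm ep) -normrM (gtr0_norm ep); set w := e * b => H.
have [a0'|a0'|a0'] := ltrgtP a 0; last by rewrite a0' eqxx in a0.
  rewrite (ltr0_norm a0') in H; rewrite (ltr0_sg a0') ltr0_sg//.
  by have := ler_norm w; lra.
rewrite (gtr0_norm a0') in H; rewrite (gtr0_sg a0') gtr0_sg//.
by have := ler_norm (- w); rewrite normrN; lra.
Qed.

(** The hyperplanes are left one after the other by moving along the normal [h], each time by too
    little to change a sign already settled. *)
Lemma generic_near (u : V) (P H : seq V) : (forall h, h \in H -> h != 0) ->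
  exists2 e, (forall l, l \in P -> dt l u != 0 -> Num.sg (dt l e) = Num.sg (dt l u))
    & forall h, h \in H -> dt h e != 0.
Proof.
elim: H P => [|h H IH] P h0; first by exists u.
have [|e eP eH] := IH P; first by move=> g gH; apply: h0; rewrite inE gH orbT.
have [he|he] := eqVneq (dt h e) 0; last first.
  by exists e => // g; rewrite inE => /orP[/eqP->|/eH].
have [eps e0 He] := small_shift [seq (dt g e, dt g h) | g <- P ++ H].
exists (e + eps *: h) => [l lP lu|g].
  rewrite dotDr dotZr.
  have := He eps (dt l e, dt l h); rewrite /= => ->.
  - exact: eP.
  - by rewrite e0 lexx.
  - by apply: (map_f (fun g => (dt g e, dt g h))); rewrite mem_cat lP.
  - by rewrite -sgr_eq0 eP// sgr_eq0.
rewrite inE dotDr dotZr => /orP[/eqP->|gH].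
  by rewrite he add0r mulf_neq0 ?gt_eqF// dot_gt0// h0// mem_head.
rewrite -sgr_eq0; have := He eps (dt g e, dt g h); rewrite /= => ->.
- by rewrite sgr_eq0 eH.
- by rewrite e0 lexx.
- by apply: (map_f (fun g => (dt g e, dt g h))); rewrite mem_cat gH orbT.
- exact: eH.
Qed.

Lemma seq_argmax (T : eqType) (s : seq T) (f : T -> K) : s != [::] ->
  exists2 x, x \in s & forall y, y \in s -> f y <= f x.
Proof.
elim: s => // a [_ _|b s /(_ isT)[x xs Hx] _].
  by exists a => [|y]; rewrite ?mem_head// inE => /eqP->.
have [fxa|/ltW fax] := leP (f x) (f a).
  exists a; rewrite ?mem_head// => y; rewrite inE => /orP[/eqP->//|/Hx yx].
  exact: le_trans fxa.
by exists x; rewrite 1?inE ?xs ?orbT// => y; rewrite inE => /orP[/eqP->//|/Hx].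
Qed.

End Euclid.

(** * Roots, chambers, vertices of the zonotope, and sets with long strings *)

Section Roots.
Context {K : realType} {n : nat}.
Local Notation V := 'rV[K]_n.
Variables (G : 'M[K]_n) (hG : euclidean G) (R : {fset V}).
Hypothesis hR : reduced_irreducible_root_system G R.
Local Notation dt := (dot G).
Local Notation cr := (coroot G).
Local Notation rf := (reflection G).
Local Notation dotE := (dotE hG).

Lemma root_gt0 a : a \in R -> 0 < dt a a.
Proof. by move=> aR; rewrite dot_gt0// (root_neq0 hR). Qed.

Lemma dot_root_neq0 a : a \in R -> dt a a != 0.
Proof. by move/root_gt0/lt0r_neq0. Qed.

Lemma dot_corootr a v : dt v (cr a) = 2 / dt a a * dt v a.
Proof. by rewrite /coroot dotZr. Qed.

Lemma dot_corootl a v : dt (cr a) v = 2 / dt a a * dt a v.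
Proof. by rewrite /coroot dotZl. Qed.

Lemma dot_coroot2 a : a \in R -> dt a (cr a) = 2.
Proof. by move=> aR; rewrite dot_corootr divfK// dot_root_neq0. Qed.

Lemma dot_coroot2' a : a \in R -> dt (cr a) a = 2.
Proof. by move=> aR; rewrite dot_sym// dot_coroot2. Qed.

Lemma corootN a : cr (- a) = - cr a.
Proof. by rewrite /coroot dotNl// dotNr// opprK scalerN. Qed.

Lemma coroot_gt0 a : a \in R -> 0 < 2 / dt a a.
Proof. by move=> aR; rewrite divr_gt0// root_gt0. Qed.

Lemma sgr_coroot a e : a \in R -> Num.sg (dt (cr a) e) = Num.sg (dt a e).
Proof. by move=> aR; rewrite dot_corootl sgrM gtr0_sg ?mul1r// coroot_gt0. Qed.

Lemma reflectionE a v : rf a v = v - dt v a *: cr a.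
Proof.
by rewrite /reflection /coroot dotZr// scalerA; congr (_ - _ *: _); rewrite mulrC.
Qed.

Lemma reflectionD a u v : rf a (u + v) = rf a u + rf a v.
Proof. by rewrite /reflection dotDl scalerDl opprD addrACA. Qed.
Lemma reflectionZ a c v : rf a (c *: v) = c *: rf a v.
Proof. by rewrite /reflection dotZl scalerBr scalerA. Qed.
Lemma reflectionN a v : rf a (- v) = - rf a v.
Proof. by rewrite -scaleN1r reflectionZ scaleN1r. Qed.

Lemma reflection_self a : a \in R -> rf a a = - a.
Proof. by move=> aR; rewrite /reflection dot_coroot2// scaler_nat mulr2n opprD addNKr. Qed.

Lemma reflectionK a : a \in R -> involutive (rf a).
Proof.
move=> aR v; rewrite /reflection dotBl dotZl dot_coroot2//; set c := dt v _.
have E : c + (c - c * 2) = 0 by ring.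
by rewrite -addrA -opprD -scalerDl E scale0r subr0.
Qed.

Lemma reflection_dot a u v : a \in R -> dt (rf a u) (rf a v) = dt u v.
Proof.
move=> aR; rewrite /reflection !dotE (dot_sym hG a v).
by field; exact: dot_root_neq0.
Qed.

Lemma reflection_dotl a u v : a \in R -> dt (rf a u) v = dt u (rf a v).
Proof. by move=> aR; rewrite -(reflection_dot u _ aR) reflectionK. Qed.

Lemma reflection_fix a v : dt a v = 0 -> rf a v = v.
Proof. by move=> av; rewrite reflectionE dot_sym// av scale0r subr0. Qed.

Lemma root_opp a : a \in R -> - a \in R.
Proof. by move=> aR; rewrite -reflection_self// (root_refl hR). Qed.

Lemma rootNE a : (- a \in R) = (a \in R).
Proof. by apply/idP/idP => /root_opp; rewrite ?opprK. Qed.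

Lemma reflection_root a b : a \in R -> (rf a b \in R) = (b \in R).
Proof.
move=> aR; apply/idP/idP => [|/(root_refl hR aR)//].
by move/(root_refl hR aR); rewrite reflectionK.
Qed.

Lemma coroot_reflection a b : a \in R -> cr (rf a b) = rf a (cr b).
Proof. by move=> aR; rewrite /coroot reflection_dot// reflectionZ. Qed.

Lemma dot_coroot_int a b : a \in R -> b \in R -> dt (cr a) b \is a Num.int.
Proof. by move=> aR bR; rewrite dot_sym// (root_int hR). Qed.

Lemma root_eqN a : a \in R -> a != - a.
Proof.
move=> aR; rewrite -subr_eq0 opprK -mulr2n -scaler_nat scaler_eq0 pnatr_eq0.
exact: root_neq0 hR _ aR.
Qed.

Lemma root_span0 v : (forall a, a \in R -> dt a v = 0) -> v = 0.
Proof.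
move=> H; apply: (dot_le0 hG).
suff -> : dt v v = 0 by [].
have : v \in <<R>>%VS by rewrite (root_span hR) memvf.
move/(coord_span (X := in_tuple (enum_fset R))) => v_eq.
rewrite {1}v_eq.
rewrite dot_suml big1// => i _; rewrite dotZl H ?mulr0//.
by rewrite mem_nth//; case: i.
Qed.

Lemma big_reflection (T : Type) (idx : T) (op : Monoid.com_law idx) a
    (P : pred V) (F : V -> T) : a \in R ->
  \big[op/idx]_(b <- R | P b) F b = \big[op/idx]_(b <- R | P (rf a b)) F (rf a b).
Proof.
move=> aR; rewrite -(big_map (rf a) P F); apply: perm_big.
apply: uniq_perm; rewrite ?(map_inj_uniq (inv_inj (reflectionK aR))) ?fset_uniq//.
move=> b; rewrite -[b in RHS](reflectionK aR) (mem_map (inv_inj (reflectionK aR))).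
by rewrite reflection_root.
Qed.

Lemma big_opp (T : Type) (idx : T) (op : Monoid.com_law idx)
    (P : pred V) (F : V -> T) :
  \big[op/idx]_(b <- R | P b) F b = \big[op/idx]_(b <- R | P (- b)) F (- b).
Proof.
rewrite -(big_map -%R P F); apply: perm_big.
apply: uniq_perm; rewrite ?(map_inj_uniq oppr_inj) ?fset_uniq//.
by move=> b; rewrite -[b in RHS]opprK (mem_map oppr_inj) rootNE.
Qed.

(** Such a vector lies in an open Weyl chamber; chambers are represented throughout by regular
    vectors. *)
Definition regular e := forall a, a \in R -> dt a e != 0.

Lemma root_nonparallel e a b : regular e -> a \in R -> b \in R ->
  b != a -> b != - a -> dt b e *: a - dt a e *: b != 0.
Proof.
move=> re aR bR ba bNa; rewrite subr_eq0; apply/eqP => E.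
have ae := re a aR; have be := re b bR.
have bE : b = (dt b e / dt a e) *: a.
  by rewrite mulrC -scalerA E scalerA mulVf// scale1r.
have /(root_reduced hR aR) : (dt b e / dt a e) *: a \in R by rewrite -bE.
by case=> H; move: ba bNa; rewrite bE H ?scale1r ?scaleN1r eqxx.
Qed.

Definition kinv (k : V -> K) :=
  forall a b, a \in R -> b \in R -> k (rf a b) = k b.

Lemma kinvN k a : kinv k -> a \in R -> k (- a) = k a.
Proof. by move=> kk aR; rewrite -(kk a a)// reflection_self. Qed.

(** Each pair of opposite roots is counted twice, whence $1/4$: for invariant [k] this is half the
    sum of $k_b b^\vee$ over the roots positive on [e]. For nonnegative [k] and regular [e] it is
    the vertex, maximal in direction [e], of the zonotope spanned by the segments
    $[-k_b b^\vee/2,\,k_b b^\vee/2]$. For $k=m$ and $e=d$ it is $\rho^\vee$. *)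
Definition vertex (k : V -> K) (e : V) : V :=
  4^-1 *: \sum_(b <- R) (Num.sg (dt b e) * k b) *: cr b.

Lemma vtx_sg k e e' : (forall a, a \in R -> Num.sg (dt a e) = Num.sg (dt a e')) ->
  vertex k e = vertex k e'.
Proof.
by move=> H; rewrite /vertex; congr (_ *: _); apply: eq_big_seq => a /H ->.
Qed.

(** The chambers of [e] and [e2] share the wall of [a]; [d0] is a point of that wall on no other
    root hyperplane. *)
Definition adj a e d0 e2 := [/\ a \in R, dt a d0 = 0, dt a e < 0, 0 < dt a e2 &
  forall b, b \in R -> b != a -> b != - a -> [/\ dt b d0 != 0,
    Num.sg (dt b e) = Num.sg (dt b d0) & Num.sg (dt b e2) = Num.sg (dt b d0)]].

Lemma adj_reg a e d0 e2 : adj a e d0 e2 -> regular e /\ regular e2.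
Proof.
case=> aR _ ae ae2 H; split=> b bR.
  have [->|ba] := eqVneq b a; first by rewrite lt_eqF.
  have [->|bNa] := eqVneq b (- a); first by rewrite dotNl oppr_eq0 lt_eqF.
  by have [b0 E _] := H b bR ba bNa; rewrite -sgr_eq0 E sgr_eq0.
have [->|ba] := eqVneq b a; first by rewrite gt_eqF.
have [->|bNa] := eqVneq b (- a); first by rewrite dotNl oppr_eq0 gt_eqF.
by have [b0 _ E] := H b bR ba bNa; rewrite -sgr_eq0 E sgr_eq0.
Qed.

Lemma bigR2 (U : zmodType) (F : V -> U) a : a \in R ->
  (forall b, b \in R -> b != a -> b != - a -> F b = 0) ->
  \sum_(b <- R) F b = F a + F (- a).
Proof.
move=> aR H; rewrite (big_fsetD1 a)//= (big_fsetD1 (- a)) /=; last first.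
  by rewrite !inE root_opp// eq_sym root_eqN.
rewrite big1_seq ?addr0// => b; rewrite !inE /= => /andP[b1 /andP[b2 bR]].
exact: H.
Qed.

(** Only the terms of [a] and [- a] change sign across the wall. *)
Lemma vtx_adj k a e d0 e2 : kinv k -> adj a e d0 e2 ->
  vertex k e2 = vertex k e + k a *: cr a.
Proof.
move=> kk [aR _ ae ae2 H]; apply/eqP; rewrite addrC -subr_eq; apply/eqP.
rewrite /vertex -scalerBr -sumrB (@bigR2 _ _ a)// => [|b bR ba bNa]; last first.
  by have [_ -> ->] := H b bR ba bNa; rewrite subrr.
rewrite !dotNl !sgrN (ltr0_sg ae) (gtr0_sg ae2) kinvN// corootN.
apply/rowP => i; rewrite !mxE; field; exact: dot_root_neq0.
Qed.

Lemma sgr_mono (x y : K) : x < y -> Num.sg x <= Num.sg y.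
Proof.
move=> xy; have [x0|x0|x0] := ltrgtP x 0.
- by rewrite (ltr0_sg x0); case: (sgrP y) => //; lra.
- by rewrite (gtr0_sg x0) gtr0_sg// (lt_trans x0).
- by move: xy; rewrite x0 sgr0 => /gtr0_sg ->; rewrite ler01.
Qed.

Lemma dot_vtx k e v :
  dt (vertex k e) v = 4^-1 * \sum_(b <- R) Num.sg (dt b e) * k b * dt (cr b) v.
Proof.
rewrite /vertex dotZl dot_suml; congr (_ * _).
by apply: eq_bigr => b _; rewrite dotZl.
Qed.

(** With the signs taken at [d0] the sum is invariant under the reflection in [a], hence orthogonal
    to [a]. The signs at [e] differ from these only for [a] and [- a]. *)
Lemma vtx_wall k a e d0 e2 : kinv k -> adj a e d0 e2 -> dt (vertex k e) a = - k a.
Proof.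
move=> kk [aR ad0 ae ae2 H]; rewrite dot_vtx.
pose F' b := Num.sg (dt b d0) * k b * dt (cr b) a.
have F'0 : \sum_(b <- R) F' b = 0.
  suff E : \sum_(b <- R) F' b = - \sum_(b <- R) F' b.
    by apply/eqP; rewrite -[_ == 0](mulrn_eq0 _ 2) mulr2n {2}E subrr.
  rewrite {1}(@big_reflection _ _ _ a predT)// -sumrN; apply: eq_big_seq => b bR.
  rewrite /F' coroot_reflection// kk// !reflection_dotl// reflection_self//.
  by rewrite dotNr// reflection_fix// mulrN.
have -> : \sum_(b <- R) Num.sg (dt b e) * k b * dt (cr b) a =
    \sum_(b <- R) (Num.sg (dt b e) * k b * dt (cr b) a - F' b).
  by rewrite sumrB F'0 subr0.
rewrite (@bigR2 _ _ a)// => [|b bR ba bNa]; last first.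
  by have [_ -> _] := H b bR ba bNa; rewrite subrr.
rewrite /F' !(dotNl, dotNr)// corootN (ltr0_sg ae) sgrN (ltr0_sg ae) kinvN// !dotNl//.
by rewrite dot_coroot2'// ad0 sgr0 oppr0 sgr0; field.
Qed.

(** After averaging with the image under the reflection in [a] all summands are nonnegative, because
    $(b,e)$ and $(s_a b,e)$ are ordered according to the sign of $(b,a)$. The summands of [a] and
    [- a] alone give the bound. *)
Lemma vtx_pos k a e : kinv k -> (forall b, b \in R -> 0 <= k b) -> a \in R ->
  0 < dt a e -> k a <= dt (vertex k e) a.
Proof.
move=> kk k0 aR ae; rewrite dot_vtx.
set T := \sum_(b <- R) _.
pose H b := k b * dt (cr b) a * (Num.sg (dt b e) - Num.sg (dt (rf a b) e)).
have ET : T + T = \sum_(b <- R) H b.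
  rewrite {2}/T (@big_reflection _ _ _ a predT)// -big_split /=.
  apply: eq_big_seq => b bR; rewrite /H kk// coroot_reflection//.
  rewrite reflection_dotl// [dt (rf a (cr b)) a]reflection_dotl// reflection_self//.
  by rewrite dotNr//; ring.
have H0 b : b \in R -> 0 <= H b.
  move=> bR; rewrite /H -mulrA mulr_ge0 ?k0//.
  have E : dt (rf a b) e = dt b e - 2 / dt a a * dt b a * dt a e.
    by rewrite /reflection dotBl dotZl dot_corootr.
  have a2 := coroot_gt0 aR; have b2 := coroot_gt0 bR.
  rewrite dot_corootl; have [ba|ba|->] := ltrgtP (dt b a) 0; last first.
  - by rewrite mulr0 mul0r.
  - apply: mulr_ge0; first by rewrite mulr_ge0// ltW.
    have : dt (rf a b) e < dt b e.
      by rewrite E ltrBlDr ltrDl -mulrA pmulr_rgt0// mulr_gt0.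
    by move/sgr_mono; rewrite subr_ge0.
  apply: mulr_le0; first by rewrite pmulr_rle0// ltW.
  have : dt b e < dt (rf a b) e.
    by rewrite E ltrBrDr gtrDl -mulrA pmulr_rlt0// nmulr_rlt0.
  by move/sgr_mono; rewrite subr_le0.
have : H a + H (- a) <= \sum_(b <- R) H b.
  rewrite (big_fsetD1 a)//= (big_fsetD1 (- a)) /=; last first.
    by rewrite !inE root_opp// eq_sym root_eqN.
  rewrite lerD2l lerDl big_seq_cond sumr_ge0// => b.
  by rewrite !inE andbT => /andP[_ /andP[_ bR]]; exact: H0.
rewrite -ET /H reflectionN reflection_self// opprK !dotNl// corootN dotNl//.
rewrite dot_coroot2'// kinvN// sgrN (gtr0_sg ae); lra.
Qed.

(** Induction along a gallery: the ray from [e0] in direction [e'] crosses the walls one at a time,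
    since by the genericity assumption no two nonproportional roots vanish at the same point of it.
    Each step moves to the next wall and slightly beyond, and the number of roots negative at the
    current point but positive at [e'] drops; the walk ends in the chamber of [e']. *)
Lemma path_ind (P : V -> Prop) (e0 e' : V) :
  (forall a e d0 e2 t s, 0 < t -> 0 < s -> d0 = e + t *: e' -> e2 = d0 + s *: e' ->
     adj a e d0 e2 -> P e -> P e2) ->
  regular e0 -> regular e' ->
  (forall a b, a \in R -> b \in R -> b != a -> b != - a ->
     dt a e0 * dt b e' != dt b e0 * dt a e') ->
  P e0 ->
  exists2 e, P e & forall a, a \in R -> Num.sg (dt a e) = Num.sg (dt a e').
Proof.
move=> step; move: {2}(size _) (leqnn (size [seq a <- R | (dt a e0 < 0) && (0 < dt a e')])).
move=> N; elim: N e0 => [|N IH] e0 sN re0 re' gen Pe0.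
  exists e0 => // a aR.
  have nil b : b \in R -> ~~ ((dt b e0 < 0) && (0 < dt b e')).
    move=> bR; apply/negP => bb.
    have : b \in [seq a <- R | (dt a e0 < 0) && (0 < dt a e')] by rewrite mem_filter bb.
    by case: [seq _ <- _ | _] sN.
  have := nil a aR; have := nil (- a) (root_opp aR).
  rewrite !dotNl// oppr_lt0 oppr_gt0.
  have := re0 a aR; have := re' a aR.
  by case: (ltrgtP (dt a e0) 0) => // h1; case: (ltrgtP (dt a e') 0) => // h2 _ _ _ _;
    rewrite ?(ltr0_sg h1) ?(gtr0_sg h1) ?(ltr0_sg h2) ?(gtr0_sg h2).
set L := [seq a <- R | _] in sN.
have [L0|Ln] := eqVneq L [::].
  by apply: (IH e0) => //; rewrite -/L L0.
(* The root [a] vanishes at time minus this quotient, so the largest quotient belongs to the first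
   wall met. *)
have [a aL amin] := seq_argmax (fun a => dt a e0 / dt a e') Ln.
have /andP[/andP[ae0 ae'] aR] : (dt a e0 < 0) && (0 < dt a e') && (a \in R).
  by move: aL; rewrite mem_filter.
pose t := - (dt a e0 / dt a e').
have t0 : 0 < t by rewrite oppr_gt0 pmulr_llt0// invr_gt0.
pose d0 := e0 + t *: e'.
have ad0 : dt a d0 = 0.
  by rewrite /d0 dotDr// dotZr// mulNr divfK ?subrr// gt_eqF.
have key b : b \in R -> b != a -> b != - a -> dt b e0 < 0 -> dt b d0 < 0.
  move=> bR ba bNa be0; rewrite /d0 dotDr// dotZr//.
  have [be'|be'] := ltP 0 (dt b e'); last first.
    by rewrite ltr_wnDr// pmulr_rle0.
  have bL : b \in L by rewrite mem_filter be0 be'.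
  have := amin b bL; rewrite le_eqVlt => /orP[/eqP E|lt].
    have := gen a b aR bR ba bNa; move/eqP: E.
    by rewrite eqr_div ?lt0r_neq0// => /eqP ->; rewrite eqxx.
  rewrite -(ltr_pM2r (x := (dt b e')^-1)) ?invr_gt0// mul0r mulrDl mulfK ?gt_eqF//.
  by rewrite /t subr_lt0.
have key2 b : b \in R -> b != a -> b != - a ->
    dt b d0 != 0 /\ Num.sg (dt b e0) = Num.sg (dt b d0).
  move=> bR ba bNa; have [lt|gt|E] := ltrgtP (dt b e0) 0; last first.
  - by have := re0 b bR; rewrite E eqxx.
  - have : dt (- b) d0 < 0.
      by apply: key; rewrite ?root_opp ?dotNl ?oppr_lt0// eqr_oppLR// opprK.
    by rewrite dotNl// oppr_lt0 => b0; rewrite gt_eqF// !gtr0_sg.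
  - by have b0 := key b bR ba bNa lt; rewrite lt_eqF// !ltr0_sg.
have [s s0 Hs] := small_shift [seq (dt b d0, dt b e') | b <- R].
pose e2 := d0 + s *: e'.
have key3 b : b \in R -> dt b d0 != 0 -> Num.sg (dt b e2) = Num.sg (dt b d0).
  move=> bR b0; rewrite /e2 dotDr// dotZr//.
  apply: (Hs s (dt b d0, dt b e')) => //; first by rewrite s0 lexx.
  exact: (map_f (fun b => (dt b d0, dt b e'))).
have ae2 : 0 < dt a e2 by rewrite /e2 dotDr// ad0 add0r dotZr// mulr_gt0.
have A : adj a e0 d0 e2.
  split => // b bR ba bNa; have [b0 E] := key2 b bR ba bNa.
  by split => //; apply: key3.
have [_ re2] := adj_reg A.
apply: (IH e2) => //.
- rewrite -ltnS; apply: leq_trans sN; set L2 := [seq _ <- _ | _].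
  apply: (@uniq_leq_size _ (a :: L2)).
    by rewrite /= filter_uniq ?fset_uniq// mem_filter (ltNge _ 0) ltW.
  move=> b; rewrite inE => /orP[/eqP->//|].
  rewrite !mem_filter => /andP[/andP[be2 be'] bR]; rewrite be' bR !andbT.
  have ba : b != a by apply: contraTneq be2 => ->; rewrite -leNgt ltW.
  have bNa : b != - a.
    by apply: contraTneq be' => ->; rewrite dotNl// oppr_gt0 -leNgt ltW.
  have [b0 E] := key2 b bR ba bNa.
  by rewrite -sgr_lt0 E -key3// sgr_lt0.
- move=> b c bR cR cb cNb; have := gen b c bR cR cb cNb.
  rewrite /e2 /d0 !dotDr// !dotZr//; apply: contra => /eqP E; apply/eqP; lra.
- exact: (step a e0 d0 e2 t s).
Qed.

(** The ray from [e0] in direction [e'] meets the root hyperplanes one at a time. *)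
Definition generic2 (e0 e' : V) := forall a b, a \in R -> b \in R ->
  b != a -> b != - a -> dt a e0 * dt b e' != dt b e0 * dt a e'.

(** The condition says that [e'] is not orthogonal to $(b,e_0)a-(a,e_0)b$; these vectors are nonzero
    since [R] is reduced, so [generic_near] applies. *)
Lemma generic2_near e0 (P : seq V) u : regular e0 ->
  exists e', [/\ regular e', generic2 e0 e' &
    forall l, l \in P -> dt l u != 0 -> Num.sg (dt l e') = Num.sg (dt l u)].
Proof.
move=> re0.
pose H := enum_fset R ++ [seq h <- [seq dt p.2 e0 *: p.1 - dt p.1 e0 *: p.2 |
  p <- [seq (a, b) | a <- enum_fset R, b <- enum_fset R]] | h != 0].
have [|e' eP eH] := generic_near hG u P (H := H).
  move=> h; rewrite mem_cat mem_filter => /orP[/(root_neq0 hR)//|/andP[]//].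
exists e'; split=> // [a aR|a b aR bR ba bNa]; first by rewrite eH// mem_cat aR.
have := root_nonparallel re0 aR bR ba bNa => h0.
have : dt (dt b e0 *: a - dt a e0 *: b) e' != 0.
  apply: eH; rewrite mem_cat mem_filter h0 /=; apply/orP; right.
  apply/mapP; exists (a, b) => //.
  exact: allpairs_f.
by rewrite dotBl// !dotZl// subr_eq0 eq_sym.
Qed.

(** The combinatorial trace of quasi-invariance: through each point of [S], in each coroot
    direction, there are two points of [S] at integral distance at least [k a]. *)
Definition strings (S : seq V) (k : V -> K) := forall a v, a \in R -> v \in S ->
  exists p j r, [/\ p \in S, p + j *: cr a \in S, k a <= j, p = v + r *: cr a
    & (j \is a Num.int) && (r \is a Num.int)].

(** Crossing the wall of [a] moves the vertex by $k_a a^\vee$, and a string through a maximizer on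
    the wall moves the maximizer of [S] at least as far in direction [e']. So the difference between
    maximizer and vertex, paired with [e'], never decreases. *)
Lemma strings_walk (S : seq V) k e0 e' v : kinv k -> strings S k ->
  regular e0 -> regular e' -> generic2 e0 e' ->
  v \in S -> (forall y, y \in S -> dt y e0 <= dt v e0) ->
  exists2 w, w \in S & dt (v - vertex k e0) e' <= dt (w - vertex k e') e'.
Proof.
move=> kk SP re0 re' gen vS vmax.
pose P e := exists w, [/\ w \in S, forall y, y \in S -> dt y e <= dt w e &
  dt (v - vertex k e0) e' <= dt (w - vertex k e) e'].
have step a e d0 e2 t s : 0 < t -> 0 < s -> d0 = e + t *: e' -> e2 = d0 + s *: e' ->
    adj a e d0 e2 -> P e -> P e2.
  move=> t0 s0 d0E e2E A [w [wS wmax wle]].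
  have Sn : S != [::] by case: (S) vS.
  have [nu nuS numax] := seq_argmax (fun y => dt y d0) Sn.
  have [aR ad0 ae ae2 H] := A.
  have [p [j [r [pS pjS kj pE _]]]] := SP a nu aR nuS.
  have [w2 w2S w2max] := seq_argmax (fun y => dt y e2) Sn.
  exists w2; split; [exact: w2S | exact: w2max |].
  have cad0 : dt (cr a) d0 = 0 by rewrite dot_corootl ad0 mulr0.
  have pd0 : dt p d0 = dt nu d0 by rewrite pE dotDl// dotZl// cad0 mulr0 addr0.
  (* [w] is maximal for [e] and [p] is maximal for [d0], which is [e] plus a positive multiple of
     [e']; subtracting the two inequalities leaves the one along [e']. *)
  have h1 : dt w e' <= dt p e'.
    have := wmax p pS; have := numax w wS; rewrite -pd0 d0E !dotDr// !dotZr//.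
    by move=> x1 x2; rewrite -(ler_pM2l t0); lra.
  have pjd0 : dt (p + j *: cr a) d0 = dt nu d0.
    by rewrite dotDl// dotZl// cad0 mulr0 addr0.
  have h2 : dt (p + j *: cr a) e' <= dt w2 e'.
    have := numax w2 w2S; have := w2max _ pjS; rewrite -pjd0 e2E !(dotDr _ d0)// !dotZr//.
    by move=> x1 x2; rewrite -(ler_pM2l s0); lra.
  have ca : 0 < dt (cr a) e'.
    move: ae2; rewrite e2E dotDr// ad0 add0r dotZr// pmulr_rgt0// => ae'.
    by rewrite dot_corootl mulr_gt0// coroot_gt0.
  apply: le_trans wle _; rewrite (vtx_adj kk A) !dotBl// dotDl// dotZl//.
  move: h2; rewrite dotDl// dotZl// => h2.
  have h3 : k a * dt (cr a) e' <= j * dt (cr a) e' by rewrite ler_pM2r.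
  by lra.
have [|e [w [wS _ wle]] esg] := path_ind step re0 re' gen; first by exists v.
exists w; first exact: wS.
by rewrite -(vtx_sg k esg).
Qed.

(** Were [S] nonempty, its maximizer for [e0] would differ from the vertex. Choose a generic [e']
    close to this difference, so that it pairs positively with it; the walk to [e'] then ends at a
    point of [S] outside the zonotope. *)
Lemma strings_nil (S : seq V) k e0 : kinv k -> strings S k -> regular e0 ->
  (forall e y, regular e -> y \in S -> dt y e <= dt (vertex k e) e) ->
  vertex k e0 \notin S -> S = [::].
Proof.
move=> kk SP re0 hull nS; apply/eqP; apply/negPn/negP => Sn.
have [v vS vmax] := seq_argmax (fun y => dt y e0) Sn.
have y0 : v - vertex k e0 != 0.
  by apply: contraNneq nS => /subr0_eq <-.
have [e' [re' gen esg]] := generic2_near [:: v - vertex k e0] (v - vertex k e0) re0.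
have y1 : 0 < dt (v - vertex k e0) e'.
  by rewrite -sgr_gt0 esg ?mem_head// ?sgr_gt0 ?gt_eqF// dot_gt0.
have [w wS] := strings_walk kk SP re0 re' gen vS vmax.
by have := hull e' w re' wS; rewrite [dt (w - _) _]dotBl//; lra.
Qed.
End Roots.

(** * The complex exponential *)

Section ComplexExp.
Local Open Scope complex_scope.
Context {K : realType}.
Local Notation C := K[i].

Lemma cexpD (u v : C) : cexp (u + v) = cexp u * cexp v.
Proof.
case: u v => [a b] [c d]; rewrite /cexp /= expRD cosD sinD; simpc.
by apply/eqP; rewrite eq_complex /=; apply/andP; split; apply/eqP; ring.
Qed.

Lemma cexp0 : cexp (0 : C) = 1.
Proof. by rewrite /cexp /= expR0 cos0 sin0 mul1r. Qed.

Lemma cexpNK (u : C) : cexp u * cexp (- u) = 1.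
Proof. by rewrite -cexpD subrr cexp0. Qed.

Lemma cexp_neq0 (u : C) : cexp u != 0.
Proof.
by apply/eqP => u0; have := cexpNK u; rewrite u0 mul0r => /eqP; rewrite eq_sym oner_eq0.
Qed.

Lemma cexpN (u : C) : cexp (- u) = (cexp u)^-1.
Proof. by apply: (mulfI (cexp_neq0 u)); rewrite cexpNK divff ?cexp_neq0. Qed.

Lemma cexp_nat (u : C) k : cexp (u *+ k) = cexp u ^+ k.
Proof. by elim: k => [|k IH]; rewrite ?mulr0n ?cexp0// mulrS exprS cexpD IH. Qed.

Lemma cexp_eq1_small (u : C) : cexp u = 1 -> `|complex.Im u| < pi -> u = 0.
Proof.
case: u => a b; rewrite /cexp /=; simpc => -[ha hb] bpi.
have sb : sin b = 0.
  by apply/eqP; move/eqP: hb; rewrite mulf_eq0 gt_eqF ?expR_gt0.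
have cb : cos b ^+ 2 = 1 by have := cos2Dsin2 b; rewrite sb expr0n /= addr0.
have cb1 : cos b = 1.
  have : 0 < cos b by rewrite -(pmulr_rgt0 _ (expR_gt0 a)) ha.
  by move: cb => /eqP; rewrite sqrf_eq1 => /orP[/eqP->//|/eqP-> /lt_gtF]; rewrite oppr_lt0 ltr01.
have ea : expR a = 1 by move: ha; rewrite cb1 mulr1.
have a0 : a = 0 by move: (expRK a); rewrite ea ln1.
have nb : `|b| = 0.
  apply: (@cos_inj K); rewrite ?in_itv /=.
  - by rewrite normr_ge0 ltW.
  - by rewrite lexx pi_ge0.
  by rewrite cos_norm cos0.
by move/normr0P: nb => /eqP ->; rewrite a0.
Qed.

Lemma cexp_surj (w : C) : w != 0 -> exists u, cexp u = w.
Proof.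
case: w => a b w0.
pose r := Num.sqrt (a ^+ 2 + b ^+ 2).
have r0 : 0 < r.
  rewrite sqrtr_gt0 lt_neqAle eq_sym addr_ge0 ?sqr_ge0// andbT.
  by apply: contra w0; rewrite paddr_eq0 ?sqr_ge0// !sqrf_eq0 eq_complex.
have rr : r ^+ 2 = a ^+ 2 + b ^+ 2 by rewrite sqr_sqrtr// addr_ge0 ?sqr_ge0.
have ar : -1 <= a / r <= 1.
  rewrite -ler_norml normrM normfV (gtr0_norm r0) ler_pdivrMr// mul1r.
  by rewrite -sqrtr_sqr ler_wsqrtr// lerDl sqr_ge0.
have sE : sin (acos (a / r)) = `|b| / r.
  rewrite sin_acos//; have -> : 1 - (a / r) ^+ 2 = (b / r) ^+ 2.
    rewrite !exprMn exprVn rr; field; rewrite -rr expf_neq0// gt_eqF//.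
  by rewrite sqrtr_sqr normrM normfV (gtr0_norm r0).
have cE : cos (acos (a / r)) = a / r by rewrite acosK// in_itv.
exists (ln r +i* (if 0 <= b then acos (a / r) else - acos (a / r))).
rewrite /cexp /= lnK ?posrE//; case: ifP => b0.
  by rewrite cE sE ger0_norm//; simpc; rewrite ![r * _]mulrC !divfK// gt_eqF.
have b0' : b < 0 by rewrite ltNge b0.
by rewrite cosN sinN cE sE ltr0_norm//; simpc; rewrite ![r * _]mulrC !divfK// gt_eqF.
Qed.

End ComplexExp.

(* The exponential is only used through this interface: computing with the
   concrete complex exponential makes conversion checks explode. *)
Structure qchar (K : realType) (C : fieldType) := QChar {
  qemb : {rmorphism K -> C};
  qfun :> C -> C;
  _ : forall a b, qfun (a + b) = qfun a * qfun b;
  _ : forall a, qfun a != 0;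
  _ : forall r, r \is a Num.int -> r != 0 -> qfun (qemb r) != 1;
  _ : exists2 k, qfun k = 1 &
        forall r, qfun (qemb r * k) = 1 -> r \is a Num.int }.

(** * Exponential sums and independence of characters *)

Section Qpow.
Context {K : realType} {C : fieldType} {n : nat}.
Local Notation V := 'rV[K]_n.
Local Notation VC := 'rV[C]_n.
Variables (G : 'M[K]_n) (hG : euclidean G) (Q : qchar K C).
Local Notation dt := (dot G).
Local Notation f := (qemb Q).

Definition qdot (x z : VC) : C := (x *m map_mx f G *m z^T) 0 0.
Definition qvec (v : V) : VC := map_mx f v.
Definition qbr (a : C) : C := Q a - Q (- a).
Local Notation dc := qdot.
Local Notation br := qbr.

Lemma qpD a b : Q (a + b) = Q a * Q b.
Proof. by case: (Q). Qed.
Lemma qp_neq0 a : Q a != 0.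
Proof. by case: (Q). Qed.
Lemma qp_int r : r \is a Num.int -> r != 0 -> Q (f r) != 1.
Proof. by case: (Q) => ? ? ? ? h ?; apply: h. Qed.
Lemma qp_period : exists2 k, Q k = 1 & forall r, Q (f r * k) = 1 -> r \is a Num.int.
Proof. by case: (Q). Qed.
Lemma qp0 : Q 0 = 1.
Proof. by apply: (mulfI (qp_neq0 0)); rewrite -qpD addr0 mulr1. Qed.
Lemma qpN a : Q (- a) = (Q a)^-1.
Proof. by apply: (mulfI (qp_neq0 a)); rewrite -qpD subrr qp0 divff ?qp_neq0. Qed.
Lemma qpB a b : Q (a - b) = Q a / Q b.
Proof. by rewrite qpD qpN. Qed.
Lemma qpMn a k : Q (k%:R * a) = Q a ^+ k.
Proof.
elim: k => [|k IH]; first by rewrite mul0r qp0.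
by rewrite -addn1 natrD mulrDl mul1r qpD IH addn1 exprSr.
Qed.
Lemma qp_sum (I : Type) (r : seq I) (P : pred I) (F : I -> C) :
  Q (\sum_(i <- r | P i) F i) = \prod_(i <- r | P i) Q (F i).
Proof. by elim/big_rec2: _ => [|i y z _ <-]; rewrite ?qp0 ?qpD. Qed.

Lemma qp_intz r y : r \is a Num.int -> Q y = 1 -> Q (f r * y) = 1.
Proof.
move=> /intrP[[k|k] ->] Qy; first by rewrite -[_%:~R]/(k%:R) rmorph_nat qpMn Qy expr1n.
rewrite NegzE mulrNz rmorphN mulNr qpN -[_%:~R]/(k.+1%:R) rmorph_nat qpMn Qy.
by rewrite expr1n invr1.
Qed.

Lemma f2_neq0 : 2 != 0 :> C.
Proof. by rewrite -(rmorph_nat f) fmorph_eq0 pnatr_eq0. Qed.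

Lemma nat_neq0 k : k.+1%:R != 0 :> C.
Proof. by rewrite -(rmorph_nat f) fmorph_eq0 pnatr_eq0. Qed.

Lemma brN a : br (- a) = - br a.
Proof. by rewrite /qbr opprK opprB. Qed.

Lemma br_eq0 a : (br a == 0) = (Q (2 * a) == 1).
Proof.
rewrite /qbr subr_eq0 qpN -(inj_eq (mulIf (qp_neq0 a))) mulVf ?qp_neq0//.
by rewrite qpMn expr2.
Qed.

Lemma qvecD u v : qvec (u + v) = qvec u + qvec v.
Proof. exact: map_mxD. Qed.
Lemma qvecN v : qvec (- v) = - qvec v.
Proof. exact: map_mxN. Qed.
Lemma qvecB u v : qvec (u - v) = qvec u - qvec v.
Proof. exact: map_mxB. Qed.
Lemma qvec0 : qvec 0 = 0.
Proof. exact: map_mx0. Qed.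
Lemma qvecZ a v : qvec (a *: v) = f a *: qvec v.
Proof. exact: map_mxZ. Qed.

Lemma dcDl x y z : dc (x + y) z = dc x z + dc y z.
Proof. by rewrite /qdot !mulmxDl mxE. Qed.
Lemma dcZl a x z : dc (a *: x) z = a * dc x z.
Proof. by rewrite /qdot -!scalemxAl mxE. Qed.
Lemma dcC x y : dc x y = dc y x.
Proof.
have [GT _] := hG; rewrite /qdot -[in RHS]GT -map_trmx.
have -> : y *m (map_mx f G)^T *m x^T = (x *m map_mx f G *m y^T)^T.
  by rewrite !trmx_mul trmxK mulmxA.
by rewrite [RHS]mxE.
Qed.
Lemma dcDr x y z : dc z (x + y) = dc z x + dc z y.
Proof. by rewrite !(dcC z) dcDl. Qed.
Lemma dcZr a x z : dc z (a *: x) = a * dc z x.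
Proof. by rewrite !(dcC z) dcZl. Qed.
Lemma dcNl x z : dc (- x) z = - dc x z.
Proof. by rewrite -scaleN1r dcZl mulN1r. Qed.
Lemma dcNr x z : dc z (- x) = - dc z x.
Proof. by rewrite -scaleN1r dcZr mulN1r. Qed.
Lemma dcBl x y z : dc (x - y) z = dc x z - dc y z.
Proof. by rewrite dcDl dcNl. Qed.
Lemma dcBr x y z : dc z (x - y) = dc z x - dc z y.
Proof. by rewrite dcDr dcNr. Qed.
Lemma dc0l z : dc 0 z = 0.
Proof. by rewrite -(scale0r 0) dcZl mul0r. Qed.
Lemma dc0r z : dc z 0 = 0.
Proof. by rewrite dcC dc0l. Qed.
Lemma dc_real u v : dc (qvec u) (qvec v) = f (dt u v).
Proof. by rewrite /qdot /dot /qvec -map_mxM map_trmx -map_mxM [LHS]mxE. Qed.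
Lemma dc_suml (I : Type) (r : seq I) (P : pred I) (F : I -> VC) z :
  dc (\sum_(i <- r | P i) F i) z = \sum_(i <- r | P i) dc (F i) z.
Proof. by elim/big_rec2: _ => [|i y u _ <-]; rewrite ?dc0l ?dcDl. Qed.
Lemma qvec_sum (I : Type) (r : seq I) (P : pred I) (F : I -> V) :
  qvec (\sum_(i <- r | P i) F i) = \sum_(i <- r | P i) qvec (F i).
Proof. by elim/big_rec2: _ => [|i y u _ <-]; rewrite ?qvec0 ?qvecD. Qed.

Definition qexp (v : V) (z : VC) : C := Q (2 * dc (qvec v) z).

Lemma qexpDl u v z : qexp (u + v) z = qexp u z * qexp v z.
Proof. by rewrite /qexp qvecD dcDl mulrDr qpD. Qed.
Lemma qexpDr v y z : qexp v (y + z) = qexp v y * qexp v z.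
Proof. by rewrite /qexp dcDr mulrDr qpD. Qed.
Lemma qexp0l z : qexp 0 z = 1.
Proof. by rewrite /qexp qvec0 dc0l mulr0 qp0. Qed.
Lemma qexp0r v : qexp v 0 = 1.
Proof. by rewrite /qexp dc0r mulr0 qp0. Qed.
Lemma qexpNl v z : qexp (- v) z = (qexp v z)^-1.
Proof. by rewrite /qexp qvecN dcNl mulrN qpN. Qed.
Lemma qexpNr v z : qexp v (- z) = (qexp v z)^-1.
Proof. by rewrite /qexp dcNr mulrN qpN. Qed.
Lemma qexp_neq0 v z : qexp v z != 0.
Proof. exact: qp_neq0. Qed.

(** An exponential sum is a list of coefficient-exponent pairs in which exponents may repeat; [cf]
    collects the total coefficient of one exponent. *)
Definition qev (s : seq (C * V)) (z : VC) : C := \sum_(p <- s) p.1 * qexp p.2 z.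
Definition cf (s : seq (C * V)) (v : V) : C := \sum_(p <- s | p.2 == v) p.1.

(* Independence of the characters of a subgroup H of VC. *)
Lemma characters_indep (H : VC -> Prop) (s : seq (C * V)) (v : V) :
  H 0 -> (forall y z, H y -> H z -> H (y + z)) ->
  (forall z, H z -> qev s z = 0) ->
  \sum_(p <- s | `[< forall z, H z -> qexp p.2 z = qexp v z >]) p.1 = 0.
Proof.
move=> H0 HD; move: {2}(size s) (leqnn (size s)) => N.
elim: N s => [|N IH] s; first by rewrite leqn0 size_eq0 => /eqP-> _; rewrite big_nil.
move=> sN Hs.
have [/allP all|] := boolP (all (fun p => `[< forall z, H z -> qexp p.2 z = qexp v z >]) s).
  rewrite big_seq_cond -[RHS](Hs 0 H0) /qev big_seq; apply: eq_big => p.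
    by case: (boolP (p \in s)) => //= /all.
  by move=> _; rewrite qexp0r mulr1.
case/allPn => p0 p0s /asboolPn /existsNP [h /not_implyP [Hh hne]].
pose s' := [seq (p.1 * (qexp p.2 h - qexp p0.2 h), p.2) | p <- rem p0 s].
have evs' z : H z -> qev s' z = 0.
  move=> Hz; rewrite /qev big_map /=.
  have : \sum_(p <- s) p.1 * (qexp p.2 h - qexp p0.2 h) * qexp p.2 z = 0.
    rewrite (eq_bigr (fun p => p.1 * qexp p.2 (h + z) - p.1 * qexp p.2 z * qexp p0.2 h));
      last by move=> p _; rewrite qexpDr; ring.
    rewrite sumrB -mulr_suml -[X in X - _]/(qev s (h + z)) -[X in _ - X * _]/(qev s z).
    by rewrite !Hs ?mul0r ?subr0//; exact: HD.
  by rewrite (big_rem p0)//= subrr mulr0 mul0r add0r.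
have := IH s' _ evs'; rewrite size_map size_rem// big_map /= => /(_ _).
have -> : ((size s).-1 <= N)%N by case: (size s) sN.
move/(_ isT) => E.
rewrite (big_rem p0)//= ifF; last by apply/asboolP => /(_ h Hh).
have v0 : qexp v h - qexp p0.2 h != 0.
  by rewrite subr_eq0 eq_sym; apply/eqP.
apply: (mulIf v0); rewrite add0r mul0r -[RHS]E mulr_suml; apply: eq_bigr => p /asboolP.
by move/(_ h Hh) => ->.
Qed.

(** Distinct exponents define distinct characters: for $w\ne0$ the character of [w] takes the value
    $q\ne1$ at $w/(2(w,w))$. *)
Lemma cf_eq0 s : (forall z, qev s z = 0) -> forall v, cf s v = 0.
Proof.
move=> Hs v; rewrite -[RHS](@characters_indep (fun=> True) s v)//.
apply: eq_bigl => p; apply/eqP/asboolP => [->//|] /(_ _ I) H.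
have H' z : qexp (p.2 - v) z = 1 by rewrite qexpDl qexpNl H divff ?qexp_neq0.
apply/subr0_eq; set w := p.2 - v in H' *; apply: (dot_le0 hG).
have [->//|w0] := eqVneq w 0; first by rewrite dot0l.
have ww := dot_gt0 hG w0.
have := H' (f (2^-1 / dt w w) *: qvec w).
rewrite /qexp dcZr dc_real -rmorphM divfK ?gt_eqF//.
have -> : 2 * f 2^-1 = f 1 by rewrite -(rmorph_nat f) -rmorphM divff ?pnatr_eq0.
by move/eqP; rewrite (negPf (qp_int _ _)) ?rpred1 ?oner_neq0.
Qed.

End Qpow.

(** * Vanishing moments force many points *)

Section FewPoints.
Context {C : fieldType}.

(** Vandermonde argument: with at most [k] nodes, the product of the $X-v_j$ over all nodes but one
    has degree below [k], and its vanishing weighted sum isolates the term of the remaining node. *)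
Lemma few_points (T : eqType) (J : seq T) (a v : T -> C) k : uniq J ->
  J != [::] -> {in J &, injective v} -> (forall j, j \in J -> a j != 0) ->
  (forall r, (r < k)%N -> \sum_(j <- J) a j * v j ^+ r = 0) -> (k < size J)%N.
Proof.
case: J => // j0 J uJ _ vinj a0 Hr; rewrite ltnNge; apply/negP => sJ.
pose p := \prod_(j <- J) ('X - (v j)%:P).
have Hp : \sum_(j <- j0 :: J) a j * p.[v j] = 0.
  under eq_bigr => j _ do rewrite horner_coef mulr_sumr.
  rewrite exchange_big /= big1// => i _.
  under eq_bigr => j _ do rewrite mulrCA.
  rewrite -mulr_sumr Hr ?mulr0//; apply: leq_trans (ltn_ord i) _.
  by rewrite size_prod_XsubC.
move: Hp; rewrite big_cons big1_seq ?addr0; last first.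
  move=> j /= jJ; rewrite /p horner_prod (big_rem j jJ) /= hornerXsubC subrr.
  by rewrite mul0r mulr0.
apply/eqP; rewrite mulf_neq0 ?a0 ?mem_head//.
rewrite /p horner_prod prodf_seq_neq0; apply/allP => j jJ /=.
rewrite hornerXsubC subr_eq0; apply/eqP => /vinj; rewrite mem_head inE jJ orbT.
by move=> /(_ isT isT) E; move: uJ; rewrite /= E jJ.
Qed.

(* Chebyshev-like recursions in u + 1/u. *)
Lemma antisym_moments (T : Type) (J : seq T) (P : pred T) (c u : T -> C) k :
  (forall j, u j != 0) ->
  (forall i, (1 <= i <= k)%N -> \sum_(j <- J | P j) c j * (u j ^+ i - u j ^- i) = 0) ->
  forall r, (r < k)%N ->
    \sum_(j <- J | P j) c j * (u j - (u j)^-1) * (u j + (u j)^-1) ^+ r = 0.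
Proof.
move=> u0 H.
have key r i : (i + r <= k)%N ->
    \sum_(j <- J | P j) c j * (u j ^+ i - u j ^- i) * (u j + (u j)^-1) ^+ r = 0.
  elim: r i => [|r IH] [|i].
  - by move=> _; rewrite big1// => j _; rewrite expr0 invr1 subrr mulr0 mul0r.
  - by rewrite addn0 => ik; under eq_bigr => j _ do rewrite expr0 mulr1; rewrite H.
  - by move=> _; rewrite big1// => j _; rewrite expr0 invr1 subrr mulr0 mul0r.
  move=> ik; have h1 : (i.+2 + r <= k)%N by move: ik; rewrite !addSn !addnS.
  have h2 : (i + r <= k)%N by apply: leq_trans h1; rewrite leq_add2r; lia.
  transitivity (\sum_(j <- J | P j) (c j * (u j ^+ i.+2 - u j ^- i.+2) * (u j + (u j)^-1) ^+ r
     + c j * (u j ^+ i - u j ^- i) * (u j + (u j)^-1) ^+ r)); last first.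
    by rewrite big_split /= IH// IH// addr0.
  apply: eq_bigr => j _; rewrite [_ ^+ r.+1]exprS !exprSr; have := u0 j => uj.
  by field; rewrite expf_neq0.
move=> r rk; rewrite -[RHS](key r 1%N rk).
by apply: eq_bigr => j _; rewrite expr1.
Qed.

Lemma sym_moments (T : Type) (J : seq T) (P : pred T) (c u : T -> C) k :
  2 != 0 :> C -> (forall j, u j != 0) ->
  (forall i, (i <= k)%N -> \sum_(j <- J | P j) c j * (u j ^+ i + u j ^- i) = 0) ->
  forall r, (r < k.+1)%N -> \sum_(j <- J | P j) c j * (u j + (u j)^-1) ^+ r = 0.
Proof.
move=> two u0 H.
have key r i : (i + r <= k)%N ->
    \sum_(j <- J | P j) c j * (u j ^+ i + u j ^- i) * (u j + (u j)^-1) ^+ r = 0.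
  elim: r i => [|r IH] [|i].
  - by rewrite addn0 => ik; under eq_bigr => j _ do rewrite [X in _ * X]expr0 mulr1; rewrite H.
  - by rewrite addn0 => ik; under eq_bigr => j _ do rewrite [X in _ * X]expr0 mulr1; rewrite H.
  - move=> ik; have h : (1 + r <= k)%N by move: ik; rewrite !addSn !addnS.
    rewrite -[RHS](mulr0 2) -[X in _ * X](IH 1%N h).
    rewrite mulr_sumr; apply: eq_bigr => j _; rewrite exprS expr0 expr1 invr1.
    by rewrite -[1 + 1]/(2); ring.
  move=> ik; have h1 : (i.+2 + r <= k)%N by move: ik; rewrite !addSn !addnS.
  have h2 : (i + r <= k)%N by apply: leq_trans h1; rewrite leq_add2r; lia.
  transitivity (\sum_(j <- J | P j) (c j * (u j ^+ i.+2 + u j ^- i.+2) * (u j + (u j)^-1) ^+ r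
     + c j * (u j ^+ i + u j ^- i) * (u j + (u j)^-1) ^+ r)); last first.
    by rewrite big_split /= IH// IH// addr0.
  apply: eq_bigr => j _; rewrite [_ ^+ r.+1]exprS !exprSr; have := u0 j => uj.
  by field; rewrite expf_neq0.
move=> r rk; apply: (mulfI two); rewrite mulr0 -[RHS](key r 0%N)// mulr_sumr.
by apply: eq_bigr => j _; rewrite expr0 invr1 -[1 + 1]/(2); ring.
Qed.
End FewPoints.

(** Pigeonhole: above the minimum [i], only [k] integers are smaller than [i + k]. *)
Lemma int_spread (L : seq int) k : uniq L -> (k < size L)%N ->
  exists i j, [/\ i \in L, j \in L & i + k%:Z <= j].
Proof.
move=> uL; case: L uL => // i0 L uL kL.
have [i iL imin] : exists2 i, i \in i0 :: L & forall j, j \in i0 :: L -> i <= j.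
  elim: L i0 {uL kL} => [|j L IH] i0.
    by exists i0; rewrite ?mem_head// => j; rewrite inE => /eqP ->.
  have [i iL im] := IH j; have [ii|/ltW ii] := leP i i0.
    exists i; first by rewrite inE iL orbT.
    by move=> l; rewrite inE => /orP[/eqP->//|/im].
  exists i0; first exact: mem_head.
  move=> l; rewrite inE => /orP[/eqP->//|/im]; exact: le_trans.
have [/hasP[j jL ij]|/hasPn H] := boolP (has (fun j => i + k%:Z <= j) (i0 :: L)).
  by exists i, j.
suff : (size (i0 :: L) <= k)%N by rewrite leqNgt kL.
rewrite -(size_iota 0 k) -(size_map (fun l => i + l%:Z)); apply: uniq_leq_size => // j jL.
have := imin j jL; have := H j jL; rewrite -ltNge => j1 j2.
apply/mapP; exists `|j - i|%N; last by rewrite gez0_abs ?subr_ge0// [RHS]addrC subrK.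
by rewrite mem_iota /= add0n -ltz_nat gez0_abs ?subr_ge0// ltrBlDl.
Qed.

(** * From quasi-invariance to long strings in the support *)

Section Strings.
Context {K : realType} {C : fieldType} {n : nat}.
Local Notation V := 'rV[K]_n.
Variables (G : 'M[K]_n) (hG : euclidean G) (Q : qchar K C) (R : {fset V}).
Hypothesis hR : reduced_irreducible_root_system G R.
Local Notation dt := (dot G).
Local Notation cr := (coroot G).
Local Notation f := (qemb Q).
Local Notation dc := (qdot G Q).
Local Notation qv := (qvec Q).
Local Notation E := (qexp G Q).
Local Notation ev := (qev G Q).

(** The set on which quasi-invariance at [a] is imposed. *)
Definition wall a z := E (cr a) z = 1.

Definition coset a v u : bool :=
  `[< exists2 j : K, j \is a Num.int & u = v + j *: cr a >].

Lemma cosetxx a v : coset a v v.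
Proof. by apply/asboolP; exists 0; rewrite ?rpred0// scale0r addr0. Qed.

Lemma coset_eq a v u w : coset a v u -> coset a v w = coset a u w.
Proof.
move=> /asboolP[j ji ->]; apply/asboolP/asboolP => -[l li ->].
  by exists (l - j); rewrite ?rpredB// -addrA -scalerDl [j + _]addrC subrK.
by exists (j + l); rewrite ?rpredD// scalerDl addrA.
Qed.

(** Real points orthogonal to [a] lie on the wall and show that [u - v] is a multiple of [cr a]. A
    quarter of a period of [Q], taken in direction [a], lies on the wall as well and shows that the
    multiple is integral. *)
Lemma wall_coset a u v : a \in R -> (forall z, wall a z -> E u z = E v z) ->
  coset a v u.
Proof.
move=> aR H; apply/asboolP; pose w := u - v.
have Hw z : wall a z -> E w z = 1.
  by move=> /H Hz; rewrite /w qexpDl qexpNl Hz divff ?qexp_neq0.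
pose w' := w - (dt w a / 2) *: cr a.
have w'a : dt (cr a) w' = 0.
  rewrite /w' dotBr// dotZr// dot_corootl {2}/coroot dotZr// dot_corootl.
  rewrite (dot_sym hG w a) mulrA; have := dot_root_neq0 hG hR aR => aa.
  by field.
have w'0 : w' = 0.
  apply: (dot_le0 hG); have [->//|w'0] := eqVneq w' 0; first by rewrite dot0l.
  have ww := dot_gt0 hG w'0.
  have ww' : dt w w' = dt w' w'.
    by rewrite {2}/w' [dt (_ - _ *: _) _]dotBl// dotZl// w'a mulr0 subr0.
  have Hz t : E w (f t *: qv w') = 1.
    by apply: Hw; rewrite /wall /qexp dcZr// dc_real w'a rmorph0 !mulr0 qp0.
  have := Hz (2^-1 / dt w' w').
  rewrite /qexp dcZr// dc_real -rmorphM ww' divfK ?gt_eqF//.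
  have -> : 2 * f 2^-1 = f 1 by rewrite -(rmorph_nat f) -rmorphM divff ?pnatr_eq0.
  by move/eqP; rewrite (negPf (qp_int _ _ _)) ?rpred1 ?oner_neq0.
have wE : w = (dt w a / 2) *: cr a by apply/eqP; rewrite -subr_eq0 -w'0.
exists (dt w a / 2); last by rewrite -wE addrC subrK.
have [k Qk kint] := qp_period Q; apply: kint.
have aa := dot_root_neq0 hG hR aR.
have : E w ((k / 4) *: qv a) = 1.
  apply: Hw; rewrite /wall /qexp dcZr// dc_real (dot_coroot2' hG hR aR) rmorph_nat -[RHS]Qk.
  by congr (Q _); field; exact: (nat_neq0 Q 3).
rewrite {1}wE /qexp qvecZ dcZl dcZr// dc_real (dot_coroot2' hG hR aR) rmorph_nat => <-.
rewrite rmorphM fmorphV rmorph_nat.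
by congr (Q _); field; rewrite (nat_neq0 Q 3) (nat_neq0 Q 1).
Qed.

Definition supp (s : seq (C * V)) : seq V :=
  [seq v <- undup (map snd s) | cf s v != 0].

Lemma sum_supp (s : seq (C * V)) (P : pred V) (h : V -> C) :
  \sum_(p <- s | P p.2) p.1 * h p.2 = \sum_(v <- supp s | P v) cf s v * h v.
Proof.
rewrite /supp big_filter_cond.
transitivity (\sum_(v <- undup (map snd s) | P v) cf s v * h v); last first.
  rewrite big_mkcond [RHS]big_mkcond; apply: eq_bigr => v _ /=.
  by case: eqVneq => //= ->; rewrite mul0r; case: ifP.
rewrite /cf; under [RHS]eq_bigr do rewrite mulr_suml.
rewrite (exchange_big_dep xpredT) //= big_mkcond big_seq [RHS]big_seq.
apply: eq_bigr => p ps; case: ifP => Pp.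
  rewrite (eq_bigl (pred1 p.2)); last first.
    by move=> v /=; rewrite eq_sym; case: eqVneq => [->|]; rewrite ?Pp ?andbF.
  have pU : p.2 \in undup (map snd s) by rewrite mem_undup map_f.
  by rewrite -big_filter filter_pred1_uniq ?undup_uniq// big_seq1.
by rewrite big1// => v /andP[Pv /eqP E]; rewrite E Pv in Pp.
Qed.

Lemma coset_floor a v u : a \in R -> coset a v u ->
  u = v + (Num.floor (dt (u - v) a / 2))%:~R *: cr a.
Proof.
move=> aR /asboolP [j ji ->]; have -> : v + j *: cr a - v = j *: cr a.
  by rewrite addrC addKr.
rewrite dotZl (dot_coroot2' hG hR aR).
by rewrite mulfK ?pnatr_eq0// floorK.
Qed.

(** On each coset the support carries nonzero weights [cf s u * A a u] at distinct nodes [U a u]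
    with [k a] vanishing moments, so it has more than [k a] points there, two of which are [k a]
    steps apart. *)
Lemma moments_strings (s : seq (C * V)) (k : V -> nat) (A U : V -> V -> C) :
  (forall a v r, a \in R -> v \in supp s -> (r < k a)%N ->
     \sum_(p <- s | coset a v p.2) p.1 * (A a p.2 * U a p.2 ^+ r) = 0) ->
  (forall a v, a \in R -> v \in supp s -> A a v != 0) ->
  (forall a v u, a \in R -> v \in supp s -> u \in supp s ->
     (exists2 j : K, j \is a Num.int & u = v + j *: cr a) -> U a v = U a u -> v = u) ->
  strings G R (supp s) (fun a => (k a)%:R).
Proof.
move=> H A0 Uinj a v aR vS.
pose J := [seq u <- supp s | coset a v u].
have uJ : uniq J by rewrite !filter_uniq// undup_uniq.
have JP u : u \in J -> u \in supp s /\ coset a v u by rewrite mem_filter => /andP[].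
have kJ : (k a < size J)%N.
  apply: (@few_points _ _ J (fun u => cf s u * A a u) (U a)) => //.
  - apply/eqP => J0; suff : v \in J by rewrite J0.
    by rewrite mem_filter cosetxx.
  - move=> u w /JP[uS /asboolP[j ji uE]] /JP[wS /asboolP[l li wE]].
    apply: Uinj => //; exists (l - j); first by rewrite rpredB.
    by rewrite wE uE; apply/rowP => i; rewrite !mxE; ring.
  - move=> u /JP[uS _]; rewrite mulf_neq0 ?A0//.
    by move: uS; rewrite mem_filter => /andP[].
  - move=> r rk; rewrite /J big_filter -[RHS](H a v r)//.
    rewrite (sum_supp s (coset a v) (fun u => A a u * U a u ^+ r)).
    by apply: eq_bigr => u _; rewrite mulrA.
pose g u := Num.floor (dt (u - v) a / 2).
have gE u : u \in J -> u = v + (g u)%:~R *: cr a.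
  by move=> /JP[_ /coset_floor]; apply.
have uL : uniq [seq g u | u <- J].
  rewrite map_inj_in_uniq// => u w uJ' wJ' E; rewrite (gE u uJ') (gE w wJ').
  by rewrite E.
have [|i [j []]] := @int_spread _ (k a) uL; first by rewrite size_map.
move=> /mapP[u uJ' ->] /mapP[w wJ' ->] le.
exists u, ((g w)%:~R - (g u)%:~R), (g u)%:~R; split.
- by case: (JP _ uJ').
- suff -> : u + ((g w)%:~R - (g u)%:~R) *: cr a = w by case: (JP _ wJ').
  have := gE u uJ'; have := gE w wJ'; move: (g u)%:~R (g w)%:~R => x y -> ->.
  by apply/rowP => l; rewrite !mxE; ring.
- by rewrite /= lerBrDl -[(k a)%:R]/((k a)%:Z%:~R) -intrD ler_int.
- exact: gE.
- by rewrite rpredB ?intr_int.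
Qed.

(** Genericity of [x], used to keep the nodes $u+u^{-1}$ on a coset distinct and the weights
    $u-u^{-1}$ nonzero. *)
Definition gen x := forall a r, a \in R -> r \is a Num.int ->
  Q (4 * dc x (qv a)) != Q (f r).
Definition lat v := forall a, a \in R -> 2 * dt v a \is a Num.int.
(** The factor gained by $q^{2(x+v,z)}$ when $z$ moves by $a/2$. *)
Definition qstr x a v : C := Q (dc x (qv a) + f (dt v a)).

Lemma str_neq0 x a v : qstr x a v != 0.
Proof. exact: qp_neq0. Qed.

(** The square of the product is $q^{4(x,a)}$ times an integral power of $q$, so genericity of [x]
    excludes the value 1. *)
Lemma str_mul x a v u : gen x -> a \in R -> lat v -> lat u ->
  qstr x a v * qstr x a u != 1.
Proof.
move=> gx aR lv lu; apply/eqP => E1.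
have : (qstr x a v * qstr x a u) ^+ 2 = 1 by rewrite E1 expr1n.
rewrite /qstr -qpD -qpMn => E2.
have := gx a (- (2 * dt v a + 2 * dt u a)) aR.
rewrite rpredN rpredD ?lv ?lu// => /(_ isT).
rewrite rmorphN -(inj_eq (mulIf (qp_neq0 Q (f (2 * dt v a + 2 * dt u a))))).
rewrite -!qpD addNr qp0 => /eqP; apply; rewrite -[RHS]E2; congr (Q _).
by rewrite rmorphD !rmorphM !rmorph_nat; ring.
Qed.

Lemma str_coset x a v u : a \in R ->
  (exists2 j : K, j \is a Num.int & u = v + j *: cr a) ->
  qstr x a v = qstr x a u -> v = u.
Proof.
move=> aR [j ji ->]; have [->|j0] := eqVneq j 0; first by rewrite scale0r addr0.
rewrite /qstr dotDl dotZl (dot_coroot2' hG hR aR) rmorphD addrA [in RHS]qpD.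
move=> /esym /eqP; rewrite -[X in _ == X]mulr1 (inj_eq (mulfI (qp_neq0 _ _))).
have j2 : j * 2 != 0 by rewrite mulf_eq0 (negPf j0) pnatr_eq0.
have j2i : j * 2 \is a Num.int by apply: rpredM => //; apply: rpred_nat.
by rewrite (negPf (qp_int Q j2i j2)).
Qed.

Definition qpsum x s z := Q (2 * dc x z) * ev s z.

Lemma psum_shift x s z a i :
  qpsum x s (z + qv ((i%:R / 2) *: a)) =
    Q (2 * dc x z) * \sum_(p <- s) p.1 * qstr x a p.2 ^+ i * E p.2 z.
Proof.
rewrite /qpsum dcDr// mulrDr qpD -mulrA; congr (_ * _); rewrite /qev mulr_sumr.
apply: eq_bigr => p _; rewrite qexpDr// /qstr -qpMn mulrCA -!mulrA; congr (_ * _).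
rewrite mulrCA [RHS]mulrC; congr (_ * _); rewrite /qexp -qpD; congr (Q _).
rewrite qvecZ !dcZr// dc_real !rmorphM fmorphV !rmorph_nat.
by field; exact: (nat_neq0 Q 1).
Qed.

Lemma psum_shiftN x s z a i :
  qpsum x s (z - qv ((i%:R / 2) *: a)) =
    Q (2 * dc x z) * \sum_(p <- s) p.1 * qstr x a p.2 ^- i * E p.2 z.
Proof.
rewrite -qvecN -scalerN psum_shift; congr (_ * _); apply: eq_bigr => p _.
congr (_ * _ * _); rewrite -exprVn; congr (_ ^+ _).
by rewrite /qstr qvecN dcNr// dotNr// rmorphN -opprD qpN.
Qed.

Lemma wall0 a : wall a 0.
Proof. by rewrite /wall qexp0r. Qed.
Lemma wallD a y z : wall a y -> wall a z -> wall a (y + z).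
Proof. by rewrite /wall qexpDr// => -> ->; rewrite mulr1. Qed.

(** Restricted to the wall, two exponentials coincide exactly when their exponents lie in one coset,
    so independence of characters separates the cosets. *)
Lemma wall_sum0 (s : seq (C * V)) (h : V -> C) a v : a \in R ->
  (forall z, wall a z -> \sum_(p <- s) p.1 * h p.2 * E p.2 z = 0) ->
  \sum_(p <- s | coset a v p.2) p.1 * h p.2 = 0.
Proof.
move=> aR H.
have := @characters_indep _ _ _ _ hG Q (wall a) [seq (p.1 * h p.2, p.2) | p <- s] v
  (wall0 a) (@wallD a).
rewrite big_map /= => H0; rewrite -[RHS]H0; last first.
  by move=> z /H Hz; rewrite /qev big_map.
apply: eq_bigl => p; apply/idP/asboolP => [/asboolP[j ji ->] z az|]; last first.
  exact: wall_coset.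
rewrite qexpDl {2}/qexp qvecZ dcZl mulrCA qp_intz ?mulr1//.
Qed.

Lemma anti_coef x s a i v : a \in R ->
  (forall z, wall a z ->
     qpsum x s (z + qv ((i%:R / 2) *: a)) = qpsum x s (z - qv ((i%:R / 2) *: a))) ->
  \sum_(p <- s | coset a v p.2) p.1 * (qstr x a p.2 ^+ i - qstr x a p.2 ^- i) = 0.
Proof.
move=> aR H; apply: (@wall_sum0 s (fun u => qstr x a u ^+ i - qstr x a u ^- i)) => // z az.
have := H z az; rewrite psum_shift psum_shiftN => /(mulfI (qp_neq0 _ _)) /eqP.
rewrite -subr_eq0 -sumrB => /eqP E0; rewrite -[RHS]E0; apply: eq_bigr => p _.
by rewrite mulrBr mulrBl.
Qed.

Lemma anti_moments x s a m v :
  (forall i, (1 <= i <= m)%N ->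
     \sum_(p <- s | coset a v p.2) p.1 * (qstr x a p.2 ^+ i - qstr x a p.2 ^- i) = 0) ->
  forall r, (r < m)%N -> \sum_(p <- s | coset a v p.2)
    p.1 * (qstr x a p.2 - (qstr x a p.2)^-1) * (qstr x a p.2 + (qstr x a p.2)^-1) ^+ r = 0.
Proof.
move=> H; apply: (@antisym_moments _ _ s (fun p => coset a v p.2) fst
  (fun p => qstr x a p.2)) => [p|i im]; first exact: str_neq0.
exact: H.
Qed.

(** The moments have nodes $u+u^{-1}$ and weights $u-u^{-1}$ with $u$ the value of [qstr]. Since $u$
    is injective on a coset, [str_mul] makes the nodes distinct; it also makes the weights
    nonzero. *)
Lemma anti_coef_strings x s (m : V -> nat) : gen x -> (forall p, p \in s -> lat p.2) ->
  (forall a i v, a \in R -> v \in supp s -> (1 <= i <= m a)%N ->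
     \sum_(p <- s | coset a v p.2) p.1 * (qstr x a p.2 ^+ i - qstr x a p.2 ^- i) = 0) ->
  strings G R (supp s) (fun a => (m a)%:R).
Proof.
move=> gx ls H.
have lsupp v : v \in supp s -> lat v.
  by rewrite mem_filter mem_undup => /andP[_ /mapP[p ps ->]]; apply: ls.
have inv v a : a \in R -> v \in supp s -> qstr x a v - (qstr x a v)^-1 != 0.
  move=> aR vS; rewrite subr_eq0 -(inj_eq (mulIf (str_neq0 x a v))) mulVf ?str_neq0//.
  by apply: str_mul => //; apply: lsupp.
apply: (@moments_strings s m (fun a v => qstr x a v - (qstr x a v)^-1)
  (fun a v => qstr x a v + (qstr x a v)^-1)) => [a v r aR vS rm|a v aR|a v u aR vS uS au].
- rewrite -[RHS](@anti_moments x s a (m a) v _ r)// => [|i im]; last exact: H.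
  by apply: eq_bigr => p _; rewrite mulrA.
- exact: inv.
have v0 := str_neq0 x a v; have u0 := str_neq0 x a u.
move=> /eqP; rewrite -subr_eq0.
have -> : qstr x a v + (qstr x a v)^-1 - (qstr x a u + (qstr x a u)^-1) =
    (qstr x a v - qstr x a u) * (1 - (qstr x a v * qstr x a u)^-1).
  by field; rewrite v0 u0.
rewrite mulf_eq0 !subr_eq0 => /orP[/eqP|]; first exact: str_coset.
by rewrite eq_sym invr_eq1 (negPf (str_mul _ _ _ _)) => //; apply: lsupp.
Qed.

Lemma anti_strings x s (m : V -> nat) : gen x -> (forall p, p \in s -> lat p.2) ->
  (forall a i z, a \in R -> (1 <= i <= m a)%N -> wall a z ->
     qpsum x s (z + qv ((i%:R / 2) *: a)) = qpsum x s (z - qv ((i%:R / 2) *: a))) ->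
  strings G R (supp s) (fun a => (m a)%:R).
Proof.
move=> gx ls H; apply: (anti_coef_strings gx) => // a i v aR _ im.
by apply: anti_coef => // z; apply: H.
Qed.

Lemma cosetN a v u : a \in R -> coset (- a) v u = coset a v u.
Proof.
move=> aR; apply/asboolP/asboolP => -[j ji ->]; exists (- j); rewrite ?rpredN//.
  by rewrite corootN// scalerN scaleNr.
by rewrite corootN// scalerN scaleNr opprK.
Qed.

Lemma strN x a v : qstr x (- a) v = (qstr x a v)^-1.
Proof. by rewrite /qstr qvecN dcNr// dotNr// rmorphN -opprD qpN. Qed.

(** Skewness includes the shift $i=0$, which gives one moment more than quasi-invariance and hence
    strings longer by one. *)
Lemma sym_strings x s (m : V -> nat) : gen x -> (forall p, p \in s -> lat p.2) ->
  (forall a i z, a \in R -> (i <= m a)%N -> wall a z ->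
     qpsum x s (z + qv ((i%:R / 2) *: a)) + qpsum x s (z - qv ((i%:R / 2) *: a)) = 0) ->
  strings G R (supp s) (fun a => (m a).+1%:R).
Proof.
move=> gx ls H.
have lsupp v : v \in supp s -> lat v.
  by rewrite mem_filter mem_undup => /andP[_ /mapP[p ps ->]]; apply: ls.
apply: (@moments_strings s (fun a => (m a).+1) (fun _ _ => 1)
  (fun a v => qstr x a v + (qstr x a v)^-1)) => [a v r aR _ rm|a v aR|a v u aR vS uS au].
- rewrite -[RHS](@sym_moments _ _ s (fun p => coset a v p.2) fst
    (fun p => qstr x a p.2) (m a) (f2_neq0 Q) _ _ r rm).
  + by apply: eq_bigr => p _; rewrite mul1r.
  + by move=> p; apply: str_neq0.
  move=> i im; apply: (@wall_sum0 s (fun u => qstr x a u ^+ i + qstr x a u ^- i)) => // z az.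
  have := H a i z aR im az; rewrite psum_shift psum_shiftN -mulrDr => /eqP.
  rewrite mulf_eq0 (negPf (qp_neq0 _ _)) /= -big_split /= => /eqP E0; rewrite -[RHS]E0.
  by apply: eq_bigr => p _; rewrite mulrDr mulrDl.
- by rewrite oner_neq0.
have v0 := str_neq0 x a v; have u0 := str_neq0 x a u.
move=> /eqP; rewrite -subr_eq0.
have -> : qstr x a v + (qstr x a v)^-1 - (qstr x a u + (qstr x a u)^-1) =
    (qstr x a v - qstr x a u) * (1 - (qstr x a v * qstr x a u)^-1).
  by field; rewrite v0 u0.
rewrite mulf_eq0 !subr_eq0 => /orP[/eqP|]; first exact: str_coset.
by rewrite eq_sym invr_eq1 (negPf (str_mul _ _ _ _)) => //; apply: lsupp.
Qed.

Lemma supp_nil s v : supp s = [::] -> cf s v = 0.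
Proof.
move=> s0; have [vs|vs] := boolP (v \in map snd s); last first.
  rewrite /cf big1_seq// => p /andP[/eqP pv ps].
  by case/mapP: vs; exists p.
apply/eqP; apply: contraT => v0; suff : v \in supp s by rewrite s0.
by rewrite mem_filter v0 mem_undup.
Qed.

Lemma ev_supp_nil s z : supp s = [::] -> ev s z = 0.
Proof.
move=> s0; rewrite /qev.
by rewrite (@sum_supp s xpredT (fun v => E v z)) s0 big_nil.
Qed.

Lemma mem_supp_neq0 s v : v \in supp s -> exists p, [/\ p \in s, p.1 != 0 & v = p.2].
Proof.
rewrite mem_filter => /andP[cv _].
have [/hasP[p ps /andP[/eqP pv p0]]|/hasPn H] := boolP (has (fun p => (p.2 == v) && (p.1 != 0)) s).
  by exists p.
move: cv; rewrite /cf big1_seq ?eqxx// => p /andP[pv ps].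
by have := H p ps; rewrite pv negbK => /eqP.
Qed.

Lemma mem_supp s v : v \in supp s -> exists2 p, p \in s & v = p.2.
Proof. by rewrite mem_filter mem_undup => /andP[_ /mapP[p ps ->]]; exists p. Qed.

End Strings.

(** * The coroot lattice, and the faces and lattice points of the zonotope *)

Lemma sgr_pm (K : realDomainType) (x : K) : x != 0 -> Num.sg x = 1 \/ Num.sg x = -1.
Proof. by case: (ltrgtP x 0) => // x0 _; [right; rewrite ltr0_sg | left; rewrite gtr0_sg]. Qed.

Section Polytope.
Context {K : realType} {n : nat}.
Local Notation V := 'rV[K]_n.
Variables (G : 'M[K]_n) (hG : euclidean G) (R : {fset V}).
Hypothesis hR : reduced_irreducible_root_system G R.
Local Notation dt := (dot G).
Local Notation cr := (coroot G).
Local Notation rf := (reflection G).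
Variables (d : V) (Rp : {fset V}).
Hypothesis rd : regular G R d.
Hypothesis RpE : Rp = [fset a in R | 0 < dt a d]%fset.
Local Notation vtx := (vertex G R).
Local Notation dot_sym := (dot_sym hG).
Local Notation dotDr := (dotDr hG).
Local Notation dotZr := (dotZr hG).
Local Notation dotBr := (dotBr hG).
Local Notation corootN := (corootN hG).
Local Notation reflectionE := (reflectionE hG).
Local Notation root_gt0 := (root_gt0 hG hR).
Local Notation dot_root_neq0 := (dot_root_neq0 hG hR).
Local Notation coroot_gt0 := (coroot_gt0 hG hR).
Local Notation reflection_self := (reflection_self hG hR).
Local Notation root_opp := (root_opp hG hR).
Local Notation rootNE := (rootNE hG hR).
Local Notation dot_coroot_int := (dot_coroot_int hG hR).
Local Notation kinvN := (kinvN hG hR).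
Local Notation bigR2 := (bigR2 hG hR).
Local Notation vtx_wall := (vtx_wall hG hR).

Lemma mem_Rp a : (a \in Rp) = (a \in R) && (0 < dt a d).
Proof. by rewrite RpE !inE. Qed.

Lemma Rp_R a : a \in Rp -> a \in R.
Proof. by rewrite mem_Rp => /andP[]. Qed.

Lemma Rp_or a : a \in R -> a \in Rp \/ - a \in Rp.
Proof.
move=> aR; rewrite !mem_Rp rootNE// aR dotNl oppr_gt0 /=.
by have := rd aR; case: ltrgtP => //; auto.
Qed.

Lemma Rp_N a : a \in Rp -> - a \notin Rp.
Proof. by rewrite !mem_Rp dotNl oppr_gt0 => /andP[_ /ltW]; rewrite leNgt negb_and orbC => ->. Qed.

Lemma big_Rp (T : Type) (idx : T) (op : Monoid.com_law idx) (F : V -> T) :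
  \big[op/idx]_(b <- R) F b = \big[op/idx]_(b <- Rp) op (F b) (F (- b)).
Proof.
rewrite big_split /= -(big_map -%R xpredT F) -big_cat; apply: perm_big.
apply: uniq_perm; rewrite ?fset_uniq// ?cat_uniq ?fset_uniq ?(map_inj_uniq oppr_inj) ?fset_uniq ?andbT /=.
  by apply/hasPn => b /mapP[a aRp ->]; rewrite Rp_N.
move=> b; rewrite mem_cat; have -> : (b \in [seq - i | i <- Rp]) = (- b \in Rp).
  by rewrite -[b in LHS]opprK (mem_map oppr_inj).
apply/idP/orP => [/Rp_or//|[/Rp_R//|/Rp_R]]; by rewrite rootNE.
Qed.

Lemma vtx_Rp k e : kinv G R k ->
  vtx k e = 2^-1 *: \sum_(b <- Rp) (Num.sg (dt b e) * k b) *: cr b.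
Proof.
move=> kk; rewrite /vertex big_Rp /=.
rewrite [X in _ *: X](_ : _ = \sum_(b <- Rp) 2 *: ((Num.sg (dt b e) * k b) *: cr b)).
  by rewrite -scaler_sumr scalerA; congr (_ *: _); field.
apply: eq_big_seq => b /Rp_R bR; rewrite dotNl sgrN kinvN// corootN//.
by rewrite mulNr scaleNr scalerN opprK -mulr2n -scaler_nat.
Qed.

(** The coroot lattice. Plain sums suffice as [R] is closed under negation, and their length serves
    as induction parameter later. *)
Definition inQ (v : V) := exists2 s : seq V, {subset s <= R} & v = \sum_(b <- s) cr b.

Lemma inQ0 : inQ 0.
Proof. by exists [::]; rewrite ?big_nil. Qed.
Lemma inQD u v : inQ u -> inQ v -> inQ (u + v).
Proof.
case=> s sR -> [t tR ->]; exists (s ++ t); last by rewrite big_cat.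
by move=> b; rewrite mem_cat => /orP[/sR|/tR].
Qed.
Lemma inQN u : inQ u -> inQ (- u).
Proof.
case=> s sR ->; exists (map -%R s).
  by move=> b /mapP[a /sR aR ->]; rewrite rootNE.
by rewrite big_map -sumrN; apply: eq_bigr => b _; rewrite corootN.
Qed.
Lemma inQB u v : inQ u -> inQ v -> inQ (u - v).
Proof. by move=> u0 /inQN; apply: inQD. Qed.
Lemma inQ_coroot a : a \in R -> inQ (cr a).
Proof. by move=> aR; exists [:: a]; rewrite ?big_seq1// => b; rewrite inE => /eqP->. Qed.
Lemma inQZ j v : j \is a Num.int -> inQ v -> inQ (j *: v).
Proof.
have nat k u : inQ u -> inQ (k%:R *: u).
  move=> uQ; elim: k => [|k IH]; first by rewrite scale0r; exact: inQ0.
  by rewrite mulrS scalerDl scale1r; apply: inQD.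
move=> /intrP[[k|k] ->] vQ; first exact: nat.
by rewrite NegzE mulrNz scaleNr; apply: inQN; apply: nat.
Qed.
Lemma inQ_sum (I : eqType) (s : seq I) (F : I -> V) :
  (forall i, i \in s -> inQ (F i)) -> inQ (\sum_(i <- s) F i).
Proof.
by move=> H; rewrite big_seq; elim/big_ind: _ => //; [exact: inQ0 | exact: inQD].
Qed.
Lemma inQ_int v a : inQ v -> a \in R -> dt v a \is a Num.int.
Proof.
case=> s sR -> aR; rewrite dot_suml big_seq rpred_sum// => b /sR bR.
exact: dot_coroot_int.
Qed.
Lemma inQ_refl v a : inQ v -> a \in R -> inQ (rf a v).
Proof.
move=> vQ aR; rewrite reflectionE//; apply: inQB => //; apply: inQZ.
  exact: inQ_int.
exact: inQ_coroot.
Qed.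

(** A generic vector of the hyperplane orthogonal to [a] lies on no other root hyperplane; the two
    chambers are reached by small moves along [a]. *)
Lemma wall_exists a : a \in R -> exists e d0 e2, adj G R a e d0 e2.
Proof.
move=> aR; have aa := dot_root_neq0 aR.
pose h b := b - (dt b a / dt a a) *: a.
pose H := [seq h b | b <- enum_fset R & h b != 0].
have [|e1 _ eH] := generic_near hG 0 [::] (H := H).
  by move=> u /mapP[b]; rewrite mem_filter => /andP[b0 _] ->.
pose d0 := e1 - (dt e1 a / dt a a) *: a.
have d0E b : dt b d0 = dt (h b) e1.
  by rewrite /d0 /h dotBr// dotZr// dotBl dotZl (dot_sym e1); field.
have [eps e0 Heps] := small_shift [seq (dt b d0, dt b a) | b <- enum_fset R].
have [eps' e0' Heps'] := small_shift [seq (dt b d0, - dt b a) | b <- enum_fset R].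
have ad0 : dt a d0 = 0.
  by rewrite /d0 dotBr// dotZr// (dot_sym e1) divfK ?subrr.
exists (d0 - eps' *: a), d0, (d0 + eps *: a); split => //.
- by rewrite dotBr// dotZr// ad0 sub0r oppr_lt0 mulr_gt0// (root_gt0).
- by rewrite dotDr// dotZr// ad0 add0r mulr_gt0// (root_gt0).
move=> b bR ba bNa.
have b0 : dt b d0 != 0.
  rewrite d0E; apply: eH; apply/mapP; exists b; rewrite // mem_filter bR andbT.
  apply/eqP => /eqP; rewrite subr_eq0 => /eqP bE.
  have /(root_reduced hR aR) : (dt b a / dt a a) *: a \in R by rewrite -bE.
  by case=> E; move: ba bNa; rewrite bE E ?scale1r ?scaleN1r eqxx.
split => //.
- rewrite dotBr// dotZr// -mulrN.
  apply: (Heps' eps' (dt b d0, - dt b a)) => //; first by rewrite e0' lexx.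
  exact: (map_f (fun b => (dt b d0, - dt b a))).
- rewrite dotDr// dotZr//.
  apply: (Heps eps (dt b d0, dt b a)) => //; first by rewrite e0 lexx.
  exact: (map_f (fun b => (dt b d0, dt b a))).
Qed.

Section Mult.
Variable m : V -> nat.
Hypothesis hm : forall a b, a \in R -> b \in R -> m (rf a b) = m b.
Local Notation mk := (fun a => (m a)%:R : K).

Lemma mk_inv : kinv G R mk.
Proof. by move=> a b aR bR; rewrite hm. Qed.

Lemma vtx_diff e e' : regular G R e -> regular G R e' -> inQ (vtx mk e - vtx mk e').
Proof.
move=> re re'; rewrite !vtx_Rp; try exact: mk_inv.
rewrite -scalerBr -sumrB scaler_sumr; apply: inQ_sum => b /Rp_R bR.
rewrite -scalerBl -mulrBl scalerA; apply: inQZ; last exact: inQ_coroot.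
rewrite mulrA; apply: rpredM; last exact: rpred_nat.
case: (sgr_pm (re b bR)) => ->; case: (sgr_pm (re' b bR)) => ->.
- by rewrite subrr mulr0 rpred0.
- by rewrite opprK -[1 + 1]/(2) mulVf ?pnatr_eq0// rpred1.
- by rewrite -opprD -[1 + 1]/(2) mulrN mulVf ?pnatr_eq0// rpredN rpred1.
- by rewrite subrr mulr0 rpred0.
Qed.

(** All vertices agree modulo the coroot lattice, and a vertex next to the wall of [a] pairs with
    [a] to the integer $-m_a$. *)
Lemma vtx_int e a : regular G R e -> a \in R -> dt (vtx mk e) a \is a Num.int.
Proof.
move=> re aR; have [e1 [d0 [e2 A]]] := wall_exists aR.
have [re1 _] := adj_reg A.
rewrite -[vtx mk e](subrK (vtx mk e1)) dotDl rpredD//.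
  by apply: inQ_int => //; apply: vtx_diff.
by rewrite (vtx_wall mk_inv A) rpredN rpred_nat.
Qed.

(** A description with one coefficient for each root, hence independent of the choice of positive
    roots and convenient in every chamber. *)
Definition polytope (v : V) := exists2 g : V -> K,
  (forall a, a \in R -> `|g a| <= (m a)%:R) & v = 4^-1 *: \sum_(b <- R) g b *: cr b.

Lemma polytopeP v : support_polytope G m Rp v -> polytope v.
Proof.
case=> l Hl ->; pose g b := if b \in Rp then (m b)%:R - 2 * l b
  else - ((m b)%:R - 2 * l (- b)).
exists g => [a aR|].
  rewrite /g; case: ifP => aRp.
    by have := Hl a aRp; rewrite ler_norml => /andP[]; lra.
  have [|aRp'] := Rp_or aR; first by rewrite aRp.
  have := Hl _ aRp'; have -> : m (- a) = m a by rewrite -(reflection_self aR) hm.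
  by rewrite normrN ler_norml => /andP[]; lra.
rewrite big_Rp /= /rhov.
rewrite [X in _ = _ *: X](_ : _ = \sum_(b <- Rp) (2 * ((m b)%:R - 2 * l b)) *: cr b).
  rewrite !scaler_sumr -sumrB; apply: eq_bigr => b _.
  by move: (cr b) => w; rewrite !scalerA -scalerBl; congr (_ *: _); field.
apply: eq_big_seq => b bRp; rewrite /g bRp (negPf (Rp_N bRp)) opprK corootN//.
have -> : m (- b) = m b.
  by rewrite -(reflection_self (Rp_R bRp)) hm// ?Rp_R.
by rewrite scaleNr scalerN opprK -scalerDl; congr (_ *: _); ring.
Qed.

(** The pairing with [d0] is bounded term by term, so equality forces the extreme coefficient at
    every root outside [P]. With [P] empty this describes a vertex, with [P] consisting of [a] and
    [- a] an edge. *)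
Lemma polytope_face v e d0 (P : pred V) : polytope v ->
  (forall b, b \in R -> ~~ P b -> Num.sg (dt b e) = Num.sg (dt b d0)) ->
  (forall b, b \in R -> ~~ P b -> dt b d0 != 0) ->
  (forall b, b \in R -> P b -> dt b d0 = 0) ->
  dt v d0 <= dt (vtx mk e) d0 /\ (dt v d0 = dt (vtx mk e) d0 ->
   exists2 g : V -> K, forall a, a \in R -> `|g a| <= (m a)%:R &
    vtx mk e - v = 4^-1 *: \sum_(b <- R | P b) (Num.sg (dt b e) * (m b)%:R - g b) *: cr b).
Proof.
case=> g Hg -> He H0 HP.
have E : vtx mk e - 4^-1 *: \sum_(b <- R) g b *: cr b =
    4^-1 *: \sum_(b <- R) (Num.sg (dt b e) * (m b)%:R - g b) *: cr b.
  by rewrite -scalerBr -sumrB; congr (_ *: _); apply: eq_bigr => b _; rewrite scalerBl.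
pose T b := (Num.sg (dt b e) * (m b)%:R - g b) * dt (cr b) d0.
have T0 b : b \in R -> 0 <= T b.
  move=> bR; rewrite /T; have [Pb|Pb] := boolP (P b).
    by rewrite dot_corootl HP// !mulr0.
  rewrite He// dot_corootl mulrCA pmulr_rge0 ?(coroot_gt0)//.
  have := Hg b bR; rewrite ler_norml => /andP[h1 h2].
  have [bd|bd|bd] := ltrgtP (dt b d0) 0; last by rewrite bd mulr0.
    by rewrite (ltr0_sg bd) mulN1r mulr_le0 ?(ltW bd)//; lra.
  by rewrite (gtr0_sg bd) mul1r mulr_ge0 ?subr_ge0// ltW.
have ET : dt (vtx mk e) d0 - dt (4^-1 *: \sum_(b <- R) g b *: cr b) d0 =
    4^-1 * \sum_(b <- R) T b.
  rewrite -dotBl E dotZl dot_suml; congr (_ * _); apply: eq_bigr => b _.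
  by rewrite dotZl.
have sT0 : 0 <= \sum_(b <- R) T b by rewrite big_seq sumr_ge0.
split; first by rewrite -subr_ge0 ET mulr_ge0.
move=> eq0; exists g => //; rewrite E; congr (_ *: _).
have : \sum_(b <- R) T b = 0.
  apply/eqP; have /eqP := ET; rewrite eq0 subrr eq_sym mulf_eq0 invr_eq0.
  by rewrite pnatr_eq0.
move/eqP; rewrite big_seq psumr_eq0// => /allP TT.
rewrite (bigID P) /= [X in _ + X]big1_seq ?addr0// => b /andP[Pb bR].
have := TT b bR; rewrite bR /= mulf_eq0 => /orP[/eqP->|]; first by rewrite scale0r.
rewrite dot_corootl mulf_eq0 (negPf (H0 _ _ _))// orbF gt_eqF//.
exact: (coroot_gt0).
Qed.

Lemma polytope_vtx v e : regular G R e -> polytope v ->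
  dt v e <= dt (vtx mk e) e /\ (dt v e = dt (vtx mk e) e -> v = vtx mk e).
Proof.
move=> re vN; have [//|b bR _|//|h1 h2] := @polytope_face v e e pred0 vN; first exact: re.
split=> // /h2 [g _]; rewrite big_pred0// scaler0 => /eqP.
by rewrite subr_eq0 => /eqP.
Qed.

Lemma polytope_wall v a e d0 e2 : adj G R a e d0 e2 -> polytope v ->
  dt v d0 = dt (vtx mk e) d0 ->
  exists2 r, 0 <= r <= (m a)%:R & v = vtx mk e + r *: cr a.
Proof.
move=> [aR ad0 ae ae2 H] vN vd0.
pose P b := (b == a) || (b == - a).
have [|||_ /(_ vd0) [g Hg E]] := @polytope_face v e d0 P vN.
- by move=> b bR; rewrite negb_or => /andP[ba bNa]; have [_ -> _] := H b bR ba bNa.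
- by move=> b bR; rewrite negb_or => /andP[ba bNa]; have [-> _ _] := H b bR ba bNa.
- by move=> b bR /orP[] /eqP->; rewrite ?dotNl ad0 ?oppr0.
exists (4^-1 * (2 * (m a)%:R + g a - g (- a))).
  have := Hg a aR; have := Hg (- a) (root_opp aR).
  have -> : m (- a) = m a by rewrite -(reflection_self aR) hm.
  by rewrite !ler_norml => /andP[h1 h2] /andP[h3 h4]; apply/andP; split; lra.
move: E; rewrite big_mkcond (bigR2 aR) /=; last first.
  by move=> b bR ba bNa; rewrite /P (negPf ba) (negPf bNa).
rewrite /P !eqxx /= orbT dotNl sgrN (ltr0_sg ae) corootN//.
have -> : m (- a) = m a by rewrite -(reflection_self aR) hm.
move/eqP; rewrite subr_eq => /eqP ->.
set w := vtx mk e; apply/rowP => i; rewrite !mxE; have := dot_root_neq0 aR.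
by move=> aa; field.
Qed.

Lemma vtx_polytope e : regular G R e -> support_polytope G m Rp (vtx mk e).
Proof.
move=> re; exists (fun b => (m b)%:R * (1 - Num.sg (dt b e)) / 2).
  move=> a /Rp_R aR; case: (sgr_pm (re a aR)) => ->.
    by rewrite subrr mulr0 mul0r lexx ler0n.
  by rewrite opprK -[1 + 1]/2 mulfK ?pnatr_eq0// lexx ler0n.
rewrite vtx_Rp; last exact: mk_inv.
rewrite /rhov !scaler_sumr -sumrB; apply: eq_bigr => b _.
by move: (cr b) => w; rewrite !scalerA -scalerBl; congr (_ *: _); field.
Qed.

End Mult.
End Polytope.

(** * Lattice points in the hull of a (quasi)minuscule orbit *)

Section Orbit.
Context {K : realType} {n : nat}.
Local Notation V := 'rV[K]_n.
Variables (G : 'M[K]_n) (hG : euclidean G) (R : {fset V}).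
Hypothesis hR : reduced_irreducible_root_system G R.
Local Notation dt := (dot G).
Local Notation cr := (coroot G).
Local Notation rf := (reflection G).
Local Notation dot_sym := (dot_sym hG).
Local Notation dotNr := (dotNr hG).
Local Notation dotBr := (dotBr hG).
Local Notation dot_gt0 := (dot_gt0 hG).
Local Notation dot_le0 := (dot_le0 hG).
Local Notation dot_corootr := (dot_corootr hG).
Local Notation reflectionE := (reflectionE hG).
Local Notation dot_coroot2 := (dot_coroot2 hG hR).
Local Notation dot_coroot2' := (dot_coroot2' hG hR).
Local Notation coroot_gt0 := (coroot_gt0 hG hR).
Local Notation reflectionK := (reflectionK hG hR).
Local Notation reflection_dotl := (reflection_dotl hG hR).
Local Notation root_opp := (root_opp hG hR).
Local Notation reflection_root := (reflection_root hG hR).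
Local Notation inQ := (inQ G R).
Local Notation inQ_int := (inQ_int hG hR).
Variable O : seq V.
Hypothesis O_refl : forall t a, t \in O -> a \in R -> rf a t \in O.
Hypothesis O_int : forall t a, t \in O -> a \in R -> dt t a \is a Num.int.
Hypothesis O_norm : forall t u, t \in O -> u \in O -> dt t t = dt u u.
Hypothesis O_small : forall t a, t \in O -> a \in R -> dt t a <= 1 \/ t = cr a.
Hypothesis O_type : (forall t a, t \in O -> a \in R -> dt t a <= 1) \/
  (forall t, t \in O -> inQ t).

Lemma int_gt0 (x : K) : x \is a Num.int -> 0 < x -> 1 <= x.
Proof. by move=> /intrP[z ->]; rewrite -[0]/(0%:~R) -[1]/(1%:~R) ltr_int ler_int -gtz0_ge1. Qed.

Lemma int_01 (x : K) : x \is a Num.int -> 0 < x <= 1 -> x = 1.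
Proof. by move=> xi /andP[x0 x1]; apply/eqP; rewrite eq_le x1 int_gt0. Qed.

(** Descent on the number of coroots summing to [y]: if no summand pairs positively with [y], then
    $(y,y)\le0$; otherwise the pairing is 1 and reflecting [y] removes that summand. *)
Lemma small_inQ0 y : inQ y -> (forall a, a \in R -> dt y a <= 1) -> y = 0.
Proof.
case=> s; move: {2}(size s) (leqnn (size s)) => N.
elim: N s y => [|N IH] s y; first by rewrite leqn0 size_eq0 => /eqP -> _ ->; rewrite big_nil.
move=> sN sR yE y1.
have [/hasP[b bs yb]|/hasPn H] := boolP (has (fun b => 0 < dt y b) s); last first.
  apply: (dot_le0); rewrite {1}yE dot_suml big_seq sumr_le0// => b bs.
  have := H b bs; rewrite -leNgt dot_corootl dot_sym => h.
  by rewrite mulr_ge0_le0// ltW// coroot_gt0// sR.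
have bR := sR b bs.
have yb1 : dt y b = 1.
  apply: int_01; last by rewrite yb y1.
  by apply: inQ_int => //; exists s.
have E : rf b y = \sum_(a <- rem b s) cr a.
  by rewrite reflectionE yb1 scale1r yE (big_rem b)//= addrAC subrr add0r.
rewrite -[y](reflectionK bR) (IH (rem b s) (rf b y)).
- by rewrite reflectionE dot0l scale0r subr0.
- by rewrite size_rem//; case: (size s) sN.
- by move=> a /mem_rem /sR.
- exact: E.
- by move=> a aR; rewrite reflection_dotl// y1// reflection_root.
Qed.

(** The same descent on [y - t]: a summand pairing positively with [y] or negatively with [t] is
    removed by reflecting [y] or [t]; if there is none, $(y-t,y-t)\le0$. *)
Lemma small_orbit y t : t \in O -> inQ (y - t) -> (forall u a, u \in O -> a \in R -> dt u a <= 1) ->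
  (forall a, a \in R -> dt y a <= 1) -> y \in O.
Proof.
move=> tO [s sR sE] O1; move: s sR sE; move=> s; move: {2}(size s) (leqnn (size s)) => N.
elim: N s y t tO => [|N IH] s y t tO.
  rewrite leqn0 size_eq0 => /eqP -> _; rewrite big_nil => /eqP.
  by rewrite subr_eq0 => /eqP ->.
move=> sN sR sE y1.
have ti := O_int tO.
have yi a : a \in R -> dt y a \is a Num.int.
  move=> aR; rewrite -[y](subrK t) dotDl rpredD ?ti//.
  by apply: inQ_int => //; exists s.
have [/hasP[b bs yb]|/hasPn Hy] := boolP (has (fun b => 0 < dt y b) s).
  have bR := sR b bs.
  have yb1 : dt y b = 1 by apply: int_01; rewrite ?yi// yb y1.
  rewrite -[y](reflectionK bR); apply: O_refl => //.
  apply: (IH (rem b s) (rf b y) t) => //.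
  - by rewrite size_rem//; case: (size s) sN.
  - by move=> a /mem_rem /sR.
  - by rewrite reflectionE yb1 scale1r addrAC sE (big_rem b)//= addrAC subrr add0r.
  - by move=> a aR; rewrite reflection_dotl// y1// reflection_root.
have [/hasP[b bs tb]|/hasPn Ht] := boolP (has (fun b => dt t b < 0) s).
  have bR := sR b bs.
  have tb1 : dt t b = -1.
    apply/eqP; rewrite -eqr_oppLR; apply/eqP; apply: int_01; first by rewrite rpredN ti.
    by rewrite oppr_gt0 tb -dotNr O1// root_opp.
  apply: (IH (rem b s) y (rf b t)) => //.
  - exact: O_refl.
  - by rewrite size_rem//; case: (size s) sN.
  - by move=> a /mem_rem /sR.
  - by rewrite reflectionE tb1 scaleN1r opprK opprD addrA sE (big_rem b)//= addrAC subrr add0r.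
suff -> : y = t by [].
apply/eqP; rewrite -subr_eq0; apply/eqP; apply: dot_le0.
rewrite {1}sE dot_suml big_seq sumr_le0// => b bs; have bR := sR b bs.
have := Hy b bs; have := Ht b bs; rewrite -!leNgt => h1 h2.
rewrite dot_corootl mulr_ge0_le0 ?(ltW (coroot_gt0 bR))//.
by rewrite dotBr !(dot_sym b); lra.
Qed.

(** Membership in the hull of 0 and the orbit is expressed by support functions. If some root pairs
    with [y] to more than 1, the pairing is 2 and comparison of norms gives $y=a^\vee$; otherwise
    [y] is itself small and the two descents apply. *)
Lemma orbit_hull y : (inQ y \/ exists2 t, t \in O & inQ (y - t)) ->
  (forall e, exists2 t, t \in 0 :: O & dt y e <= dt t e) -> y = 0 \/ y \in O.
Proof.
move=> yQ H.
have Hz e : 0 < dt y e -> exists2 t, t \in O & dt y e <= dt t e.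
  move=> ye; have [t] := H e; rewrite inE => /orP[/eqP->|tO h]; last by exists t.
  by rewrite dot0l leNgt ye.
have yi a : a \in R -> dt y a \is a Num.int.
  move=> aR; case: yQ => [yQ|[t tO ytQ]]; first exact: inQ_int.
  by rewrite -[y](subrK t) dotDl rpredD ?(O_int tO aR)//; apply: inQ_int.
have [/hasP[a aR ya]|/hasPn y1'] := boolP (has (fun a => 1 < dt y a) (enum_fset R)).
  have [t tO yt] : exists2 t, t \in O & dt y a <= dt t a.
    by apply: Hz; apply: lt_trans ya.
  have ta : t = cr a.
    by case: (O_small tO aR) => // /(le_trans yt); rewrite leNgt ya.
  have ya2 : dt y a = 2.
    move: yt; rewrite ta dot_coroot2'// => yt.
    have : dt y a - 1 = 1.
      apply: int_01; first by rewrite rpredB ?yi ?rpred1.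
      by rewrite subr_gt0 ya lerBlDr.
    by move/eqP; rewrite subr_eq => /eqP ->.
  right; suff -> : y = cr a by rewrite -ta.
  apply/eqP; rewrite -subr_eq0; apply/eqP; apply: dot_le0.
  have yy0 : 0 < dt y y.
    rewrite dot_gt0//; apply/eqP => y0; move: ya2; rewrite y0 dot0l => /eqP.
    by rewrite eq_sym pnatr_eq0.
  (* Testing the hull in direction [y] gives $(y,y)\le(t',t')$, and this norm is
     $(a^\vee,a^\vee)=(y,a^\vee)$; therefore $(y-a^\vee,y-a^\vee)\le0$. *)
  have [t' t'O yt'] := Hz y yy0.
  have nn : 0 <= dt (y - t') (y - t') by exact: (dot_ge0 hG).
  have N : dt t' t' = dt (cr a) (cr a) by rewrite -ta; apply: O_norm.
  have ca : dt (cr a) (cr a) = 2 / dt a a * 2 by rewrite dot_corootl dot_coroot2.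
  have yca : dt y (cr a) = 2 / dt a a * 2 by rewrite dot_corootr ya2.
  move: nn; rewrite !dotBl !dotBr N (dot_sym t' y) (dot_sym (cr a) y) ca yca.
  by move: yt'; rewrite (dot_sym t' y); lra.
have y1 a : a \in R -> dt y a <= 1 by move=> aR; rewrite leNgt; apply: y1'.
case: yQ => [yQ|[t tO ytQ]]; first by left; apply: small_inQ0.
case: O_type => [Om|OQ]; first by right; apply: (small_orbit tO ytQ Om y1).
by left; apply: small_inQ0 => //; rewrite -[y](subrK t); apply: inQD => //; apply: OQ.
Qed.

End Orbit.

(** * Newton polytopes of exponential sums *)

Section ExpSums.
Context {K : realType} {C : fieldType} {n : nat}.
Local Notation V := 'rV[K]_n.
Local Notation VC := 'rV[C]_n.
Variables (G : 'M[K]_n) (hG : euclidean G) (Q : qchar K C) (R : {fset V}).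
Hypothesis hR : reduced_irreducible_root_system G R.
Local Notation dt := (dot G).
Local Notation cr := (coroot G).
Local Notation f := (qemb Q).
Local Notation dc := (qdot G Q).
Local Notation qv := (qvec Q).
Local Notation E := (qexp G Q).
Local Notation ev := (qev G Q).
Local Notation br := (qbr Q).
Local Notation vtx := (vertex G R).
Local Notation coroot_gt0 := (coroot_gt0 hG hR).
Local Notation dot_coroot_int := (dot_coroot_int hG hR).
Variable d : V.

(** The Newton polytope is controlled by its support function: in direction [e] only the exponent
    [L e] may reach the maximum. The number [k] is the coefficient at [L d]; it may be zero. *)
Definition expsum (L : V -> V) (F : VC -> C) (k : C) := exists s : seq (C * V),
  [/\ forall z, F z = ev s z,
      forall p, p \in s -> lat G R p.2,
      forall e p, regular G R e -> p \in s ->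
        dt p.2 e <= dt (L e) e /\ (dt p.2 e = dt (L e) e -> p.2 = L e)
    & cf s (L d) = k].

Hypothesis rd : regular G R d.

Lemma expsum_eq L L' F F' k : expsum L F k -> (forall e, regular G R e -> L e = L' e) ->
  (forall z, F z = F' z) -> expsum L' F' k.
Proof.
move=> [s [Fs ls hs ks]] HL HF; exists s; split => //.
- by move=> z; rewrite -HF.
- by move=> e p re ps; rewrite -HL//; apply: hs.
- by rewrite -HL.
Qed.

Lemma cf_cat (s t : seq (C * V)) (v : V) : cf (s ++ t) v = cf s v + cf t v.
Proof. by rewrite /cf big_cat. Qed.

Lemma ev_cat s t z : ev (s ++ t) z = ev s z + ev t z.
Proof. by rewrite /qev big_cat. Qed.

Lemma expsumD L F F' k k' : expsum L F k -> expsum L F' k' ->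
  expsum L (fun z => F z + F' z) (k + k').
Proof.
move=> [s [Fs ls hs ks]] [t [Ft lt' ht kt]]; exists (s ++ t); split.
- by move=> z; rewrite ev_cat Fs Ft.
- by move=> p; rewrite mem_cat => /orP[/ls|/lt'].
- by move=> e p re; rewrite mem_cat => /orP[/(hs e p re)|/(ht e p re)].
- by rewrite cf_cat ks kt.
Qed.

Lemma expsum_map (g : C * V -> C) L F F' k b : expsum L F k ->
  (forall s z, F z = ev s z -> (forall y, F y = ev s y) ->
     F' z = ev [seq (p.1 * g p, p.2) | p <- s] z) ->
  (forall p, p.2 = L d -> g p = b) -> expsum L F' (k * b).
Proof.
move=> [s [Fs ls hs ks]] HF Hg; exists [seq (p.1 * g p, p.2) | p <- s]; split.
- by move=> z; apply: HF.
- by move=> p /mapP[p' /ls ? ->].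
- by move=> e p re /mapP[p' /(hs e p' re) ? ->].
- rewrite /cf big_map /= -ks /cf mulr_suml; apply: eq_bigr => p /eqP pE.
  by rewrite Hg.
Qed.

Lemma expsumZ b L F k : expsum L F k -> expsum L (fun z => F z * b) (k * b).
Proof.
move=> H; apply: (expsum_map (g := fun=> b) H) => // s z -> _.
rewrite /qev big_map /= mulr_suml; apply: eq_bigr => p _; ring.
Qed.

Lemma expsum_shift w L F k : expsum L F k -> expsum L (fun z => F (z + w)) (k * E (L d) w).
Proof.
move=> H; apply: (expsum_map (g := fun p => E p.2 w) H) => [s z _ ->|p -> //].
rewrite /qev big_map /=; apply: eq_bigr => p _; rewrite qexpDr//; ring.
Qed.

Lemma expsum_const b : expsum (fun=> 0) (fun=> b) b.
Proof.
exists [:: (b, 0)]; split.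
- by move=> z; rewrite /qev big_seq1 qexp0l mulr1.
- by move=> p; rewrite inE => /eqP -> a aR; rewrite dot0l mulr0 rpred0.
- by move=> e p _; rewrite inE => /eqP ->.
- by rewrite /cf big_cons eqxx big_nil addr0.
Qed.

(** Newton polytopes add, and the vertex of a product in a regular direction comes only from the two
    vertex terms. *)
Lemma expsumM L L' F F' k k' : expsum L F k -> expsum L' F' k' ->
  expsum (fun e => L e + L' e) (fun z => F z * F' z) (k * k').
Proof.
move=> [s [Fs ls hs ks]] [t [Ft lt' ht kt]].
have top e p q : regular G R e -> p \in s -> q \in t ->
    dt (p.2 + q.2) e <= dt (L e + L' e) e /\
    (dt (p.2 + q.2) e = dt (L e + L' e) e -> p.2 = L e /\ q.2 = L' e).
  move=> re ps qt; have [h1 h2] := hs e p re ps; have [h3 h4] := ht e q re qt.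
  rewrite !dotDl; split; first exact: lerD.
  by move=> E1; split; [apply: h2|apply: h4]; apply/eqP; rewrite eq_le ?h1 ?h3 /=; lra.
exists [seq (p.1 * q.1, p.2 + q.2) | p <- s, q <- t]; split.
- move=> z; rewrite Fs Ft /qev big_allpairs_dep mulr_suml; apply: eq_bigr => p _.
  by rewrite mulr_sumr; apply: eq_bigr => q _ /=; rewrite qexpDl; ring.
- move=> p /allpairsP[[p1 p2] /= [ps pt ->]] a aR /=.
  rewrite dotDl mulrDr; apply: rpredD; [exact: ls | exact: lt'].
- move=> e p re /allpairsP[[p1 p2] /= [ps pt ->]] /=.
  by have [h1 h2] := top e p1 p2 re ps pt; split=> // /h2 [-> ->].
rewrite -ks -kt /cf big_mkcond big_allpairs_dep [in RHS]big_mkcond mulr_suml.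
rewrite big_seq [RHS]big_seq; apply: eq_bigr => p ps.
rewrite [in RHS]big_mkcond mulr_sumr big_seq [RHS]big_seq; apply: eq_bigr => q qt /=.
have [_ h2] := top d p q rd ps qt.
case: (eqVneq p.2 (L d)) => [pE|pn]; case: (eqVneq q.2 (L' d)) => [qE|qn].
- by rewrite pE qE eqxx.
- rewrite mulr0 ifF//; apply/eqP => E1; have [_ qE] := h2 (congr1 (fun w => dt w d) E1).
  by rewrite qE eqxx in qn.
- rewrite mul0r ifF//; apply/eqP => E1; have [pE _] := h2 (congr1 (fun w => dt w d) E1).
  by rewrite pE eqxx in pn.
- rewrite mul0r ifF//; apply/eqP => E1; have [pE _] := h2 (congr1 (fun w => dt w d) E1).
  by rewrite pE eqxx in pn.
Qed.

Lemma expsum_prod (I : eqType) (r : seq I) (L : I -> V -> V) (F : I -> VC -> C) (k : I -> C) :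
  (forall i, i \in r -> expsum (L i) (F i) (k i)) ->
  expsum (fun e => \sum_(i <- r) L i e) (fun z => \prod_(i <- r) F i z) (\prod_(i <- r) k i).
Proof.
elim: r => [|i r IH] H.
  rewrite big_nil; apply: (expsum_eq (expsum_const 1)) => *; by rewrite !big_nil.
rewrite big_cons; apply: (expsum_eq (expsumM (H i (mem_head _ _)) (IH _))).
- by move=> j jr; apply: H; rewrite inE jr orbT.
- by move=> e _; rewrite big_cons.
- by move=> z; rewrite big_cons.
Qed.

Lemma expsum_sum (I : eqType) (r : seq I) L (F : I -> VC -> C) (k : I -> C) : r != [::] ->
  (forall i, i \in r -> expsum L (F i) (k i)) ->
  expsum L (fun z => \sum_(i <- r) F i z) (\sum_(i <- r) k i).
Proof.
elim: r => // i r IH _ H; have [r0|rn] := eqVneq r [::].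
  rewrite r0 big_seq1; apply: (expsum_eq (H i (mem_head _ _))) => // z.
  by rewrite big_seq1.
rewrite big_cons; apply: (expsum_eq (expsumD (H i (mem_head _ _)) (IH rn _))) => //.
- by move=> j jr; apply: H; rewrite inE jr orbT.
- by move=> z; rewrite big_cons.
Qed.

(** The end point in direction [e] of the segment from $-a^\vee/2$ to $a^\vee/2$, the Newton
    polytope of a bracket. *)
Definition half_vtx a e : V := (Num.sg (dt a e) / 2) *: cr a.

Lemma expsum_br a j : a \in R -> expsum (half_vtx a) (fun z => br (dc (qv (cr a)) z + j))
  (if 0 < dt a d then Q j else - Q (- j)).
Proof.
move=> aR; exists [:: (Q j, 2^-1 *: cr a); (- Q (- j), - (2^-1 *: cr a))].
have half y : 2 * (f 2^-1 * y) = y.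
  by rewrite mulrA fmorphV rmorph_nat mulfV ?mul1r// (f2_neq0 Q).
split.
- move=> z; rewrite /qev big_cons big_seq1 /= qexpNl /qexp (qvecZ Q 2^-1 (cr a)) [dc (f 2^-1 *: _) _]dcZl half.
  by rewrite /qbr opprD !qpD !qpN; ring.
- have li : lat G R (2^-1 *: cr a).
    move=> b bR; rewrite dotZl mulrA mulfV ?mul1r ?pnatr_eq0//.
    exact: dot_coroot_int.
  move=> p; rewrite !inE => /orP[/eqP->//|/eqP-> b bR] /=.
  by rewrite dotNl mulrN rpredN li.
- move=> e p re; rewrite /half_vtx; have ce := coroot_gt0 aR.
  have [ae|ae|ae] := ltrgtP (dt a e) 0; last by have := re a aR; rewrite ae eqxx.
    have ca : dt (cr a) e < 0 by rewrite dot_corootl pmulr_rlt0.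
    rewrite (ltr0_sg ae) mulN1r scaleNr !inE => /orP[/eqP->|/eqP->] /=; last by [].
    by rewrite dotNl dotZl; split; first lra; move=> H; exfalso; lra.
  have ca : 0 < dt (cr a) e by rewrite dot_corootl pmulr_rgt0.
  rewrite (gtr0_sg ae) mul1r !inE => /orP[/eqP->|/eqP->] /=; first by [].
  by rewrite dotNl dotZl; split; first lra; move=> H; exfalso; lra.
have cN : (2^-1 *: cr a == - (2^-1 *: cr a)) = false.
  apply/negbTE; rewrite -subr_eq0 opprK -mulr2n -scaler_nat scalerA mulfV ?pnatr_eq0//.
  rewrite scale1r scaler_eq0 negb_or (gt_eqF (coroot_gt0 aR)).
  exact: root_neq0 hR _ aR.
rewrite /cf !big_cons big_nil /= /half_vtx.
have [ad|ad|ad] := ltrgtP (dt a d) 0; last by have := rd aR; rewrite ad eqxx.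
  by rewrite (ltr0_sg ad) mulN1r scaleNr cN eqxx addr0.
by rewrite (gtr0_sg ad) mul1r eqxx eq_sym cN addr0.
Qed.

Lemma expsum_top L F F' k k' : expsum L F k -> expsum L F' k' -> (forall z, F z = F' z) -> k = k'.
Proof.
move=> [s [Fs _ _ <-]] [t [Ft _ _ <-]] FF.
have := @cf_eq0 _ _ _ _ hG Q (s ++ [seq (- p.1, p.2) | p <- t]) _ (L d).
rewrite cf_cat => H; apply/eqP; rewrite -subr_eq0 -[X in _ == X]H; last first.
  move=> z; rewrite ev_cat -Fs FF Ft /qev big_map /= -big_split /= big1// => p _.
  by rewrite mulNr subrr.
by apply/eqP; congr (_ + _); rewrite /cf big_map /= -sumrN.
Qed.

(* The uniqueness principle: an exponential sum whose support has long strings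
   but misses a vertex of the corresponding zonotope vanishes. *)
Lemma expsum_eq0 (k : V -> K) F : kinv G R k -> expsum (vtx k) F 0 ->
  (forall s, (forall z, F z = ev s z) -> (forall p, p \in s -> lat G R p.2) ->
     strings G R (supp s) k) ->
  forall z, F z = 0.
Proof.
move=> kk [s [Fs ls hs ks]] SP z; rewrite Fs; apply: ev_supp_nil.
apply: (strings_nil hG hR kk (SP s Fs ls) rd).
  by move=> e y re /mem_supp[p ps ->]; case: (hs e p re ps).
by rewrite mem_filter ks eqxx.
Qed.

End ExpSums.

(** * Polynomial solutions of linear systems with polynomial coefficients *)

Local Notation "x %:F" := (@FracField.tofrac _ x).

Section PolyKernel.
Local Open Scope quotient_scope.

Lemma frac_num_den (D : idomainType) (x : {fraction D}) :
  exists a b : D, b != 0 /\ x * b%:F = a%:F.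
Proof.
elim/quotW: x => r; exists (frac r).1, (frac r).2; split; first exact: denom_ratioP.
unlock FracField.tofrac; rewrite -[LHS]FracField.pi_mul; apply/eqmodP => /=.
rewrite FracField.equivfE /FracField.mulf !numden_Ratio ?mulf_neq0 ?oner_neq0 ?denom_ratioP//.
by rewrite !mulr1 mulrC.
Qed.

Lemma common_den (D : idomainType) p (u : 'cV[{fraction D}]_p) :
  exists b : D, exists a : 'cV[D]_p, b != 0 /\ forall i, u i 0 * b%:F = (a i 0)%:F.
Proof.
have ex i : exists ab : D * D, ab.2 != 0 /\ u i 0 * ab.2%:F = ab.1%:F.
  by have [a [b [b0 E]]] := frac_num_den (u i 0); exists (a, b).
have [g Hg] := boolp.choice ex.
exists (\prod_i (g i).2), (\col_i ((g i).1 * \prod_(j | j != i) (g j).2)); split.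
  by apply/prodf_neq0 => i _; case: (Hg i).
move=> i; rewrite mxE (bigD1 i)//= !tofracM mulrA; case: (Hg i) => _ ->.
by [].
Qed.

Variable C : fieldType.

(** Were the kernel zero over the fraction field, some maximal minor would be a nonzero polynomial;
    at a point where it does not vanish the evaluated system could have no kernel. A kernel vector
    over the fraction field is then cleared of denominators. *)
Lemma poly_kernel N p (M : 'M[{poly C}]_(N, p)) :
  (forall D : {poly C}, D != 0 -> exists (T : C) (w : 'cV[C]_p),
     [/\ D.[T] != 0, w != 0 & map_mx (fun q : {poly C} => q.[T]) M *m w = 0]) ->
  exists2 u : 'cV[{poly C}]_p, u != 0 & M *m u = 0.
Proof.
move=> H; pose tf := @FracField.tofrac {poly C}; pose A := map_mx tf M.
have [fA|nfA] := boolP (row_full A).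
  exfalso; pose g := fullrankfun fA.
  have : \det (rowsub g A) != 0.
    by rewrite -unitfE -unitmxE; apply: fullrowsub_unit.
  have -> : rowsub g A = map_mx tf (rowsub g M) by rewrite map_mxsub.
  rewrite det_map_mx tofrac_eq0 => /H[T [w [DT w0 Mw]]].
  have E : \det (map_mx (horner_eval T) (rowsub g M)) != 0 by rewrite det_map_mx.
  have wk : map_mx (horner_eval T) (rowsub g M) *m w = 0.
    rewrite map_mxsub mul_rowsub_mx (_ : map_mx _ M *m w = 0) ?Mw//.
    by apply/matrixP => i j; rewrite !mxE.
  have uM : map_mx (horner_eval T) (rowsub g M) \in unitmx by rewrite unitmxE unitfE.
  by move/eqP: w0; apply; rewrite -[w](mulKmx uM) wk mulmx0.
move: nfA; rewrite -cokermx_eq0 => /matrix0Pn[i0 [j0 k0]].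
pose v := col j0 (cokermx A).
have Av : A *m v = 0 by rewrite /v colE mulmxA mulmx_coker mul0mx.
have [b [a [b0 Ea]]] := common_den v.
exists a.
  apply/eqP => a0; have := Ea i0; rewrite a0 [X in _ = X%:F]mxE tofrac0 => /eqP.
  by rewrite mulf_eq0 tofrac_eq0 (negPf b0) orbF /v mxE (negPf k0).
apply/matrixP => i j; rewrite ord1 !mxE; apply/eqP; rewrite -tofrac_eq0 rmorph_sum.
have /matrixP/(_ i 0) := Av; rewrite !mxE => /(congr1 (fun x => x * b%:F)).
rewrite mul0r mulr_suml => /eqP; congr (_ == _); apply: eq_bigr => l _.
by rewrite -mulrA Ea mxE -tofracM.
Qed.

End PolyKernel.

Section PolyKernelSeq.
Variable C : fieldType.

Lemma poly_kernel_seq (I J : eqType) (L : seq I) (S : seq J) (M : I -> J -> {poly C}) :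
  uniq S ->
  (forall D : {poly C}, D != 0 -> exists (T : C) (w : J -> C), [/\ D.[T] != 0,
     exists2 j, j \in S & w j != 0 &
     forall i, i \in L -> \sum_(j <- S) (M i j).[T] * w j = 0]) ->
  exists2 u : J -> {poly C}, exists2 j, j \in S & u j != 0 &
    forall i, i \in L -> \sum_(j <- S) M i j * u j = 0.
Proof.
move=> uS H; case: S uS H => [|j0 S'] uS H.
  by have [T [w [_ [j]]]] := H 1 (oner_neq0 _).
set S := j0 :: S' in uS H *.
case: L H => [|i0 L'] H; first by exists (fun=> 1); [exists j0; rewrite ?mem_head ?oner_neq0|].
set L := i0 :: L' in H *.
pose A := \matrix_(i < size L, j < size S) M (tnth (in_tuple L) i) (tnth (in_tuple S) j).
have [|U U0 AU] := @poly_kernel C _ _ A.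
  move=> D /H[T [w [DT [j jS wj] Hw]]]; exists T, (\col_j w (tnth (in_tuple S) j)); split=> //.
    apply/eqP => /matrixP w0; case/seq_tnthP: jS => k kE.
    by move: wj; rewrite kE; have := w0 k 0; rewrite !mxE => ->; rewrite eqxx.
  apply/matrixP => i k; rewrite !mxE -[RHS](Hw (tnth (in_tuple L) i) (mem_tnth _ _)).
  by rewrite [RHS]big_tnth; apply: eq_bigr => j' _; rewrite !mxE.
pose u j := U (inord (index j S)) 0.
have uE k : u (tnth (in_tuple S) k) = U k 0.
  rewrite /u (tnth_nth j0) index_uniq//.
  by congr (U _ _); apply: val_inj; rewrite /= inordK.
exists u.
  move/matrix0Pn: U0 => [k [l Ukl]]; exists (tnth (in_tuple S) k); first exact: mem_tnth.
  by rewrite uE; rewrite (ord1 l) in Ukl.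
move=> i /seq_tnthP[k ->]; have /matrixP/(_ k 0) := AU; rewrite !mxE => E.
by rewrite -[RHS]E [LHS]big_tnth; apply: eq_bigr => j _; rewrite uE !mxE.
Qed.

(** [D] and [V] are the degree and the order of vanishing at 0 of the family [u] as a whole. *)
Lemma poly_support (J : eqType) (S : seq J) (u : J -> {poly C}) :
  (exists2 j, j \in S & u j != 0) -> exists D V : nat,
  [/\ exists2 j, j \in S & (u j)`_D != 0, forall j k, j \in S -> (D < k)%N -> (u j)`_k = 0,
      exists2 j, j \in S & (u j)`_V != 0 & forall j k, j \in S -> (k < V)%N -> (u j)`_k = 0].
Proof.
case=> j0 j0S u0; pose P k := has (fun j => (u j)`_k != 0) S.
have exP : exists k, P k.
  by exists (size (u j0)).-1; apply/hasP; exists j0; rewrite // -/(lead_coef _) lead_coef_eq0.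
have bP k : P k -> (k <= \sum_(j <- S) size (u j))%N.
  case/hasP => j jS; apply: contraR; rewrite -ltnNge => lt; rewrite nth_default//.
  by apply: leq_trans (ltnW lt); rewrite (big_rem j)//= leq_addr.
have [D PD maxD] := ex_maxnP exP bP; have [V PV minV] := ex_minnP exP.
exists D, V; split; try by apply/hasP.
- move=> j k jS Dk; apply/eqP; apply: contraTT Dk => uk; rewrite -leqNgt maxD//.
  by apply/hasP; exists j.
- move=> j k jS kV; apply/eqP; apply: contraTT kV => uk; rewrite -leqNgt minV//.
  by apply/hasP; exists j.
Qed.

Lemma poly_eq_char0 (P : {poly C}) : (forall k, k.+1%:R != 0 :> C) ->
  (forall w, w != 0 -> P.[w] = 0) -> P = 0.
Proof.
move=> ch H; apply/eqP; apply: contraT => P0.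
pose rs := [seq k.+1%:R : C | k <- iota 0 (size P)].
have inj k l : (k <= l)%N -> k.+1%:R = l.+1%:R :> C -> k = l.
  move=> kl /eqP; rewrite eq_sym -subr_eq0 -natrB// subSS.
  by case E : (l - k)%N => [|q] //; [move=> _; apply/eqP; rewrite eqn_leq kl -subn_eq0 E|rewrite (negPf (ch q))].
have := @max_poly_roots _ P rs P0; rewrite size_map size_iota ltnn; apply.
  by apply/allP => w /mapP[k _ ->]; apply/rootP; apply: H.
rewrite map_inj_uniq ?iota_uniq// => k l E.
by have [kl|/ltnW lk] := leqP k l; [apply: inj|apply/esym; apply: inj].
Qed.
End PolyKernelSeq.

(** * Vertex coefficients of psi and the x-equation up to a constant *)

Section Psi.
Context {K : realType} {C : fieldType} {n : nat}.
Local Notation V := 'rV[K]_n.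
Local Notation VC := 'rV[C]_n.
Variables (G : 'M[K]_n) (hG : euclidean G) (Q : qchar K C) (R : {fset V}).
Hypothesis hR : reduced_irreducible_root_system G R.
Local Notation dt := (dot G).
Local Notation cr := (coroot G).
Local Notation rf := (reflection G).
Local Notation f := (qemb Q).
Local Notation dc := (qdot G Q).
Local Notation qv := (qvec Q).
Local Notation E := (qexp G Q).
Local Notation psum := (qpsum G Q).
Local Notation br := (qbr Q).
Local Notation vtx := (vertex G R).
Local Notation str := (qstr G Q).
Local Notation dot_sym := (dot_sym hG).
Local Notation dotDr := (dotDr hG).
Local Notation dotZr := (dotZr hG).
Local Notation dotNr := (dotNr hG).
Local Notation dotBr := (dotBr hG).
Local Notation dot_gt0 := (dot_gt0 hG).
Local Notation reflectionE := (reflectionE hG).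
Local Notation dot_root_neq0 := (dot_root_neq0 hG hR).
Local Notation dot_coroot2 := (dot_coroot2 hG hR).
Local Notation dot_coroot2' := (dot_coroot2' hG hR).
Local Notation coroot_gt0 := (coroot_gt0 hG hR).
Local Notation sgr_coroot := (sgr_coroot hG hR).
Local Notation reflection_self := (reflection_self hG hR).
Local Notation reflectionK := (reflectionK hG hR).
Local Notation reflection_dot := (reflection_dot hG hR).
Local Notation reflection_dotl := (reflection_dotl hG hR).
Local Notation root_opp := (root_opp hG hR).
Local Notation vtx_adj := (vtx_adj hG hR).
Local Notation vtx_wall := (vtx_wall hG hR).
Local Notation root_eqN := (root_eqN hR).
Variables (d : V) (Rp : {fset V}).
Hypothesis rd : regular G R d.
Hypothesis RpE : Rp = [fset a in R | 0 < dt a d]%fset.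
Variable m : V -> nat.
Hypothesis hm : forall a b, a \in R -> b \in R -> m (rf a b) = m b.
Local Notation mk := (fun a => (m a)%:R : K).
Variables (S0 : seq V) (c : V -> VC -> C).
Hypothesis uS0 : uniq S0.
Hypothesis S0P : forall v, v \in S0 -> polytope G R m v.
Hypothesis S0I : forall v a, v \in S0 -> a \in R -> dt v a \is a Num.int.
Hypothesis S0v : forall e, regular G R e -> vtx mk e \in S0.
Definition psi_seq x : seq (C * V) := [seq (c v x, v) | v <- S0].
Hypothesis hQI : forall x a i z, a \in R -> (1 <= i <= m a)%N -> wall G Q a z ->
  psum x (psi_seq x) (z + qv ((i%:R / 2) *: a)) =
  psum x (psi_seq x) (z - qv ((i%:R / 2) *: a)).

Lemma br_mul s t : br s * br t = Q (s + t) + (Q (s + t))^-1 - (Q (s - t) + (Q (s - t))^-1).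
Proof.
rewrite /qbr !qpD !qpN; have := qp_neq0 Q s; have := qp_neq0 Q t.
by move=> t0 s0; field; rewrite t0 s0.
Qed.

Lemma br_gen x a (j : K) : gen G Q R x -> a \in R -> j \is a Num.int ->
  br (f j + dc (qv a) x) != 0.
Proof.
move=> gx aR ji; rewrite br_eq0; apply/eqP => E1.
have := gx a (- (4 * j)) aR; rewrite rpredN rpredM ?rpred_nat// => /(_ isT) /eqP; apply.
rewrite rmorphN qpN; apply: (mulIf (qp_neq0 Q (f (4 * j)))); rewrite mulVf ?qp_neq0// -qpD.
have := congr1 (fun y => y ^+ 2) E1; rewrite expr1n -qpMn => {2}<-; congr (Q _).
by rewrite rmorphM rmorph_nat dcC//; ring.
Qed.

Lemma br_nat j : br j.+1%:R != 0.
Proof.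
rewrite br_eq0 -natrM -(rmorph_nat f); apply: qp_int; first exact: rpred_nat.
by rewrite pnatr_eq0.
Qed.

Lemma mN a : a \in R -> m (- a) = m a.
Proof. by move=> aR; rewrite -(reflection_self aR) hm. Qed.

Lemma mkinv : kinv G R mk.
Proof. by move=> a b aR bR; rewrite hm. Qed.

(** The $m_a$ moments along the edge joining the two vertices are combined with the polynomial, of
    degree $m_a-1$, that vanishes at the nodes of the inner lattice points of the edge. Only the two
    end points survive. *)
Lemma vertex_step a e d0 e2 x : adj G R a e d0 e2 -> gen G Q R x ->
  c (vtx mk e2) x * \prod_(1 <= j < (m a).+1) br (j%:R + dc (qv a) x) =
  c (vtx mk e) x * \prod_(1 <= j < (m a).+1) br (j%:R - dc (qv a) x).
Proof.
move=> A gx; have [aR ad0 _ _ _] := A; set X := dc _ _.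
have [re re2] := adj_reg A.
have e2E : vtx mk e2 = vtx mk e + (m a)%:R *: cr a by rewrite (vtx_adj mkinv A).
case mE : (m a) => [|M].
  by rewrite !big_nil !mulr1 e2E mE scale0r addr0.
set b := vtx mk e in e2E *.
(* The value of [qstr] at the [j]-th lattice point of the edge: the starting vertex pairs with [a]
   to $-m_a$, and each step adds 2. *)
pose u (j : nat) := Q (X - M.+1%:R + 2 * j%:R).
have uE j : str x a (b + j%:R *: cr a) = u j.
  rewrite /qstr dotDl dotZl dot_coroot2'// (vtx_wall mkinv A) mE /u dcC//.
  by congr (Q _); rewrite rmorphD rmorphN rmorphM !rmorph_nat -/X; ring.
pose W (j : nat) := u j + (u j)^-1.
pose p := \prod_(1 <= j < M.+1) ('X - (W j)%:P).
have sp : (size p <= M.+1)%N by rewrite size_prod_XsubC size_iota subn1.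
pose t v := c v x * (str x a v - (str x a v)^-1) * p.[str x a v + (str x a v)^-1].
have sum0 : \sum_(v <- S0 | coset G a b v) t v = 0.
  have AM r : (r < M.+1)%N -> \sum_(v <- S0 | coset G a b v)
      c v x * (str x a v - (str x a v)^-1) * (str x a v + (str x a v)^-1) ^+ r = 0.
    move=> rM; have := @anti_moments _ _ _ G Q x (psi_seq x) a M.+1 b _ r rM.
    rewrite big_map /=; apply=> i iM; apply: (anti_coef hG hR) => // z.
    by apply: hQI => //; rewrite mE.
  rewrite /t; under eq_bigr => v _ do rewrite horner_coef mulr_sumr.
  rewrite exchange_big /= big1// => i _.
  under eq_bigr => v _ do rewrite mulrCA.
  by rewrite -mulr_sumr AM ?mulr0//; apply: leq_trans (ltn_ord i) sp.
have pW j : p.[W j] = \prod_(1 <= i < M.+1) (W j - W i).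
  by rewrite /p horner_prod; apply: eq_bigr => i _; rewrite hornerXsubC.
have S0b : b \in S0 by apply: S0v.
have S0e2 : vtx mk e2 \in S0 by apply: S0v.
have ca0 : M.+1%:R *: cr a != 0.
  by rewrite scaler_eq0 pnatr_eq0 /= scaler_eq0 (gt_eqF (coroot_gt0 aR)) (root_neq0 hR aR).
have e2b : vtx mk e2 != b.
  by rewrite e2E mE -subr_eq0 addrC addKr.
have tt : t b + t (vtx mk e2) = 0.
  have ce2 : coset G a b (vtx mk e2).
    by rewrite e2E; apply/asboolP; exists (m a)%:R; rewrite ?rpred_nat.
  rewrite -[RHS]sum0 -big_filter (bigD1_seq b) ?filter_uniq//=; last first.
    by rewrite mem_filter cosetxx.
  congr (_ + _); rewrite -big_filter (bigD1_seq (vtx mk e2)) ?filter_uniq//=; last first.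
    by rewrite !mem_filter ce2 e2b.
  rewrite big1_seq ?addr0// => v; rewrite !mem_filter => /andP[ve2 /andP[vb /andP[cv vS]]].
  move/asboolP: (cv) => [j ji vE].
  (* Points of the coset have the same pairing with [d0] as the vertex, so those in the polytope lie
     on the edge. *)
  have [|r /andP[r0 rm] vE'] := polytope_wall hG hR hm A (S0P vS).
    by rewrite vE dotDl dotZl dot_corootl ad0 !mulr0 addr0.
  have jr : j = r.
    have : (j - r) *: cr a = 0.
      by apply/eqP; rewrite scalerBl subr_eq0; apply/eqP; apply: (addrI b); rewrite -vE.
    move/eqP; rewrite scaler_eq0 subr_eq0 => /orP[/eqP//|].
    by rewrite scaler_eq0 (gt_eqF (coroot_gt0 aR)) (negPf (root_neq0 hR aR)).
  have [i iE] : exists i : nat, j = i%:R.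
    by apply/natrP; rewrite natrEint ji jr.
  have iM : (i <= M.+1)%N by rewrite -(ler_nat K) -iE jr -mE.
  have i0 : (0 < i)%N.
    by case: (i) iE vb => // j0; rewrite vE j0 scale0r addr0 eqxx.
  have iM' : (i < M.+1)%N.
    rewrite ltn_neqAle iM andbT; apply: contra ve2 => /eqP iM1.
    by rewrite vE e2E iE iM1 mE.
  rewrite /t vE iE uE -/(W i) pW (bigD1_seq i) ?iota_uniq//=.
    by rewrite subrr mul0r mulr0.
  by rewrite mem_index_iota i0.
have B0 : \prod_(1 <= j < M.+1) br j%:R != 0.
  rewrite prodf_seq_neq0; apply/allP => j; rewrite mem_index_iota => /andP[j0 _] /=.
  by case: j j0 => // j _; apply: br_nat.
have W0 : \prod_(1 <= i < M.+1) (W 0%N - W i) =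
    (-1) ^+ M * (\prod_(1 <= i < M.+1) br (X - M.+1%:R + i%:R)) * \prod_(1 <= i < M.+1) br i%:R.
  have -> : (-1) ^+ M = \prod_(1 <= i < M.+1) (-1 : C).
    by rewrite prodr_const_nat subn1.
  rewrite -!big_split; apply: eq_bigr => i _ /=; rewrite mulN1r mulNr -mulrN -brN br_mul.
  by rewrite /W /u; congr (Q _ + (Q _)^-1 - (Q _ + (Q _)^-1)); ring.
have WM : \prod_(1 <= i < M.+1) (W M.+1 - W i) =
    (\prod_(1 <= i < M.+1) br (i%:R + X)) * \prod_(1 <= i < M.+1) br i%:R.
  rewrite [X in _ * X]big_nat_rev /= -big_split; apply: eq_big_nat => i /andP[i0 iM] /=.
  rewrite br_mul /W /u add1n subSS natrB; last by apply: ltnW.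
  by congr (Q _ + (Q _)^-1 - (Q _ + (Q _)^-1)); ring.
have u0 : u 0%N - (u 0%N)^-1 = br (X - M.+1%:R).
  by rewrite /u mulr0 addr0 /qbr qpN.
have uM : u M.+1 - (u M.+1)^-1 = br (M.+1%:R + X).
  by rewrite /u /qbr qpN; congr (Q _ - (Q _)^-1); ring.
have b0E : str x a b = u 0%N by rewrite -uE scale0r addr0.
have e2u : str x a (vtx mk e2) = u M.+1 by rewrite e2E mE uE.
move: tt; rewrite /t b0E e2u -/(W 0%N) -/(W M.+1) !pW W0 WM u0 uM => tt.
have -> : \prod_(1 <= j < M.+2) br (j%:R + X) =
    (\prod_(1 <= i < M.+1) br (i%:R + X)) * br (M.+1%:R + X) by rewrite big_nat_recr.
have -> : \prod_(1 <= j < M.+2) br (j%:R - X) =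
    - ((-1) ^+ M * (\prod_(1 <= i < M.+1) br (X - M.+1%:R + i%:R)) * br (X - M.+1%:R)).
  rewrite (eq_bigr (fun j => -1 * br (X - j%:R))); last first.
    by move=> j _; rewrite mulN1r -brN opprB.
  rewrite big_split /= prodr_const_nat subn1 /= exprS.
  have -> : \prod_(1 <= j < M.+2) br (X - j%:R) =
      br (X - M.+1%:R) * \prod_(1 <= i < M.+1) br (X - M.+1%:R + i%:R).
    rewrite big_nat_rev /= big_ltn// big_add1 /= add1n subSS subn1; congr (_ * _).
    apply: eq_big_nat => i /andP[i0 iM]; rewrite !subSS natrB ?(ltnW iM)//.
    by congr (br _); ring.
  by ring.
apply: (mulIf B0); apply/eqP; rewrite -subr_eq0; apply/eqP.
by rewrite -[RHS]tt; ring.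
Qed.

(** The normalization of $\psi_{\rho^\vee}$ transported to the positive system of [e]. *)
Definition vcoef e x := \prod_(a <- R | 0 < dt a e)
  \prod_(1 <= j < (m a).+1) br (j%:R - dc (qv a) x).

Hypothesis htop : forall x, c (vtx mk d) x = vcoef d x.

Lemma vcoef_sg e e' x : (forall a, a \in R -> Num.sg (dt a e) = Num.sg (dt a e')) ->
  vcoef e x = vcoef e' x.
Proof.
move=> H; rewrite /vcoef big_seq_cond [RHS]big_seq_cond; apply: eq_bigl => a.
by case: (boolP (a \in R)) => //= aR; rewrite -sgr_gt0 H// sgr_gt0.
Qed.

Lemma chamber_near e : regular G R e -> exists e', [/\ regular G R e',
  generic2 G R d e' & forall a, a \in R -> Num.sg (dt a e') = Num.sg (dt a e)].
Proof.
move=> re; have [e' [re' ge' esg]] := generic2_near hG hR (enum_fset R) e rd.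
by exists e'; split=> // a aR; apply: esg => //; apply: re.
Qed.

Lemma br_nat_neq0 x a j : gen G Q R x -> a \in R -> br (j%:R + dc (qv a) x) != 0.
Proof. by move=> gx aR; rewrite -(rmorph_nat f); apply: br_gen => //; apply: rpred_nat. Qed.

Lemma vcoef_neq0 e x : gen G Q R x -> vcoef e x != 0.
Proof.
move=> gx; rewrite /vcoef prodf_seq_neq0; apply/allP => a aR; apply/implyP => _.
rewrite prodf_seq_neq0; apply/allP => j _ /=; rewrite -[_ - _]/(_ + - _) -dcNl -qvecN.
by apply: br_nat_neq0 => //; rewrite root_opp.
Qed.

(** Walk from the chamber of [d], where the coefficient is the normalization. Across the wall of [a]
    the factor of [- a] is replaced by that of [a], which is what [vertex_step] gives. *)
Lemma vertex_coef e x : regular G R e -> gen G Q R x -> c (vtx mk e) x = vcoef e x.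
Proof.
move=> re gx; have [e' [re' ge' esg]] := chamber_near re.
pose P e1 := c (vtx mk e1) x = vcoef e1 x.
have step a e1 d0 e2 t s : 0 < t -> 0 < s -> d0 = e1 + t *: e' -> e2 = d0 + s *: e' ->
    adj G R a e1 d0 e2 -> P e1 -> P e2.
  move=> _ _ _ _ A; rewrite /P => Pe1.
  have [aR ad0 ae1 ae2 H] := A.
  have tt e3 (F : V -> C) : \prod_(b <- R | 0 < dt b e3) F b =
      \prod_(b <- R | [&& 0 < dt b e3, b != a & b != - a]) F b *
      ((if 0 < dt a e3 then F a else 1) * (if 0 < dt (- a) e3 then F (- a) else 1)).
    rewrite big_mkcond (big_fsetD1 a)//= (big_fsetD1 (- a)) /=; last first.
      by rewrite !inE root_opp// eq_sym root_eqN.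
    rewrite mulrA mulrC; congr (_ * _).
    rewrite big_mkcond [RHS]big_mkcond [RHS](big_fsetD1 a)//=.
    rewrite [X in _ = _ * X](big_fsetD1 (- a)) /=; last first.
      by rewrite !inE root_opp// eq_sym root_eqN.
    rewrite !eqxx /= !andbF !mul1r; apply: eq_big_seq => b.
    by rewrite !inE => /andP[-> /andP[-> _]]; rewrite !andbT.
  have := vertex_step A gx; rewrite Pe1 /vcoef !tt ae2 (ltNge 0 (dt a e1)) (ltW ae1) /=.
  rewrite !dotNl !oppr_gt0 ae1 (ltNge (dt a e2)) (ltW ae2) /= mulr1 mul1r.
  have -> : \prod_(1 <= j < (m (- a)).+1) br (j%:R - dc (qv (- a)) x) =
      \prod_(1 <= j < (m a).+1) br (j%:R + dc (qv a) x).
    by rewrite mN//; apply: eq_bigr => j _; rewrite qvecN dcNl opprK.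
  have Pi0 : \prod_(1 <= j < (m a).+1) br (j%:R + dc (qv a) x) != 0.
    by rewrite prodf_seq_neq0; apply/allP => j _ /=; apply: br_nat_neq0.
  move=> E1; apply: (mulIf Pi0); rewrite E1 mulrAC; congr (_ * _ * _).
  rewrite big_seq_cond [RHS]big_seq_cond; apply: eq_bigl => b.
  case: (boolP (b \in R)) => //= bR; case: (eqVneq b a) => [|ba]; first by rewrite !andbF.
  case: (eqVneq b (- a)) => [|bNa]; rewrite ?andbF ?andbT//.
  by have [_ h1 h2] := H b bR ba bNa; rewrite -sgr_gt0 h1 -h2 sgr_gt0.
have [|e1 Pe1 e1sg] := path_ind hG hR step rd re' ge'; first exact: htop.
have eqsg a : a \in R -> Num.sg (dt a e1) = Num.sg (dt a e).
  by move=> aR; rewrite e1sg// esg.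
by rewrite -(vtx_sg mk eqsg) -(vcoef_sg x eqsg).
Qed.

Lemma br_telescope X k : br X != 0 ->
  br (X - k%:R) / br X * \prod_(1 <= j < k.+1) br (j%:R - (X + 1)) =
  \prod_(1 <= j < k.+1) br (j%:R - X).
Proof.
move=> X0.
have E1 : br X * \prod_(1 <= j < k.+1) br (j%:R - X) =
    br (X - k%:R) * \prod_(1 <= j < k.+1) br (j%:R - (X + 1)).
  apply: oppr_inj; rewrite -!mulNr -!brN opprB.
  have -> : br (- X) * \prod_(1 <= j < k.+1) br (j%:R - X) =
      \prod_(0 <= j < k.+1) br (j%:R - X) by rewrite [RHS]big_ltn// sub0r.
  rewrite big_nat_recr//= mulrC; congr (_ * _); rewrite big_add1 /=.
  by apply: eq_bigr => j _; congr (br _); rewrite -natr1; ring.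
by rewrite mulrAC -E1 mulrAC mulfV ?mul1r.
Qed.

Definition xcoef (t : V) (x : VC) : C :=
  (\prod_(a <- R | 0 < dt a t) (br (dc (qv a) x - (m a)%:R) / br (dc (qv a) x))) *
  (\prod_(a <- R | dt a t == 2) (br (dc (qv a) x - (m a)%:R + 1) / br (dc (qv a) x + 1))).

(** Root by root, moving [x] by [t] shifts the run of brackets in [vcoef] by $(a,t)\in\{0,1,2\}$,
    and the factors of $a_t(x)$ are the telescoping quotients. *)
Lemma xcoef_vcoef e t x : gen G Q R x ->
  (forall a, a \in R -> 0 < dt a t -> 0 < dt a e) ->
  (forall a, a \in R -> 0 < dt a e -> [\/ dt a t = 0, dt a t = 1 | dt a t = 2]) ->
  xcoef t x * vcoef e (x + qv t) = vcoef e x.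
Proof.
move=> gx h1 h2.
have two0 : 0 < 2 :> K by rewrite ltr0n.
rewrite /xcoef (big_seq_cond (fun a => 0 < dt a t)) (big_seq_cond (fun a => dt a t == 2)).
rewrite /vcoef 2!(big_seq_cond (fun a => 0 < dt a e)).
have -> : \prod_(i <- R | (i \in R) && (0 < dt i t)) (br (dc (qv i) x - (m i)%:R) / br (dc (qv i) x)) =
  \prod_(i <- R | (i \in R) && (0 < dt i e))
    (if 0 < dt i t then br (dc (qv i) x - (m i)%:R) / br (dc (qv i) x) else 1).
  rewrite -big_mkcondr; apply: eq_bigl => a; case: (boolP (a \in R)) => //= aR.
  by case: (boolP (0 < dt a t)) => [/(h1 a aR) ->|]; rewrite ?andbF.
have -> : \prod_(i <- R | (i \in R) && (dt i t == 2))
      (br (dc (qv i) x - (m i)%:R + 1) / br (dc (qv i) x + 1)) =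
  \prod_(i <- R | (i \in R) && (0 < dt i e))
    (if dt i t == 2 then br (dc (qv i) x - (m i)%:R + 1) / br (dc (qv i) x + 1) else 1).
  rewrite -big_mkcondr; apply: eq_bigl => a; case: (boolP (a \in R)) => //= aR.
  case: (eqVneq (dt a t) 2) => [a2|]; rewrite ?andbF//.
  by rewrite h1// a2.
rewrite -!big_split; apply: eq_bigr => a /andP[aR ae] /=.
rewrite dcDr// dc_real.
set X := dc (qv a) x.
have X0 : br X != 0 by rewrite -[X]add0r -[0]/(0%:R); apply: br_nat_neq0.
have X1 : br (X + 1) != 0 by rewrite addrC -[1]/(1%:R); apply: br_nat_neq0.
case: (h2 a aR ae) => ->.
- by rewrite ltxx eq_sym (gt_eqF two0) !mul1r rmorph0 addr0.
- rewrite ltr01 -[1 == 2]/(1%:R == 2%:R) eqr_nat mulr1 rmorph1.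
  exact: br_telescope.
rewrite two0 eqxx rmorph_nat -mulrA -[X + 2]/(X + (1 + 1)) addrA.
by rewrite [X - _ + 1]addrAC !br_telescope.
Qed.

(** Chosen so that $k_a a^\vee=m_a a$; with these multiplicities the vertex in direction [d] is
    $\rho$. *)
Definition kroot (a : V) : K := (m a)%:R * dt a a / 2.

Lemma kroot_inv : kinv G R kroot.
Proof. by move=> a b aR bR; rewrite /kroot hm// reflection_dot. Qed.

Lemma kroot_coroot a : a \in R -> kroot a *: cr a = (m a)%:R *: a.
Proof.
move=> aR; rewrite /kroot /coroot scalerA; congr (_ *: _).
by have := dot_root_neq0 aR => aa; field.
Qed.

Lemma vtxN k e : vtx k (- e) = - vtx k e.
Proof.
rewrite /vertex -scalerN -sumrN; congr (_ *: _); apply: eq_bigr => b _.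
by rewrite dotNr sgrN mulNr scaleNr.
Qed.

(** Across the wall of [a] the images of $\rho$ differ by $m_a a$ and their midpoint is orthogonal
    to [a], so quasi-invariance with $s=m_a$ equates the two values of psi. Walking to the opposite
    chamber turns $\rho$ into $-\rho$. *)
Lemma psi_opp_rho x :
  psum x (psi_seq x) (qv (vtx kroot d)) = psum x (psi_seq x) (- qv (vtx kroot d)).
Proof.
have rNd : regular G R (- d) by move=> a aR; rewrite dotNr oppr_eq0 rd.
have [e' [re' ge' esg]] := chamber_near rNd.
pose P e1 := psum x (psi_seq x) (qv (vtx kroot e1)) = psum x (psi_seq x) (qv (vtx kroot d)).
have step a e1 d0 e2 t s : 0 < t -> 0 < s -> d0 = e1 + t *: e' -> e2 = d0 + s *: e' ->
    adj G R a e1 d0 e2 -> P e1 -> P e2.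
  move=> _ _ _ _ A; rewrite /P => <-.
  have [aR _ _ _ _] := A.
  have E2 : vtx kroot e2 = vtx kroot e1 + (m a)%:R *: a.
    by rewrite (vtx_adj kroot_inv A) kroot_coroot.
  case mE : (m a) => [|M]; first by rewrite E2 mE scale0r addr0.
  pose z0 := vtx kroot e1 + ((m a)%:R / 2) *: a.
  have z0P : qv (vtx kroot e2) = qv z0 + qv (((m a)%:R / 2) *: a).
    rewrite -qvecD E2 /z0; congr (qv _); rewrite -addrA -scalerDl; congr (_ + _ *: _).
    by field.
  have z0N : qv (vtx kroot e1) = qv z0 - qv (((m a)%:R / 2) *: a).
    by rewrite -qvecB /z0 addrK.
  rewrite z0P z0N; apply: hQI => //; first by rewrite mE leqnn.
  rewrite /wall /qexp dc_real dot_corootl /z0 dotDr [dt a (_ / 2 *: a)]dotZr (dot_sym a (vtx _ _)).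
  rewrite (vtx_wall kroot_inv A).
  have -> : - kroot a + (m a)%:R / 2 * dt a a = 0 by rewrite /kroot; ring.
  by rewrite mulr0 rmorph0 mulr0 qp0.
have [|e1 Pe1 e1sg] := path_ind hG hR step rd re' ge'; first by [].
have eqsg a : a \in R -> Num.sg (dt a e1) = Num.sg (dt a (- d)).
  by move=> aR; rewrite e1sg// esg.
by rewrite -Pe1 (vtx_sg kroot eqsg) vtxN qvecN.
Qed.

Lemma psi_seq_lat x p : p \in psi_seq x -> lat G R p.2.
Proof.
move=> /mapP[v vS -> a aR] /=; apply: rpredM; first exact: rpred_nat.
exact: S0I.
Qed.

Lemma S0_hull v e : regular G R e -> v \in S0 ->
  dt v e <= dt (vtx mk e) e /\ (dt v e = dt (vtx mk e) e -> v = vtx mk e).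
Proof. by move=> re vS; apply: (polytope_vtx hG hR re (S0P vS)). Qed.

(** Strings stay within a coset of the coroot lattice. Hence the part of the support outside the
    coset of $\rho^\vee$ has long strings too, but misses a vertex, and is empty. *)
Lemma psi_coset x v : gen G Q R x -> v \in S0 -> c v x != 0 -> inQ G R (v - vtx mk d).
Proof.
move=> gx vS cv; apply: contrapT => nQ.
pose S := supp (psi_seq x).
have cfE u : u \in S0 -> cf (psi_seq x) u = c u x.
  move=> uS; rewrite /cf big_map /= -big_filter filter_pred1_uniq//.
  by rewrite big_seq1.
have SP : strings G R S mk.
  apply: (@anti_strings _ _ _ _ hG Q _ hR x) => //; [exact: psi_seq_lat | by move=> *; apply: hQI].
pose S' := [seq u <- S | ~~ `[< inQ G R (u - vtx mk d) >]].
have SS0 u : u \in S -> u \in S0 by case/mem_supp => p /mapP[w wS ->] ->.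
have : S' = [::].
  apply: (@strings_nil _ _ _ hG _ hR S' mk d mkinv) => //.
  - move=> a u aR; rewrite mem_filter => /andP[nu uS].
    have [p [j [r [pS pjS kj pE /andP[ji ri]]]]] := SP a u aR uS.
    have H l w : l \is a Num.int -> ~~ `[< inQ G R (w - vtx mk d) >] ->
        ~~ `[< inQ G R (w + l *: cr a - vtx mk d) >].
      move=> li; apply: contra => /asboolP h; apply/asboolP.
      have -> : w - vtx mk d = w + l *: cr a - vtx mk d - l *: cr a.
        by rewrite [in RHS]addrAC addrK.
      by apply: (inQB hG hR h); apply: (inQZ hG hR) => //; apply: inQ_coroot.
    have np : ~~ `[< inQ G R (p - vtx mk d) >] by rewrite pE; apply: H.
    exists p, j, r; split => //; last by rewrite ji ri.
      by rewrite mem_filter np pS.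
    by rewrite mem_filter H.
  - by move=> e u re; rewrite mem_filter => /andP[_ /SS0 /(S0_hull re)[]].
  rewrite mem_filter; apply/negP => /andP[/asboolP h _]; apply: h.
  by rewrite subrr; apply: inQ0.
apply/eqP; rewrite -has_filter; apply/hasP; exists v; last by apply/asboolPn.
rewrite mem_filter cfE// cv mem_undup; apply/mapP; exists (c v x, v) => //.
exact: (map_f (fun v => (c v x, v))).
Qed.

Section Eigen.
Variable O : seq V.
Hypothesis uO : uniq O.
Hypothesis O_refl : forall t a, t \in O -> a \in R -> rf a t \in O.
Hypothesis O_int : forall t a, t \in O -> a \in R -> dt t a \is a Num.int.
Hypothesis O_norm : forall t u, t \in O -> u \in O -> dt t t = dt u u.
Hypothesis O_small : forall t a, t \in O -> a \in R -> dt t a <= 1 \/ t = cr a.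
Hypothesis O_type : (forall t a, t \in O -> a \in R -> dt t a <= 1) \/
  (forall t, t \in O -> inQ G R t).
Hypothesis O_neq0 : forall t, t \in O -> t != 0.
Hypothesis O_Q : forall t u, t \in O -> u \in O -> inQ G R (t - u).

Lemma sum_orbit_refl a (F : V -> C) : a \in R ->
  \sum_(t <- O) F t = \sum_(t <- O) F (rf a t).
Proof.
move=> aR; rewrite -(big_map (rf a) xpredT F); apply: perm_big.
have inj := inv_inj (reflectionK aR).
apply: uniq_perm; rewrite ?(map_inj_uniq inj)// => t.
rewrite -[t in RHS](reflectionK aR) (mem_map inj).
apply/idP/idP => [tO|/(O_refl (a := a))/(_ aR)]; first exact: O_refl.
by rewrite reflectionK.
Qed.

(** Reindexing the orbit by the reflection in [a] exchanges the two shifts and, on the wall, does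
    not change the exponentials at [z]. Multiplication by the orbit sum thus preserves
    quasi-invariance. *)
Lemma orbit_sum_wall a i z : a \in R -> wall G Q a z ->
  \sum_(t <- O) E t (z + qv ((i%:R / 2) *: a)) = \sum_(t <- O) E t (z - qv ((i%:R / 2) *: a)).
Proof.
move=> aR az; rewrite [RHS](sum_orbit_refl _ aR) big_seq [RHS]big_seq.
apply: eq_bigr => t tO; rewrite !qexpDr// qexpNr//.
have E1 : E (rf a t) z = E t z.
  rewrite reflectionE qexpDl qexpNl {2}/qexp qvecZ dcZl mulrCA.
  by rewrite qp_intz ?O_int// invr1 mulr1.
rewrite E1; congr (_ * _); rewrite -qexpNl /qexp !dc_real !dotZr dotNl.
by rewrite reflection_dotl// reflection_self// dotNr opprK.
Qed.

Lemma gen_shift x v : gen G Q R x -> (forall a, a \in R -> dt v a \is a Num.int) ->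
  gen G Q R (x + qv v).
Proof.
move=> gx vi a r aR ri; rewrite dcDl dc_real mulrDr qpD.
have vi4 : 4 * dt v a \is a Num.int by rewrite rpredM ?rpred_nat ?vi.
have := gx a (r - 4 * dt v a) aR; rewrite rpredB// => /(_ isT); apply: contra => /eqP E1.
rewrite rmorphB qpB -E1; apply/eqP; apply: (mulIf (qp_neq0 Q (f (4 * dt v a)))).
by rewrite divfK ?qp_neq0// rmorphM rmorph_nat.
Qed.

Lemma sub_refl_dot t a e : dt (t - rf a t) e = dt t a * dt (cr a) e.
Proof. by rewrite reflectionE opprB addrC subrK dotZl. Qed.

(** The difference [s] of both sides is quasi-invariant, with [k] chosen to cancel its coefficient
    at $\rho^\vee$. If it were nonzero, let [v] be a maximizer of its support in direction [d] and
    $y=v-\rho^\vee$. Walks to all generic directions place [y] in the hull of 0 and the orbit. The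
    case $y=0$ is excluded by the choice of [k]. If [y] is in the orbit, a walk in a direction near
    [y] ends at the vertex translated by [y], where the coefficient is zero by [xcoef_vcoef]. *)
Lemma x_operator_eigen x : gen G Q R x -> exists k : C, forall z,
  \sum_(t <- O) xcoef t x * psum (x + qv t) (psi_seq (x + qv t)) z =
  (\sum_(t <- O) E t z + k) * psum x (psi_seq x) z.
Proof.
move=> gx.
have gxt t : t \in O -> gen G Q R (x + qv t).
  by move=> tO; apply: gen_shift => // a aR; apply: O_int.
pose s1 := [seq (xcoef t x * c v (x + qv t), v + t) | t <- O, v <- S0].
pose s2 := [seq (- c v x, v + t) | t <- O, v <- S0].
pose k := cf (s1 ++ s2) (vtx mk d) / c (vtx mk d) x.
pose s3 := [seq (- k * c v x, v) | v <- S0].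
pose s := s1 ++ s2 ++ s3.
have ev1 z : psum x s1 z = \sum_(t <- O) xcoef t x * psum (x + qv t) (psi_seq (x + qv t)) z.
  rewrite /qpsum /qev big_allpairs_dep mulr_sumr; apply: eq_bigr => t _.
  rewrite big_map /= [RHS]mulrA !mulr_sumr; apply: eq_bigr => v _.
  by rewrite qexpDl /qexp dcDl mulrDr qpD; ring.
have ev2 z : psum x s2 z = - ((\sum_(t <- O) E t z) * psum x (psi_seq x) z).
  rewrite /qpsum /qev big_allpairs_dep -mulNr -sumrN mulr_suml [LHS]mulr_sumr.
  apply: eq_bigr => t _; rewrite big_map /= [RHS]mulrCA; congr (_ * _).
  by rewrite mulr_sumr; apply: eq_bigr => v _; rewrite qexpDl; ring.
have ev3 z : psum x s3 z = - k * psum x (psi_seq x) z.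
  rewrite /qpsum /qev !big_map /= [RHS]mulrCA; congr (_ * _); rewrite mulr_sumr.
  by apply: eq_bigr => v _; rewrite mulrA.
have evs z : psum x s z = psum x s1 z + psum x s2 z + psum x s3 z.
  by rewrite /qpsum /qev !big_cat /= !mulrDr addrA.
have tlat t u : t \in O -> u \in S0 -> lat G R (u + t).
  move=> tO uS a aR; apply: rpredM; first exact: rpred_nat.
  by rewrite dotDl rpredD ?(O_int tO aR) ?(S0I uS aR).
have ls p : p \in s -> lat G R p.2.
  rewrite !mem_cat => /or3P[/allpairsP[[t u] [tO uS ->]]|/allpairsP[[t u] [tO uS ->]]|] /=.
  - exact: tlat.
  - exact: tlat.
  by move=> /mapP[u uS ->] a aR; rewrite rpredM ?rpred_nat ?S0I.
have SP : strings G R (supp s) mk.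
  apply: (@anti_strings _ _ _ _ hG Q _ hR x) => // a i z aR iM az.
  rewrite !evs !ev1 !ev2 !ev3 (orbit_sum_wall i aR az) hQI//; congr (_ + _ + _).
  by apply: eq_bigr => t _; rewrite hQI.
have vd0 : c (vtx mk d) x != 0 by rewrite htop vcoef_neq0.
have cfd : cf s (vtx mk d) = 0.
  have -> : cf s (vtx mk d) = cf (s1 ++ s2) (vtx mk d) + cf s3 (vtx mk d).
    by rewrite /s catA /cf big_cat.
  rewrite [X in _ + X]/cf big_map /= -big_filter filter_pred1_uniq ?S0v// big_seq1.
  by rewrite /k mulNr divfK// subrr.
suff s0 : supp s = [::].
  exists k => z; have := evs z; rewrite ev1 ev2 ev3 {1}/qpsum ev_supp_nil// mulr0.
  by move=> /eqP; rewrite eq_sym mulNr -addrA -opprD subr_eq0 -mulrDl => /eqP.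
apply/eqP; apply: contraT => Sn.
have [v vS vmax] := seq_argmax (fun y => dt y d) Sn.
pose y := v - vtx mk d.
have hullS w e : w \in supp s -> regular G R e -> exists2 t, t \in 0 :: O &
    exists2 u, u \in S0 & w = u + t.
  move=> /mem_supp [p + ->] _.
  rewrite !mem_cat => /or3P[/allpairsP[[t u] [tO uS ->]]|/allpairsP[[t u] [tO uS ->]]|] /=.
  - by exists t; [rewrite inE tO orbT | exists u].
  - by exists t; [rewrite inE tO orbT | exists u].
  by move=> /mapP[u uS ->] /=; exists 0; [rewrite mem_head | exists u; rewrite ?addr0].
have yQ : inQ G R y \/ exists2 t, t \in O & inQ G R (y - t).
  have [p [+ p0 vp]] := mem_supp_neq0 vS.
  rewrite !mem_cat => /or3P[/allpairsP[[t u] [tO uS pE]]|/allpairsP[[t u] [tO uS pE]]|];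
    move: p0; rewrite /y vp.
  - rewrite pE /= mulf_eq0 negb_or => /andP[_ cu]; right; exists t => //.
    rewrite addrAC addrK; apply: (psi_coset (gxt t tO)) => //.
  - rewrite pE /= oppr_eq0 => cu; right; exists t => //.
    by rewrite addrAC addrK; apply: (psi_coset gx).
  - move=> p0 /mapP[u uS pE]; left; move: p0; rewrite pE /= mulf_eq0 negb_or => /andP[_ cu].
    exact: (psi_coset gx).
have walk e' : regular G R e' -> generic2 G R d e' ->
    exists2 w, w \in supp s & dt y e' <= dt (w - vtx mk e') e'.
  by move=> re' ge'; apply: (strings_walk hG hR mkinv SP rd re' ge' vS vmax).
have vE : v = y + vtx mk d by rewrite /y subrK.
clearbody y.
(* If [e] separated [y] strictly from 0 and the orbit, so would a nearby generic [e'], and the walk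
   to [e'] would leave the sum of the zonotope and the hull. *)
have yhull e : exists2 t, t \in 0 :: O & dt y e <= dt t e.
  apply: contrapT => H.
  have H' t : t \in 0 :: O -> 0 < dt (y - t) e.
    by move=> tO; rewrite dotBl subr_gt0 ltNge; apply/negP => h; apply: H; exists t.
  have [e' [re' ge' esg]] := generic2_near hG hR [seq y - t | t <- 0 :: O] e rd.
  have [w wS wle] := walk e' re' ge'.
  have [t tO [u uS wE]] := hullS w e' wS re'.
  have : 0 < dt (y - t) e'.
    rewrite -sgr_gt0 esg ?sgr_gt0 ?H' ?gt_eqF ?H'//.
    exact: (map_f (fun t => y - t)).
  have [h _] := S0_hull re' uS.
  by move: wle; rewrite wE [dt (u + t - _) _]dotBl [dt (u + t) _]dotDl [dt (y - t) _]dotBl; lra.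
have [y0|yO] := orbit_hull hG hR O_refl O_int O_norm O_small O_type yQ yhull.
  move: vS; rewrite mem_filter (_ : v = vtx mk d) ?cfd ?eqxx//.
  by rewrite vE y0 add0r.
have N0 : 0 < dt y y by rewrite dot_gt0 ?O_neq0.
(* Orbit elements have equal norms, so among them [y] alone maximizes the pairing with [y]. *)
have yt t : t \in O -> t != y -> 0 < dt (y - t) y.
  move=> tO ty; have : 0 < dt (y - t) (y - t) by rewrite dot_gt0// subr_eq0 eq_sym.
  by rewrite !dotBl !dotBr (O_norm tO yO) (dot_sym y t); lra.
have [e' [re' ge' esg]] := generic2_near hG hR (y :: [seq y - t | t <- O]) y rd.
have ye' : 0 < dt y e' by rewrite -sgr_gt0 esg ?mem_head ?sgr_gt0 ?gt_eqF.
have yte' t : t \in O -> t != y -> 0 < dt (y - t) e'.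
  move=> tO ty; rewrite -sgr_gt0 esg ?sgr_gt0 ?yt ?gt_eqF ?yt//.
  by rewrite inE (map_f (fun t => y - t)) ?orbT.
(* For [e'] near [y], the exponent at the translated vertex arises from one pair only, so its
   coefficient can be computed. *)
have uniq_top t u : t \in 0 :: O -> u \in S0 -> dt (vtx mk e') e' + dt y e' <= dt (u + t) e' ->
    t = y /\ u = vtx mk e'.
  move=> tO uS; rewrite dotDl => le; have [h1 h2] := S0_hull re' uS.
  have ty : t = y.
    apply/eqP; apply: contraT => ty; move: tO; rewrite inE => /orP[/eqP t0|tO].
      by move: le; rewrite t0 dot0l; lra.
    by have := yte' t tO ty; rewrite dotBl; lra.
  by split=> //; apply: h2; apply/eqP; rewrite eq_le h1; move: le; rewrite ty; lra.
have [w wS wle] := walk e' re' ge'.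
have [t tO [u uS wE]] := hullS w e' wS re'.
have [tE uE] : t = y /\ u = vtx mk e'.
  by apply: uniq_top => //; move: wle; rewrite wE [dt (u + t - _) _]dotBl; lra.
move: wS; rewrite mem_filter wE tE uE; case/andP => + _; case/negP; apply/eqP.
have big_pairs (F : V -> V -> C) :
    \sum_(p <- [seq (F t v, v + t) | t <- O, v <- S0] | p.2 == vtx mk e' + y) p.1 =
    F y (vtx mk e').
  rewrite big_mkcond big_allpairs_dep /= (bigD1_seq y)//= (bigD1_seq (vtx mk e')) ?S0v//=.
  rewrite eqxx big1_seq ?addr0; last first.
    move=> u' /andP[u'n _]; rewrite ifF//; apply: contra_neqF u'n => /eqP E1.
    exact: (addIr _ E1).
  rewrite big1_seq ?addr0// => t' /andP[t'n t'O]; rewrite big1_seq// => u' /= u'S.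
  rewrite ifF//; apply: contra_neqF t'n => /eqP E1.
  have [] := uniq_top t' u' _ u'S => //; first by rewrite inE t'O orbT.
  by rewrite E1 dotDl.
rewrite /s /cf !big_cat /= !big_pairs big_map /= big1_seq ?addr0; last first.
  move=> u' /andP[/eqP E1 u'S].
  have [] := uniq_top 0 u' (mem_head _ _) u'S; first by rewrite addr0 E1 dotDl.
  by move=> y0; move: N0; rewrite -y0 dot0l ltxx.
rewrite !vertex_coef//; last exact: gxt.
(* It remains to see that [y] lies in the closed chamber of [e']: otherwise a reflection would
   increase its pairing with [e']. The values 0, 1, 2 come from the (quasi)minuscule condition. *)
rewrite xcoef_vcoef ?subrr// => a aR.
- move=> ay; have ray : rf a y != y.
    rewrite reflectionE -subr_eq0 addrAC subrr add0r oppr_eq0 scaler_eq0 negb_or.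
    rewrite dot_sym gt_eqF//= scaler_eq0 negb_or (gt_eqF (coroot_gt0 aR)).
    exact: root_neq0 hR _ aR.
  have := yte' (rf a y) (O_refl yO aR) ray; rewrite sub_refl_dot (dot_sym y) pmulr_rgt0//.
  by rewrite -sgr_gt0 sgr_coroot// sgr_gt0.
- move=> ae'.
  have ay0 : 0 <= dt a y.
    rewrite leNgt; apply/negP => ay.
    have ray : rf a y != y.
      rewrite reflectionE -subr_eq0 addrAC subrr add0r oppr_eq0 scaler_eq0 negb_or.
      rewrite dot_sym lt_eqF//= scaler_eq0 negb_or (gt_eqF (coroot_gt0 aR)).
      exact: root_neq0 hR _ aR.
    have := yte' (rf a y) (O_refl yO aR) ray; rewrite sub_refl_dot (dot_sym y).
    by rewrite nmulr_rgt0// -sgr_lt0 sgr_coroot// sgr_lt0 ltNge (ltW ae').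
  have ayi : dt a y \is a Num.int by rewrite dot_sym O_int.
  case: (O_small yO aR) => [y1|->]; last by apply: Or33; rewrite dot_coroot2.
  move: ay0; rewrite le_eqVlt => /orP[/eqP <-|ay0]; first exact: Or31.
  by apply: Or32; apply: int_01; rewrite ?ay0 // dot_sym.
Qed.

End Eigen.
End Psi.

(** * The value of psi at rho does not depend on x *)

Section ConstPsi.
Context {K : realType} {C : closedFieldType} {n : nat}.

Local Notation V := 'rV[K]_n.
Local Notation VC := 'rV[C]_n.
Variables (G : 'M[K]_n) (hG : euclidean G) (Q : qchar K C) (R : {fset V}).
Hypothesis hR : reduced_irreducible_root_system G R.
Local Notation dt := (dot G).
Local Notation cr := (coroot G).
Local Notation rf := (reflection G).
Local Notation f := (qemb Q).
Local Notation dc := (qdot G Q).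
Local Notation qv := (qvec Q).
Local Notation E := (qexp G Q).
Local Notation ev := (qev G Q).
Local Notation psum := (qpsum G Q).
Local Notation br := (qbr Q).
Local Notation vtx := (vertex G R).
Local Notation str := (qstr G Q).
Local Notation dot_sym := (dot_sym hG).
Local Notation dotZr := (dotZr hG).
Local Notation dot_sumr := (dot_sumr hG).
Local Notation corootN := (corootN hG).
Local Notation root_gt0 := (root_gt0 hG hR).
Local Notation dot_coroot2' := (dot_coroot2' hG hR).
Local Notation coroot_gt0 := (coroot_gt0 hG hR).
Local Notation reflection_self := (reflection_self hG hR).
Local Notation rootNE := (rootNE hG hR).
Local Notation dot_coroot_int := (dot_coroot_int hG hR).
Local Notation vtx_pos := (vtx_pos hG hR).
Variables (d : V) (Rp : {fset V}).
Hypothesis rd : regular G R d.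
Hypothesis RpE : Rp = [fset a in R | 0 < dt a d]%fset.
Variable m : V -> nat.
Hypothesis hm : forall a b, a \in R -> b \in R -> m (rf a b) = m b.
Local Notation mk := (fun a => (m a)%:R : K).
Variables (S0 : seq V) (c : V -> VC -> C).
Hypothesis uS0 : uniq S0.
Hypothesis S0P : forall v, v \in S0 -> polytope G R m v.
Hypothesis S0I : forall v a, v \in S0 -> a \in R -> dt v a \is a Num.int.
Hypothesis S0v : forall e, regular G R e -> vtx mk e \in S0.
Local Notation psi_seq := (psi_seq S0 c).
Hypothesis hQI : forall x a i z, a \in R -> (1 <= i <= m a)%N -> wall G Q a z ->
  psum x (psi_seq x) (z + qv ((i%:R / 2) *: a)) =
  psum x (psi_seq x) (z - qv ((i%:R / 2) *: a)).

Hypothesis htop : forall x, c (vtx mk d) x = vcoef G Q R m d x.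
Hypothesis Qsurj : forall w : C, w != 0 -> exists t, Q t = w.
(** A direction on which every positive root takes a positive integral value, so that along the line
    [x t] the equations involve only integral powers of $T=q^t$. *)
Let wt : V := \sum_(b <- Rp) cr b.
Variable x0 : VC.
Let x t : VC := x0 + t *: qv wt.
Let rt : V := vtx (kroot G m) d.
Let F t : C := psum (x t) (psi_seq (x t)) (qv rt).
(** Topological input: generic points of the line avoid the zeros of any nonzero polynomial in
    $q^t$, and identities for [F] extend from such points to the whole line. Both are established in
    [psi_const]. *)
Hypothesis Hdense : forall D : {poly C}, D != 0 -> exists2 t, gen G Q R (x t) & D.[Q t] != 0.
Hypothesis Hext : forall A B D : {poly C}, D != 0 ->
  (forall t, gen G Q R (x t) -> D.[Q t] != 0 -> F t * A.[Q t] = B.[Q t]) ->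
  forall t, F t * A.[Q t] = B.[Q t].
Local Notation mkinv := (mkinv hm).
Local Notation Rp_R := (Rp_R RpE).

(** Degree at most [k] with coefficient [b] in degree [k]; [b] may be zero. *)
Definition ptop (P : {poly C}) k b := (size P <= k.+1)%N /\ P`_k = b.

Lemma ptopM P P' k k' b b' : ptop P k b -> ptop P' k' b' -> ptop (P * P') (k + k') (b * b').
Proof.
move=> [s1 e1] [s2 e2]; split.
  by apply: leq_trans (size_polyMleq _ _) _; move: (size P) (size P') s1 s2 => p p'; lia.
rewrite coefM (bigD1 (inord k)) //= inordK ?ltnS ?leq_addr// addKn e1 e2 big1 ?addr0//.
move=> i; rewrite -val_eqE /= inordK ?ltnS ?leq_addr// => ik.
have [lt|ge] := ltnP i k.
  by rewrite [P'`_ _]nth_default ?mulr0//; apply: leq_trans s2 _; lia.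
have lt : (k < i)%N by rewrite ltn_neqAle eq_sym ik.
by rewrite nth_default ?mul0r//; apply: leq_trans s1 _.
Qed.

Lemma ptop_prod_seq (I : eqType) (r : seq I) (P : I -> {poly C}) (k : I -> nat) (b : I -> C) :
  (forall i, i \in r -> ptop (P i) (k i) (b i)) ->
  ptop (\prod_(i <- r) P i) (\sum_(i <- r) k i) (\prod_(i <- r) b i).
Proof.
elim: r => [|i r IH] H.
  by rewrite !big_nil; split; rewrite ?size_poly1 ?coef1.
rewrite !big_cons; apply: ptopM; first exact/H/mem_head.
by apply: IH => j jr; apply: H; rewrite inE jr orbT.
Qed.

(** At a zero $T_0=q^{t_0}$ of [A] the product $F A$ vanishes, so $T_0$ is also a zero of [B] and
    the linear factor cancels, first away from $T_0$ and then everywhere by [Hext]. The condition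
    $A(0)\ne0$ keeps $T_0$ in the range of [Q]. *)
Lemma continuous_quotient A B : A.[0] != 0 -> (forall t, F t * A.[Q t] = B.[Q t]) ->
  exists B', forall t, F t = B'.[Q t].
Proof.
move: {2}(size A) (leqnn (size A)) => N; elim: N A B => [|N IH] A B sA A0 H.
  by move: sA A0; rewrite leqn0 size_poly_eq0 => /eqP ->; rewrite horner0 eqxx.
have [sA1|] := eqVneq (size A) 1.
  have [a a0 AE] := size_poly1P _ (introT eqP sA1).
  exists (a^-1 *: B) => t; have := H t; rewrite AE hornerC hornerZ => <-.
  by rewrite mulrCA mulVf ?mulr1.
move/closed_rootP => [T0 rT0].
have T00 : T0 != 0 by apply: contraTneq rT0 => ->.
have [t0 t0E] := Qsurj T00.
have rB : root B T0 by rewrite /root -t0E -H t0E (eqP rT0) mulr0.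
move: rT0 rB => /factor_theorem[A2 AE] /factor_theorem[B2 BE].
have D0 : 'X - T0%:P != 0 :> {poly C} by rewrite polyXsubC_eq0.
have A20 : A2.[0] != 0.
  by apply: contraNneq A0 => z0; rewrite AE hornerM z0 mul0r.
apply: (IH A2 B2) => //.
  rewrite -ltnS; apply: leq_trans sA; rewrite AE.
  have A2n : A2 != 0 by apply: contraNneq A20 => ->; rewrite horner0.
  by rewrite size_Mmonic ?monicXsubC// size_XsubC addn2.
apply: (Hext D0) => t _; rewrite hornerXsubC => Dt; apply: (mulIf Dt).
by have := H t; rewrite AE BE !hornerM hornerXsubC mulrA.
Qed.

Lemma wt_gt0 a : a \in Rp -> dt a wt \is a Num.int /\ 0 < dt a wt.
Proof.
move=> aRp; have aR := Rp_R aRp; split.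
  rewrite dot_sym; apply: (inQ_int hG hR) => //; apply: inQ_sum => b /Rp_R bR.
  exact: inQ_coroot.
have one_inv : kinv G R (fun=> 1 : K) by [].
have -> : wt = 2 *: vtx (fun=> 1 : K) d.
  rewrite (vtx_Rp hG hR rd RpE)// scalerA mulfV ?pnatr_eq0// scale1r.
  apply: eq_big_seq => b; rewrite (mem_Rp RpE) => /andP[_ bd].
  by rewrite (gtr0_sg bd) mulr1 scale1r.
rewrite dotZr dot_sym mulr_gt0//.
have ad : 0 < dt a d by move: aRp; rewrite (mem_Rp RpE) => /andP[].
have one0 b : b \in R -> 0 <= 1 :> K by rewrite ler01.
by apply: lt_le_trans (vtx_pos one_inv one0 aR ad).
Qed.

Let nn a := Num.truncn (dt a wt).

Lemma nnE a : a \in Rp -> dt a wt = (nn a)%:R /\ (0 < nn a)%N.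
Proof.
move=> /wt_gt0[wi w0].
have E1 : dt a wt = (nn a)%:R by apply/esym/truncnK; rewrite natrEint wi ltW.
by split=> //; rewrite -(ltr0n K) -E1.
Qed.

Lemma dc_xt v t : dc (qv v) (x t) = dc (qv v) x0 + t * f (dt v wt).
Proof. by rewrite /x dcDr// dcZr// dc_real. Qed.

Lemma str_xt a v t : a \in Rp -> str (x t) a v = str x0 a v * Q t ^+ nn a.
Proof.
move=> aRp; have [E1 _] := nnE aRp.
rewrite /qstr ![dc _ (qv a)]dcC// dc_xt E1 rmorph_nat -qpMn -qpD; congr (Q _); ring.
Qed.

(** Multiplied by $T^{i(a,wt)}$, the quasi-invariance equations along the line have coefficients
    polynomial in $T$. The coefficients of psi solve them nontrivially at generic points, so
    [poly_kernel_seq] gives a polynomial solution. *)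
Lemma poly_solution : exists2 u : V -> {poly C}, exists2 v, v \in S0 & u v != 0 &
  forall a i v0, a \in Rp -> (1 <= i <= m a)%N ->
    \sum_(v <- S0 | coset G a v0 v) u v *
      ((str x0 a v ^+ i)%:P * 'X^(2 * i * nn a) - (str x0 a v ^- i)%:P) = 0.
Proof.
pose M0 := (\sum_(a <- Rp) m a)%N.
pose L := [seq (a, iv) | a <- enum_fset Rp, iv <- [seq (i, v) | i <- iota 1 M0, v <- S0]].
pose M (r : V * (nat * V)) v : {poly C} :=
  if (r.2.1 <= m r.1)%N && coset G r.1 r.2.2 v then
   (str x0 r.1 v ^+ r.2.1)%:P * 'X^(2 * r.2.1 * nn r.1) - (str x0 r.1 v ^- r.2.1)%:P
  else 0.
have [|u u0 Hu] := @poly_kernel_seq C _ _ L S0 M uS0.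
  move=> D /Hdense[t gt Dt]; exists (Q t), (fun v => c v (x t)); split=> //.
    by exists (vtx mk d); [apply: S0v | rewrite htop vcoef_neq0].
  move=> r /allpairsP[[a iv] /= [aRp /allpairsP[[i v0] /= [iI v0S ->]] ->]] /=.
  rewrite /M /=; have [im|im] := leqP i (m a); last first.
    by rewrite big1// => v _; rewrite horner0 mul0r.
  have i1 : (1 <= i <= m a)%N by move: iI; rewrite mem_iota im andbT => /andP[].
  have := @anti_coef _ _ _ _ hG Q _ hR (x t) (psi_seq (x t)) a i v0 (Rp_R aRp).
  rewrite big_map /= => H.
  transitivity (Q t ^+ (i * nn a) * \sum_(v <- S0 | coset G a v0 v)
      c v (x t) * (str (x t) a v ^+ i - str (x t) a v ^- i)); last first.
    by rewrite H ?mulr0// => z az; apply: hQI => //; apply: Rp_R.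
  rewrite mulr_sumr [RHS]big_mkcond; apply: eq_bigr => v _.
  case: ifP => cv; last by rewrite horner0 mul0r.
  rewrite !hornerE str_xt// !exprMn -!exprM.
  have T0 := qp_neq0 Q t; have s0 := str_neq0 G Q x0 a v.
  have -> : (2 * i * nn a = nn a * i + nn a * i)%N by rewrite addnn -mul2n [(nn a * i)%N]mulnC mulnA.
  rewrite [(i * _)%N]mulnC exprD.
  move: (expf_neq0 (nn a * i) T0) (expf_neq0 i s0).
  move: (Q t ^+ _) (str x0 a v ^+ i) => P S P0 S1. rewrite /=; field.
  by rewrite P0 S1.
exists u => // a i v0 aRp i1.
have [/hasP[v1 v1S cv1]|/hasPn H] := boolP (has (fun v => coset G a v0 v) S0); last first.
  by rewrite big1_seq// => v /andP[cv vS]; have := H v vS; rewrite cv.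
have := Hu (a, (i, v1)); rewrite /M /=; case/andP: i1 => i0 im; rewrite im /= => H.
rewrite (eq_bigl (fun v => coset G a v1 v)); last by move=> v; apply: coset_eq.
rewrite big_mkcond -[RHS]H.
  by apply: eq_bigr => v _; case: ifP; rewrite ?mul0r// mulrC.
apply/allpairsP; exists (a, (i, v1)); split=> //=; apply/allpairsP; exists (i, v1).
split=> //; rewrite mem_iota i0 add1n ltnS /M0 (big_rem a)//=.
exact: leq_trans (leq_addr _ _).
Qed.

(** As $T$ tends to infinity ([b] false) or to zero ([b] true) the equations retain only the powers
    of one sign. These are still moments at distinct nodes, so uniqueness holds in the limit. *)
Lemma limit_strings (b : bool) s :
  (forall a i v0, a \in Rp -> (1 <= i <= m a)%N ->
    \sum_(p <- s | coset G a v0 p.2) p.1 * str 0 (if b then - a else a) p.2 ^+ i = 0) ->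
  strings G R (supp s) mk.
Proof.
move=> H; pose w a := if (a \in Rp) (+) b then a else - a.
have wR a : a \in R -> w a \in R by rewrite /w; case: ifP; rewrite ?rootNE.
apply: (@moments_strings _ _ _ _ hG _ hR s m (fun a v => str 0 (w a) v)
  (fun a v => str 0 (w a) v)) => [a v r aR _ rm|a v aR|a v u aR vS uS [j ji ->]].
- rewrite /w; have [aRp|aNRp] := boolP (a \in Rp).
    rewrite -[RHS](H a r.+1 v aRp)//; apply: eq_bigr => p _.
    by rewrite exprS; case: (b).
  have Na : - a \in Rp by case: (Rp_or hG hR rd RpE aR) => //; rewrite (negPf aNRp).
  have mN : m (- a) = m a by rewrite -(reflection_self aR) hm.
  rewrite -[RHS](H (- a) r.+1 v Na) ?mN//; apply: eq_big => p.
    by rewrite (cosetN hG v p.2 aR).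
  by move=> _; rewrite opprK exprS; case: (b).
- by move=> _; apply: str_neq0.
apply: (str_coset hG hR (wR _ aR)); rewrite /w; case: ifP => _; first by exists j.
by exists (- j); rewrite ?rpredN// corootN scalerN scaleNr opprK.
Qed.

Lemma limit_zero b s :
  (forall a i v0, a \in Rp -> (1 <= i <= m a)%N ->
    \sum_(p <- s | coset G a v0 p.2) p.1 * str 0 (if b then - a else a) p.2 ^+ i = 0) ->
  (forall e p, regular G R e -> p \in s -> dt p.2 e <= dt (vtx mk e) e) ->
  cf s (vtx mk d) = 0 -> supp s = [::].
Proof.
move=> H hull top; apply: (strings_nil hG hR mkinv (limit_strings H) rd).
  by move=> e y re /mem_supp[p ps ->]; apply: hull.
by rewrite mem_filter top eqxx.
Qed.

Lemma cf_graph (h : V -> C) v : v \in S0 -> cf [seq (h v, v) | v <- S0] v = h v.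
Proof.
move=> vS; rewrite /cf big_map /= -big_filter filter_pred1_uniq// big_seq1.
by [].
Qed.

Lemma graph_hull (h : V -> C) e p : regular G R e -> p \in [seq (h v, v) | v <- S0] ->
  dt p.2 e <= dt (vtx mk e) e.
Proof. by move=> re /mapP[v vS ->] /=; case: (S0_hull hG hR S0P re vS). Qed.

Lemma graph_limit_neq0 b h : (exists2 v, v \in S0 & h v != 0) ->
  (forall a i v0, a \in Rp -> (1 <= i <= m a)%N ->
    \sum_(v <- S0 | coset G a v0 v) h v * str 0 (if b then - a else a) v ^+ i = 0) ->
  h (vtx mk d) != 0.
Proof.
move=> [v vS hv] H; apply: contraNneq hv => top; rewrite -(cf_graph h vS).
rewrite supp_nil//; apply: (@limit_zero b) => [a i v0 aRp im|e p|].
- by rewrite big_map; apply: H.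
- exact: graph_hull.
- by rewrite cf_graph// S0v.
Qed.

Lemma str_str0 y a v : str y a v = Q (dc y (qv a)) * str 0 a v.
Proof. by rewrite /qstr dc0l add0r qpD. Qed.

(** A solution of the limit equations at infinity: for positive [a] it vanishes at $z+\frac i2a$
    whenever [z] is on the wall of [a] and $1\le i\le m_a$. *)
Let gp z := \prod_(a <- Rp) \prod_(1 <= j < (m a).+1) br (dc (qv (cr a)) z - j%:R).

Lemma gp_esum : expsum G Q R d (vtx mk) gp (\prod_(a <- Rp) \prod_(1 <= j < (m a).+1) Q (- j%:R)).
Proof.
have H : expsum G Q R d
    (fun e => \sum_(a <- Rp) \sum_(j <- index_iota 1 (m a).+1) half_vtx G a e) gp
    (\prod_(a <- Rp) \prod_(1 <= j < (m a).+1) Q (- j%:R)).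
  apply: (expsum_prod rd) => a aRp; apply: (expsum_prod rd) => j _.
  have := expsum_br hG Q hR rd (- j%:R) (Rp_R aRp).
  by move: aRp; rewrite (mem_Rp RpE) => /andP[_ ->].
apply: (expsum_eq rd H) => // e re; rewrite (vtx_Rp hG hR rd RpE _ mkinv) scaler_sumr.
apply: eq_bigr => a _; rewrite sumr_const_nat subSS subn0 /half_vtx -scaler_nat.
by move: (cr a) => w; rewrite !scalerA; congr (_ *: _); ring.
Qed.

Lemma gp_wall a i z : a \in Rp -> (1 <= i <= m a)%N -> wall G Q a z ->
  gp (z + qv ((i%:R / 2) *: a)) = 0.
Proof.
move=> aRp /andP[i1 im] az; apply/eqP; rewrite /gp prodf_seq_eq0; apply/hasP; exists a => //=.
rewrite prodf_seq_eq0; apply/hasP; exists i; rewrite ?mem_index_iota ?i1 ?ltnS//=.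
have -> : dc (qv (cr a)) (z + qv ((i%:R / 2) *: a)) - i%:R = dc (qv (cr a)) z.
  rewrite dcDr// dc_real dotZr (dot_coroot2' (Rp_R aRp)) divfK ?pnatr_eq0//.
  by rewrite rmorph_nat addrK.
by rewrite br_eq0; move: az; rewrite /wall /qexp => ->.
Qed.

(** Suitably scaled, the two sides solve the same limit equations and agree at $\rho^\vee$, so
    [limit_zero] makes them equal. *)
Lemma graph_limit_gp h :
  (forall a i v0, a \in Rp -> (1 <= i <= m a)%N ->
    \sum_(v <- S0 | coset G a v0 v) h v * str 0 a v ^+ i = 0) -> forall z,
  (\sum_(v <- S0) h v * E v z) * \prod_(a <- Rp) \prod_(1 <= j < (m a).+1) Q (- j%:R) =
  h (vtx mk d) * gp z.
Proof.
move=> H z; set kg := \prod_(a <- Rp) _.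
have [s [sE sl sh stop]] := gp_esum.
pose t := [seq (h v * kg, v) | v <- S0] ++ [seq (p.1 * - h (vtx mk d), p.2) | p <- s].
have t0 : supp t = [::].
  apply: (@limit_zero false) => [a i v0 aRp im|e p re|].
  - rewrite big_cat !big_map /=.
    have -> : \sum_(v <- S0 | coset G a v0 v) h v * kg * str 0 a v ^+ i = 0.
      transitivity (kg * \sum_(v <- S0 | coset G a v0 v) h v * str 0 a v ^+ i).
        by rewrite mulr_sumr; apply: eq_bigr => v _; ring.
      by rewrite H ?mulr0.
    rewrite add0r; transitivity (- h (vtx mk d) *
        \sum_(p <- s | coset G a v0 p.2) p.1 * str 0 a p.2 ^+ i).
      by rewrite mulr_sumr; apply: eq_bigr => p _; ring.
    rewrite (@wall_sum0 _ _ _ _ hG Q _ hR s (fun v => str 0 a v ^+ i) _ _ (Rp_R aRp)) ?mulr0// => y ay.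
    have := gp_wall aRp im ay; rewrite sE => E1; rewrite -[RHS]E1.
    have := psum_shift hG Q 0 s y a i; rewrite /qpsum !dc0l mulr0 qp0 !mul1r => ->.
    by [].
  - rewrite mem_cat => /orP[/mapP[v vS ->]|/mapP[p' /(sh e _ re)[? _] ->]] //=.
    by case: (S0_hull hG hR S0P re vS).
  - rewrite cf_cat (cf_graph (fun v => h v * kg)) ?S0v//.
    have -> : cf [seq (p.1 * - h (vtx mk d), p.2) | p <- s] (vtx mk d) = kg * - h (vtx mk d).
      by rewrite /kg -stop /cf big_map /= mulr_suml.
    by rewrite mulrN [h _ * _]mulrC subrr.
have := ev_supp_nil G Q z t0; rewrite ev_cat /qev !big_map /= => E1.
apply/eqP; rewrite -subr_eq0 -[X in _ == X]E1 sE mulr_suml /qev mulr_sumr -sumrN.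
by apply/eqP; congr (_ + _); apply: eq_bigr => p _; ring.
Qed.

(** Each bracket has argument $-((a^\vee,\rho)+j)$; twice its absolute value is a positive integer,
    and $q$ is not a root of unity. *)
Lemma gp_neq0 : gp (- qv rt) != 0.
Proof.
rewrite /gp prodf_seq_neq0; apply/allP => a aRp /=.
rewrite prodf_seq_neq0; apply/allP => j /=; rewrite mem_index_iota => /andP[j0 _].
have aR := Rp_R aRp; rewrite dcNr// dc_real -opprD brN oppr_eq0 br_eq0.
have kr0 b : b \in R -> 0 <= kroot G m b.
  by move=> bR; rewrite /kroot mulr_ge0// mulr_ge0 ?ler0n// ltW// root_gt0.
have ad : 0 < dt a d by move: aRp; rewrite (mem_Rp RpE) => /andP[].
have pos : 0 <= dt (cr a) rt.
  rewrite dot_corootl mulr_ge0 ?(ltW (coroot_gt0 aR))// dot_sym.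
  exact: le_trans (kr0 a aR) (vtx_pos (kroot_inv hG hR hm) kr0 aR ad).
have -> : 2 * (f (dt (cr a) rt) + j%:R) = f (2 * (dt (cr a) rt + j%:R)).
  by rewrite [f (2 * _)]rmorphM [f (dt _ _ + _)]rmorphD !rmorph_nat.
apply: qp_int.
  rewrite mulrDr; apply: rpredD; last by apply: rpredM; apply: rpred_nat.
  rewrite /rt (vtx_Rp hG hR rd RpE _ (kroot_inv hG hR hm)) dotZr mulrA divff ?pnatr_eq0// mul1r.
  rewrite dot_sumr big_seq rpred_sum// => b bRp; have bR := Rp_R bRp.
  rewrite -scalerA (kroot_coroot hG hR m bR) !dotZr; apply: rpredM.
    by case: (sgr_pm (rd bR)) => ->; rewrite ?rpredN rpred1.
  by apply: rpredM; [apply: rpred_nat|apply: dot_coroot_int].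
by apply: lt0r_neq0; rewrite mulr_gt0// ltr_wpDl// ltr0n.
Qed.

(** The constant value of $\psi(x,\rho)$, as it comes out of the leading coefficients for $T$
    tending to infinity. *)
Let kappa := (\prod_(a <- Rp) \prod_(1 <= j < (m a).+1) (- Q (- j%:R))) * gp (- qv rt) /
  \prod_(a <- Rp) \prod_(1 <= j < (m a).+1) Q (- j%:R).

Lemma kappa_neq0 : kappa != 0.
Proof.
have H (b : bool) : \prod_(a <- Rp) \prod_(1 <= j < (m a).+1) ((-1) ^+ b * Q (- j%:R)) != 0.
  rewrite prodf_seq_neq0; apply/allP => a _ /=; rewrite prodf_seq_neq0.
  by apply/allP => j _ /=; rewrite mulf_neq0 ?qp_neq0 ?signr_eq0.
rewrite /kappa mulf_neq0 ?invr_eq0 ?mulf_neq0 ?gp_neq0//.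
  have := H true; under eq_bigr do under eq_bigr do rewrite expr1 mulN1r; exact.
have := H false; under eq_bigr do under eq_bigr do rewrite expr0 mul1r; exact.
Qed.

Let X a := dc (qv a) x0.
Let fac a j : {poly C} := (Q (j%:R - X a))%:P - (Q (X a - j%:R))%:P * 'X^(2 * nn a).
Let p : {poly C} := \prod_(a <- Rp) \prod_(1 <= j < (m a).+1) fac a j.
Let N := (\sum_(a <- Rp) m a * nn a)%N.

Lemma vcoef_xt t : vcoef G Q R m d (x t) * Q t ^+ N = p.[Q t].
Proof.
have -> : Q t ^+ N = \prod_(a <- Rp) \prod_(1 <= j < (m a).+1) Q t ^+ nn a.
  by rewrite /N -prodrXr; apply: eq_bigr => a _; rewrite prodr_const_nat subSS subn0 -exprM mulnC.
have -> : vcoef G Q R m d (x t) =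
    \prod_(a <- Rp) \prod_(1 <= j < (m a).+1) br (j%:R - dc (qv a) (x t)).
  rewrite /vcoef RpE -big_filter; apply: perm_big; apply: uniq_perm; rewrite ?filter_uniq ?fset_uniq//.
  by move=> a; rewrite mem_filter !inE andbC.
rewrite -big_split /p horner_prod; apply: eq_big_seq => a aRp /=.
rewrite -big_split horner_prod; apply: eq_bigr => j _ /=.
have [E1 _] := nnE aRp; rewrite dc_xt E1 rmorph_nat /fac !hornerE -/(X a) /qbr.
have -> : j%:R - (X a + t * (nn a)%:R) = (j%:R - X a) + - ((nn a)%:R * t) by ring.
rewrite -[X a - j%:R]opprB opprD opprK mul2n -addnn exprD.
move: (j%:R - X a) => y; rewrite !qpD !qpN qpMn.
move: (qp_neq0 Q y) (expf_neq0 (nn a) (qp_neq0 Q t)).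
by move: (Q y) (Q t ^+ _) => A P A0 P0; rewrite /=; field; rewrite A0 P0.
Qed.

Lemma rt_wt t : Q (2 * dc (x t) (qv rt)) = (\prod_(a <- Rp) Q (X a) ^+ m a) * Q t ^+ N.
Proof.
have rtE : 2 *: rt = \sum_(a <- Rp) (m a)%:R *: a.
  rewrite /rt (vtx_Rp hG hR rd RpE _ (kroot_inv hG hR hm)) scalerA divff ?pnatr_eq0// scale1r.
  apply: eq_big_seq => a aRp; have aR := Rp_R aRp.
  have ad : 0 < dt a d by move: aRp; rewrite (mem_Rp RpE) => /andP[].
  by rewrite (gtr0_sg ad) mul1r (kroot_coroot hG hR m aR).
have -> : 2 * dc (x t) (qv rt) = dc (qv (2 *: rt)) (x t).
  by rewrite qvecZ dcZl rmorph_nat [dc (x t) _]dcC.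
rewrite rtE qvec_sum dc_suml qp_sum /N -prodrXr -big_split /=.
apply: eq_big_seq => a aRp; rewrite qvecZ dcZl rmorph_nat qpMn dc_xt.
have [-> _] := nnE aRp; rewrite rmorph_nat qpD exprMn [t * _]mulrC qpMn -exprM.
by rewrite [(nn a * _)%N]mulnC.
Qed.

(** Let [u] be the polynomial solution and [W y] its exponential sum at [y]. Proportionality of [c]
    and [u] gives $F u_r=q_0\,p\,W(\rho)$, and $\psi(x,\rho)=\psi(x,-\rho)$ gives $F
    T^{2N}u_r=q_0^{-1}p\,W(-\rho)$. Cancelling the common power of $T$ in the first makes $F$ a
    polynomial in $T$; comparing degrees in the second makes it constant; leading coefficients
    identify it with [kappa]. *)
Lemma F_const t : F t = kappa.
Proof.
have [u u0 Hu] := poly_solution.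
have [D [V0 [topD hiD topV loV]]] := poly_support u0.
pose r := vtx mk d; have rS : r \in S0 by apply: S0v.
have unshift (b : bool) h a i v0 :
    \sum_(v <- S0 | coset G a v0 v) h v * str x0 (if b then - a else a) v ^+ i =
    Q (dc x0 (qv (if b then - a else a))) ^+ i *
      \sum_(v <- S0 | coset G a v0 v) h v * str 0 (if b then - a else a) v ^+ i.
  by rewrite mulr_sumr; apply: eq_bigr => v _; rewrite str_str0 exprMn; ring.
have nn0 a i : a \in Rp -> (0 < i)%N -> (0 < 2 * i * nn a)%N.
  by move=> /nnE[_ n0] i0; rewrite !muln_gt0 i0 n0.
(* Leading coefficients of the polynomial equations: in this degree only the terms carrying the
   higher power of $T$ contribute. *)
have hi_eq a i v0 : a \in Rp -> (1 <= i <= m a)%N ->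
    \sum_(v <- S0 | coset G a v0 v) (u v)`_D * str 0 a v ^+ i = 0.
  move=> aRp im; have i0 : (0 < i)%N by case/andP: im.
  apply: (mulfI (expf_neq0 i (qp_neq0 Q (dc x0 (qv a))))).
  rewrite mulr0 -(unshift false).
  have := congr1 (fun P : {poly C} => P`_(D + 2 * i * nn a)) (Hu a i v0 aRp im).
  rewrite coef0 coef_sum => E1; rewrite -[RHS]E1 big_seq_cond [RHS]big_seq_cond.
  apply: eq_bigr => v /andP[vS _].
  rewrite mulrBr mulrA coefB coefMXn ltnNge leq_addl /= addnK !coefMC.
  by rewrite [(u v)`_(_ + _)](hiD v)// ?mul0r ?subr0// -[X in (X < _)%N]addn0 ltn_add2l nn0.
(* Lowest coefficients: only the terms free of the extra power of $T$ contribute. *)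
have lo_eq a i v0 : a \in Rp -> (1 <= i <= m a)%N ->
    \sum_(v <- S0 | coset G a v0 v) (u v)`_V0 * str 0 (- a) v ^+ i = 0.
  move=> aRp im; have i0 : (0 < i)%N by case/andP: im.
  apply: (mulfI (expf_neq0 i (qp_neq0 Q (dc x0 (qv (- a)))))).
  rewrite mulr0 -(unshift true) /=; apply: oppr_inj; rewrite oppr0.
  have := congr1 (fun P : {poly C} => P`_V0) (Hu a i v0 aRp im).
  rewrite coef0 coef_sum => E1; rewrite -[RHS]E1 -sumrN big_seq_cond [RHS]big_seq_cond.
  apply: eq_bigr => v /andP[vS _].
  rewrite mulrBr mulrA coefB coefMXn !coefMC strN// exprVn.
  case: ltnP => [_|le]; first by rewrite sub0r.
  have k0 := nn0 a i aRp i0; rewrite [(u v)`_(V0 - _)]loV ?mul0r ?sub0r//.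
  by rewrite ltn_subrL k0 (leq_trans k0).
have hi0 : (u r)`_D != 0 by apply: (@graph_limit_neq0 false (fun v => (u v)`_D)).
have lo0 : (u r)`_V0 != 0 by apply: (@graph_limit_neq0 true (fun v => (u v)`_V0)).
pose W (y : V) : {poly C} := \sum_(v <- S0) (E v (qv y))%:P * u v.
pose q0 := \prod_(a <- Rp) Q (X a) ^+ m a.
have q00 : q0 != 0.
  by rewrite prodf_seq_neq0; apply/allP => a _ /=; rewrite expf_neq0 ?qp_neq0.
(* At a generic point both vectors solve the quasi-invariance equations, and the combination
   vanishing at $\rho^\vee$ is zero by uniqueness. *)
have prop t' v : gen G Q R (x t') -> v \in S0 ->
    c v (x t') * (u r).[Q t'] = c r (x t') * (u v).[Q t'].
  move=> gt vS; apply/eqP; rewrite -subr_eq0; apply/eqP.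
  pose h w := c w (x t') * (u r).[Q t'] - c r (x t') * (u w).[Q t'].
  rewrite -/(h v) -(cf_graph h vS); apply: supp_nil.
  have sl q : q \in [seq (h w, w) | w <- S0] -> lat G R q.2.
    by move=> /mapP[w wS ->] a aR /=; rewrite rpredM ?rpred_nat ?S0I.
  have SP : strings G R (supp [seq (h w, w) | w <- S0]) mk.
    apply: (anti_coef_strings hG hR gt sl) => a i v0 aR _ im.
    have key a' : a' \in Rp -> (1 <= i <= m a')%N ->
        \sum_(w <- S0 | coset G a' v0 w) h w * (str (x t') a' w ^+ i - str (x t') a' w ^- i) = 0.
      move=> aRp im'; have a'R := Rp_R aRp; have Tn := expf_neq0 (i * nn a') (qp_neq0 Q t').
      have e1 : \sum_(w <- S0 | coset G a' v0 w)
          c w (x t') * (str (x t') a' w ^+ i - str (x t') a' w ^- i) = 0.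
        have := @anti_coef _ _ _ _ hG Q _ hR (x t') (psi_seq (x t')) a' i v0 a'R.
        by rewrite big_map /=; apply => z az; apply: hQI.
      have e2 : \sum_(w <- S0 | coset G a' v0 w)
          (u w).[Q t'] * (str (x t') a' w ^+ i - str (x t') a' w ^- i) = 0.
        apply: (mulfI Tn); rewrite mulr0.
        have := congr1 (fun P : {poly C} => P.[Q t']) (Hu a' i v0 aRp im').
        rewrite horner0 horner_sum => E1; rewrite -[RHS]E1 mulr_sumr; apply: eq_bigr => w _.
        rewrite !hornerE str_xt// exprMn -exprM.
        have s0 := expf_neq0 i (str_neq0 G Q x0 a' w).
        have -> : (2 * i * nn a' = i * nn a' + i * nn a')%N by rewrite -mulnA mul2n addnn.
        rewrite [(nn a' * _)%N]mulnC exprD.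
        move: Tn s0; move: (Q t' ^+ _) (str x0 a' w ^+ i) => P S P0 S1.
        by rewrite /=; field; rewrite P0 S1.
      transitivity ((u r).[Q t'] * (\sum_(w <- S0 | coset G a' v0 w)
          c w (x t') * (str (x t') a' w ^+ i - str (x t') a' w ^- i)) -
        c r (x t') * (\sum_(w <- S0 | coset G a' v0 w)
          (u w).[Q t'] * (str (x t') a' w ^+ i - str (x t') a' w ^- i))).
        by rewrite !mulr_sumr -sumrB; apply: eq_bigr => w _; rewrite /h; ring.
      by rewrite e1 e2 !mulr0 subr0.
    rewrite big_map /=; have [aRp|] := boolP (a \in Rp); first exact: key.
    move=> aNRp; have Na : - a \in Rp by case: (Rp_or hG hR rd RpE aR) => //; rewrite (negPf aNRp).
    have mN : m (- a) = m a by rewrite -(reflection_self aR) hm.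
    apply: oppr_inj; rewrite oppr0 -[RHS](key (- a) Na) ?mN// -sumrN; apply: eq_big => w.
      by rewrite (cosetN hG v0 w aR).
    by move=> _; rewrite strN// exprVn invrK; ring.
  apply: (strings_nil hG hR mkinv SP rd).
    by move=> e y re /mem_supp[q qs ->]; apply: graph_hull qs.
  by rewrite mem_filter cf_graph// /h mulrC subrr eqxx.
have eqW t' y : gen G Q R (x t') -> (\sum_(v <- S0) c v (x t') * E v (qv y)) * (u r).[Q t'] * Q t' ^+ N =
    p.[Q t'] * (W y).[Q t'].
  move=> gt; rewrite -vcoef_xt -htop mulr_suml [RHS]mulrAC; congr (_ * _).
  rewrite /W horner_sum mulr_sumr big_seq [RHS]big_seq; apply: eq_bigr => v vS.
  by rewrite hornerM hornerC mulrAC prop//; ring.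
have evpsi t' z : ev (psi_seq (x t')) z = \sum_(v <- S0) c v (x t') * E v z.
  by rewrite /qev big_map.
have eq1 t' : F t' * (u r).[Q t'] = (q0 *: (p * W rt)).[Q t'].
  apply: (Hext (oner_neq0 _)) => {}t' gt _.
  rewrite /F /qpsum rt_wt evpsi hornerZ hornerM -eqW// -/q0.
  by rewrite -!mulrA; congr (_ * _); rewrite mulrC -mulrA.
have eq2 t' : F t' * ('X^(2 * N) * u r).[Q t'] = (q0^-1 *: (p * W (- rt))).[Q t'].
  apply: (Hext (oner_neq0 _)) => {}t' gt _.
  rewrite hornerM hornerXn /F (psi_opp_rho hG hR rd hm hQI) /qpsum dcNr// mulrN qpN rt_wt evpsi.
  rewrite hornerZ hornerM -eqW// -/q0 -qvecN mul2n -addnn exprD invfM.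
  have := expf_neq0 N (qp_neq0 Q t'); move: (Q t' ^+ N) => P P0.
  by rewrite /=; field; rewrite q00 P0.
have ch k : k.+1%:R != 0 :> C := nat_neq0 Q k.
(* Every [u v] is divisible by $T^{V_0}$; after division the denominator is nonzero at $T=0$, as
   [continuous_quotient] requires. *)
have dropE v : v \in S0 -> u v = drop_poly V0 (u v) * 'X^V0.
  move=> vS; rewrite -[u v in LHS](poly_take_drop V0) -[RHS]add0r; congr (_ + _).
  by apply/polyP => k; rewrite coef_take_poly coef0; case: ifP => // kV; rewrite loV.
have [B HB] : exists B : {poly C}, forall t', F t' = B.[Q t'].
  apply: (@continuous_quotient (drop_poly V0 (u r))
     (q0 *: (p * \sum_(v <- S0) (E v (qv rt))%:P * drop_poly V0 (u v)))) => [|t'].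
    by rewrite horner_coef0 coef_drop_poly add0n.
  apply: (mulIf (expf_neq0 V0 (qp_neq0 Q t'))); have := eq1 t'.
  rewrite [in LHS](dropE r rS) hornerM hornerXn mulrA => ->.
  rewrite !hornerZ !hornerM -!mulrA; congr (_ * (_ * _)); rewrite /W !horner_sum mulr_suml.
  rewrite big_seq [RHS]big_seq; apply: eq_bigr => v vS; rewrite [in LHS](dropE v vS).
  by rewrite !hornerM hornerXn !hornerC mulrA.
have eqB : B * ('X^(2 * N) * u r) = q0^-1 *: (p * W (- rt)).
  apply/eqP; rewrite -subr_eq0; apply/eqP; apply: poly_eq_char0 => // w /Qsurj[t' <-].
  by rewrite hornerD hornerN -eq2 HB hornerM subrr.
have sizeu v : v \in S0 -> (size (u v) <= D.+1)%N.
  by move=> vS; apply/leq_sizeP => k; apply: hiD.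
have pW : ptop (W (- rt)) D (\sum_(v <- S0) (u v)`_D * E v (- qv rt)).
  split.
    apply: leq_trans (size_sum _ _ _) _; apply/bigmax_leqP_seq => v vS _.
    by rewrite mul_polyC (leq_trans (size_scale_leq _ _))// sizeu.
  by rewrite coef_sum; apply: eq_bigr => v _; rewrite coefCM qvecN mulrC.
have pp : ptop p (2 * N) (\prod_(a <- Rp) \prod_(1 <= j < (m a).+1) (- Q (X a - j%:R))).
  have -> : (2 * N = \sum_(a <- Rp) \sum_(1 <= j < (m a).+1) 2 * nn a)%N.
    rewrite /N big_distrr /=; apply: eq_bigr => a _; rewrite sum_nat_const_nat subSS subn0; lia.
  rewrite /p; apply: ptop_prod_seq => a aRp; apply: ptop_prod_seq => j _.
  have n0 : (0 < 2 * nn a)%N by rewrite muln_gt0; case: (nnE aRp).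
  split; last by rewrite /fac coefB coefC coefCM coefXn eqxx mulr1 gtn_eqF// sub0r.
  apply: leq_trans (size_polyD _ _) _; rewrite geq_max; apply/andP; split.
    by apply: leq_trans (size_polyC_leq1 _) _.
  by rewrite size_polyN mul_polyC (leq_trans (size_scale_leq _ _))// size_polyXn.
have [sP cP] := ptopM pp pW.
have u_neq0 : u r != 0 by apply: contraNneq hi0 => ->; rewrite coef0.
have su : size (u r) = D.+1.
  by apply/eqP; rewrite eqn_leq sizeu//= ltnNge; apply: contra hi0 => /leq_sizeP ->.
(* [u r] has degree exactly [D], whereas the right-hand side of [eqB] has degree at most $2N+D$. *)
have sB : (size B <= 1)%N.
  have [->|B0] := eqVneq B 0; first by rewrite size_poly0.
  have Xu0 : 'X^(2 * N) * u r != 0 by rewrite mulf_neq0 ?(monic_neq0 (monicXn _ _)).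
  have : (size (B * ('X^(2 * N) * u r))%R <= (2 * N + D).+1)%N.
    by rewrite eqB (leq_trans (size_scale_leq _ _)).
  by rewrite size_mul// ['X^_ * _]mulrC size_mulXn// su; move: (size B) => k; lia.
have BE := size1_polyC sB; rewrite HB BE hornerC.
have := congr1 (fun P : {poly C} => P`_(2 * N + D)) eqB.
rewrite coefZ cP BE coefCM coefXnM ltnNge leq_addr /= addKn.
have -> : \prod_(a <- Rp) \prod_(1 <= j < (m a).+1) (- Q (X a - j%:R)) =
    q0 * \prod_(a <- Rp) \prod_(1 <= j < (m a).+1) (- Q (- j%:R)).
  rewrite /q0 -big_split /=; apply: eq_bigr => a _.
  have -> : Q (X a) ^+ m a = \prod_(1 <= j < (m a).+1) Q (X a).
    by rewrite prodr_const_nat subSS subn0.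
  by rewrite -big_split /=; apply: eq_bigr => j _; rewrite qpD mulrN.
move=> E1; apply: (mulIf hi0); rewrite coefC eqxx E1 /kappa -[q0 * _ * _]mulrA mulKf//.
have := graph_limit_gp hi_eq (- qv rt).
have kg0 : \prod_(a <- Rp) \prod_(1 <= j < (m a).+1) Q (- j%:R) != 0.
  rewrite prodf_seq_neq0; apply/allP => a _ /=; rewrite prodf_seq_neq0.
  by apply/allP => j _ /=; rewrite qp_neq0.
move: kg0; move: (\prod_(a <- Rp) \prod_(1 <= j < (m a).+1) Q (- j%:R)) => kg kg0 E2.
apply: (mulIf kg0); rewrite -[LHS]mulrA E2 -/r; field.
by [].
Qed.
End ConstPsi.

(** * Determination of the constant, and a continuation principle *)

Section XOperator.
Context {K : realType} {C : fieldType} {n : nat}.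
Local Notation V := 'rV[K]_n.
Local Notation VC := 'rV[C]_n.
Variables (G : 'M[K]_n) (Q : qchar K C) (R : {fset V}).
Local Notation psum := (qpsum G Q).
Local Notation qv := (qvec Q).
Local Notation E := (qexp G Q).

(** At [r] all values of psi equal the nonzero [kappa] and cancel, which expresses [k] through the
    coefficients $a_t$ and the orbit sum at [r]. *)
Lemma x_operator_normalized (m : V -> nat) (O : seq V) (S : VC -> seq (C * V)) (x r : VC) kappa :
  kappa != 0 -> (forall y, psum y (S y) r = kappa) ->
  (exists k, forall z, \sum_(t <- O) xcoef G Q R m t x * psum (x + qv t) (S (x + qv t)) z =
     (\sum_(t <- O) E t z + k) * psum x (S x) z) ->
  forall z, \sum_(t <- O) xcoef G Q R m t x *
      (psum (x + qv t) (S (x + qv t)) z - psum x (S x) z) +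
    (\sum_(t <- O) E t r) * psum x (S x) z = (\sum_(t <- O) E t z) * psum x (S x) z.
Proof.
move=> k0 Hk [k H] z.
have kE : k = \sum_(t <- O) xcoef G Q R m t x - \sum_(t <- O) E t r.
  have := H r; rewrite Hk; under eq_bigr do rewrite Hk.
  by rewrite -mulr_suml => /(mulIf k0) ->; rewrite addrAC subrr add0r.
under eq_bigr do rewrite mulrBr.
by rewrite sumrB H -mulr_suml kE; ring.
Qed.
End XOperator.

(** The polynomial with the bases as roots annihilates the sum and has nonzero constant term. All
    its other terms vanish by hypothesis, so the case $N=0$ follows from the positive $N$. *)
Lemma geometric_eq0 (C : fieldType) (s : seq (C * C)) : (forall p, p \in s -> p.2 != 0) ->
  (forall N, (0 < N)%N -> \sum_(p <- s) p.1 * p.2 ^+ N = 0) -> \sum_(p <- s) p.1 = 0.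
Proof.
move=> s0 H; pose P : {poly C} := \prod_(p <- s) ('X - p.2%:P).
have P0 : P`_0 != 0.
  rewrite -horner_coef0 horner_prod prodf_seq_neq0; apply/allP => p ps /=.
  by rewrite hornerXsubC sub0r oppr_eq0 s0.
apply: (mulfI P0); rewrite mulr0.
have : \sum_(p <- s) p.1 * P.[p.2] = 0.
  rewrite big1_seq// => p /andP[_ ps]; rewrite horner_prod (big_rem p)//= hornerXsubC subrr.
  by rewrite mul0r mulr0.
under eq_bigr do rewrite horner_coef mulr_sumr.
have Pn : (0 < size P)%N by rewrite lt0n size_poly_eq0; apply: contraNneq P0 => ->; rewrite coef0.
rewrite exchange_big /= -(big_mkord xpredT (fun i => \sum_(p <- s) p.1 * (P`_i * p.2 ^+ i))).
rewrite -(prednK Pn) big_nat_recl//= [X in _ + X]big1_seq ?addr0 => [E|i _].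
  by rewrite -[RHS]E mulr_sumr; apply: eq_bigr => p _; rewrite expr0 mulr1 mulrC.
transitivity (P`_i.+1 * \sum_(p <- s) p.1 * p.2 ^+ i.+1).
  by rewrite mulr_sumr; apply: eq_bigr => p _; rewrite mulrCA.
by rewrite H// mulr0.
Qed.

(** * The z-equation for generic x *)

Section ZOperator.
Context {K : realType} {C : fieldType} {n : nat}.
Local Notation V := 'rV[K]_n.
Local Notation VC := 'rV[C]_n.
Variables (G : 'M[K]_n) (hG : euclidean G) (Q : qchar K C) (R : {fset V}).
Hypothesis hR : reduced_irreducible_root_system G R.
Local Notation dt := (dot G).
Local Notation cr := (coroot G).
Local Notation rf := (reflection G).
Local Notation f := (qemb Q).
Local Notation dc := (qdot G Q).
Local Notation qv := (qvec Q).
Local Notation E := (qexp G Q).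
Local Notation ev := (qev G Q).
Local Notation psum := (qpsum G Q).
Local Notation br := (qbr Q).
Local Notation vtx := (vertex G R).
Local Notation str := (qstr G Q).
Local Notation coset := (coset G).
Local Notation dot_sym := (dot_sym hG).
Local Notation dotZr := (dotZr hG).
Local Notation dotNr := (dotNr hG).
Local Notation dotBr := (dotBr hG).
Local Notation dot0r := (dot0r hG).
Local Notation dot_gt0 := (dot_gt0 hG).
Local Notation corootN := (corootN hG).
Local Notation reflectionE := (reflectionE hG).
Local Notation reflection_fix := (reflection_fix hG).
Local Notation dot_root_neq0 := (dot_root_neq0 hG hR).
Local Notation dot_coroot2' := (dot_coroot2' hG hR).
Local Notation coroot_gt0 := (coroot_gt0 hG hR).
Local Notation reflection_self := (reflection_self hG hR).
Local Notation reflectionK := (reflectionK hG hR).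
Local Notation reflection_dot := (reflection_dot hG hR).
Local Notation reflection_dotl := (reflection_dotl hG hR).
Local Notation root_opp := (root_opp hG hR).
Local Notation rootNE := (rootNE hG hR).
Local Notation reflection_root := (reflection_root hG hR).
Local Notation coroot_reflection := (coroot_reflection hG hR).
Local Notation dot_coroot_int := (dot_coroot_int hG hR).
Local Notation big_reflection := (big_reflection hG hR).
Local Notation vtx_wall := (vtx_wall hG hR).
Local Notation coset_eq := (@coset_eq _ _ G).
Variables (d : V) (Rp : {fset V}).
Hypothesis rd : regular G R d.
Hypothesis RpE : Rp = [fset a in R | 0 < dt a d]%fset.
Variable m : V -> nat.
Hypothesis hm : forall a b, a \in R -> b \in R -> m (rf a b) = m b.
Local Notation mk := (fun a => (m a)%:R : K).
Local Notation mkinv := (mk_inv hm).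
Local Notation Rp_R := (Rp_R RpE).
Variables (x : VC) (s : seq (C * V)).
Hypothesis gx : gen G Q R x.
Hypothesis sI : forall p a, p \in s -> a \in R -> dt p.2 a \is a Num.int.
Hypothesis sH : forall e p, regular G R e -> p \in s ->
  dt p.2 e <= dt (vtx mk e) e /\ (dt p.2 e = dt (vtx mk e) e -> p.2 = vtx mk e).
Hypothesis sQ : forall a i z, a \in R -> (1 <= i <= m a)%N -> wall G Q a z ->
  psum x s (z + qv ((i%:R / 2) *: a)) = psum x s (z - qv ((i%:R / 2) *: a)).
Local Notation X b z := (dc (qv (cr b)) z).

Lemma br_half a z : br (X a z) = E (2^-1 *: cr a) z - E (- (2^-1 *: cr a)) z.
Proof.
have e : E (2^-1 *: cr a) z = Q (X a z).
  rewrite /qexp (qvecZ Q 2^-1 (cr a)) dcZl fmorphV rmorph_nat mulrA divff ?mul1r//.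
  exact: (f2_neq0 Q).
by rewrite qexpNl e /qbr qpN.
Qed.

(** A geometric progression along the segment: consecutive exponentials differ by the bracket times
    the exponential of their midpoint. *)
Lemma segment_list a v j : exists t : seq (C * V),
  (forall z, E (v + j%:R *: cr a) z - E v z = br (X a z) * ev t z) /\
  forall q, q \in t -> exists2 i, (i < j)%N & q.2 = v + (i%:R + 2^-1) *: cr a.
Proof.
elim: j => [|j [t [tE tP]]].
  exists [::]; split=> // z; rewrite scale0r addr0 subrr.
  by rewrite /qev big_nil mulr0.
exists ((1, v + (j%:R + 2^-1) *: cr a) :: t); split.
  move=> z; rewrite /qev big_cons mul1r mulrDr /= -/(ev t z) -tE br_half.
  have -> : v + j.+1%:R *: cr a = v + (j%:R + 2^-1) *: cr a + 2^-1 *: cr a.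
    by move: (cr a) => w; rewrite -addrA -scalerDl; congr (_ + _ *: _); rewrite -natr1; field.
  have -> : v + j%:R *: cr a = v + (j%:R + 2^-1) *: cr a + - (2^-1 *: cr a).
    by move: (cr a) => w; rewrite -addrA -scalerBl; congr (_ + _ *: _); field.
  by rewrite ![E (v + _ + _) z]qexpDl; ring.
move=> q; rewrite inE => /orP[/eqP ->|/tP[i ij ->]]; first by exists j.
by exists i; rewrite // ltnW.
Qed.

(** Moving a coefficient to another exponent of the same coset changes the sum by a multiple of the
    bracket; the coefficients merged in one coset finally add up to zero. *)
Lemma expsum_div a (u : seq (C * V)) :
  (forall v, \sum_(p <- u | coset a v p.2) p.1 = 0) ->
  exists t : seq (C * V), (forall z, ev u z = br (X a z) * ev t z) /\
  forall q, q \in t -> exists v j i, [/\ v \in map snd u,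
    v + j%:R *: cr a \in map snd u, (i < j)%N & q.2 = v + (i%:R + 2^-1) *: cr a].
Proof.
move: {2}(size u) (leqnn (size u)) => N; elim: N u => [|N IH] u.
  rewrite leqn0 size_eq0 => /eqP -> _; exists [::]; split=> // z.
  by rewrite /qev !big_nil mulr0.
case: u => [|p0 u] su H.
  by exists [::]; split=> // z; rewrite /qev !big_nil mulr0.
have [/hasP[p1 p1u c1]|/hasPn Hn] := boolP (has (fun p => coset a p0.2 p.2) u); last first.
  have p00 : p0.1 = 0.
    rewrite -[RHS](H p0.2) big_cons cosetxx big1_seq ?addr0// => p /andP[cp pu].
    by have := Hn p pu; rewrite cp.
  have [|v|t [tE tP]] := IH u; first by rewrite -ltnS.
    by rewrite -[RHS](H v) big_cons p00 add0r; case: ifP.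
  exists t; split=> [z|q /tP[v [j [i [vu vj ij ->]]]]].
    by rewrite /qev big_cons p00 mul0r add0r -/(ev u z) tE.
  by exists v, j, i; split=> //; rewrite /= inE ?vu ?vj orbT.
pose u' := (p0.1 + p1.1, p1.2) :: rem p1 u.
have [|v|t [tE tP]] := IH u'; first by rewrite /= size_rem//; case: (u) p1u su.
  rewrite -[RHS](H v) !big_cons /= [in RHS](perm_big _ (perm_to_rem p1u)) /= big_cons.
  have -> : coset a v p1.2 = coset a v p0.2.
    apply/idP/idP => h.
      by rewrite (coset_eq _ h) -(coset_eq _ c1) cosetxx.
    by rewrite (coset_eq _ h).
  by case: ifP; rewrite ?addrA.
have sub q : q \in map snd u' -> q \in map snd (p0 :: u).
  rewrite !inE /= => /orP[/eqP ->|/mapP[r /mem_rem ru ->]]; apply/orP; right; exact: map_f.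
have [t2 [t2E t2P]] : exists t2 : seq (C * V),
  (forall z, p0.1 * (E p0.2 z - E p1.2 z) = br (X a z) * ev t2 z) /\
  forall q, q \in t2 -> exists v j i, [/\ v \in map snd (p0 :: u),
    v + j%:R *: cr a \in map snd (p0 :: u), (i < j)%N & q.2 = v + (i%:R + 2^-1) *: cr a].
  have m0 : p0.2 \in map snd (p0 :: u) by rewrite mem_head.
  have m1 : p1.2 \in map snd (p0 :: u) by rewrite inE; apply/orP; right; apply: map_f.
  have scale b (r : seq (C * V)) z : ev [seq (b * p.1, p.2) | p <- r] z = b * ev r z.
    by rewrite /qev big_map mulr_sumr; apply: eq_bigr => p _; rewrite mulrA.
  have snds b (r : seq (C * V)) q : q \in [seq (b * p.1, p.2) | p <- r] ->
      exists2 q', q' \in r & q.2 = q'.2.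
    by move=> /mapP[q' ? ->]; exists q'.
  move/asboolP: c1 => [_ /intrP[[k|k] ->] E1].
    have [t1 [t1E t1P]] := segment_list a p0.2 k.
    exists [seq (- p0.1 * p.1, p.2) | p <- t1]; split=> [z|q /snds[q' /t1P[i ik ->] ->]].
      by rewrite scale mulrCA -t1E E1; ring.
    by exists p0.2, k, i; split=> //; move: m1; rewrite E1.
  have E2 : p0.2 = p1.2 + k.+1%:R *: cr a by rewrite E1 NegzE mulrNz scaleNr subrK.
  have [t1 [t1E t1P]] := segment_list a p1.2 k.+1.
  exists [seq (p0.1 * p.1, p.2) | p <- t1]; split=> [z|q /snds[q' /t1P[i ik ->] ->]].
    by rewrite scale mulrCA -t1E -E2.
  by exists p1.2, k.+1, i; split=> //; rewrite -E2.
exists (t ++ t2); split=> [z|q]; last first.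
  rewrite mem_cat => /orP[/tP[v [j [i [vu vj ij ->]]]]|/t2P//].
  by exists v, j, i; split=> //; apply: sub.
rewrite ev_cat mulrDr -tE -t2E /qev /u' !big_cons /= [in LHS](perm_big _ (perm_to_rem p1u)) /= big_cons.
ring.
Qed.

(** Quasi-invariance with $s=1$ makes the coefficients of the difference sum to zero on each coset.
    Division by the bracket shortens the polytope by the segment of $a^\vee$. *)
Lemma quotient_exists a : a \in R -> (0 < m a)%N -> exists t : seq (C * V),
  [/\ forall z, psum x s (z + qv (2^-1 *: a)) - psum x s (z - qv (2^-1 *: a)) =
        br (X a z) * psum x t z,
      forall q, q \in t -> lat G R q.2 &
      forall e q, regular G R e -> q \in t ->
        dt q.2 e <= dt (vtx mk e - half_vtx G a e) e /\
        (dt q.2 e = dt (vtx mk e - half_vtx G a e) e -> q.2 = vtx mk e - half_vtx G a e)].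
Proof.
move=> aR ma; pose u := [seq (p.1 * (str x a p.2 - (str x a p.2)^-1), p.2) | p <- s].
have [v|t [tE tP]] := @expsum_div a u.
  rewrite big_map /= -[RHS](@anti_coef _ _ _ _ hG Q _ hR x s a 1 v aR) ?expr1// => z.
  by apply: sQ.
have uS v : v \in map snd u -> exists2 p, p \in s & p.2 = v.
  by rewrite -map_comp => /mapP[p ps ->]; exists p.
have aa := dot_root_neq0 aR.
exists t; split=> [z|q /tP[v [j [i [/uS[p ps pv] _ _ ->]]]] b bR|e q re].
- have -> : 2^-1 *: a = (1%:R / 2) *: a by rewrite div1r.
  rewrite (psum_shift hG) (psum_shiftN hG) -mulrBr /qpsum mulrCA -tE; congr (_ * _).
  rewrite /qev big_map -sumrB; apply: eq_bigr => p _.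
  by rewrite !expr1 /= mulrBr mulrBl.
- rewrite dotDl dotZl mulrDr; apply: rpredD; first by rewrite -pv rpredM ?rpred_nat ?sI.
  rewrite mulrA; apply: rpredM; last exact: dot_coroot_int.
  rewrite mulrDr divff ?pnatr_eq0// rpredD ?rpred1//; apply: rpredM; exact: rpred_nat.
move=> /tP[v [j [i [/uS[p ps pv] /uS[p' ps' pv'] ij ->]]]].
have [h1 h2] := sH re ps; have [h3 h4] := sH re ps'; rewrite pv in h1 h2; rewrite pv' in h3 h4.
rewrite /half_vtx; have ce := coroot_gt0 aR.
have ij' : i%:R + 1 <= j%:R :> K by rewrite natr1 ler_nat.
have i0 : 0 <= i%:R :> K by rewrite ler0n.
move: h1 h2 h3 h4; rewrite [dt (_ - _) e]dotBl [dt (_ *: cr a) e]dotZl.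
rewrite [dt (v + (_ + _) *: _) e]dotDl [dt ((i%:R + _) *: _) e]dotZl.
rewrite [dt (v + j%:R *: _) e]dotDl [dt (j%:R *: _) e]dotZl.
have ae := re a aR; move: (dot_corootl G a e) => ca h1 h2 h3 h4.
have [ae0|ae0|/eqP] := ltrgtP (dt a e) 0; last by rewrite (negPf ae).
  have c0 : dt (cr a) e < 0 by rewrite ca pmulr_rlt0.
  rewrite (ltr0_sg ae0); split; first by nra.
  move=> E1; have vi : i%:R * dt (cr a) e = 0 by apply/eqP; rewrite eq_le; apply/andP; split; nra.
  have iz : i%:R = 0 :> K by move/eqP: vi; rewrite mulf_eq0 (lt_eqF c0) orbF => /eqP.
  rewrite -h2; last by move: E1; rewrite iz; lra.
  by rewrite iz add0r mulN1r scaleNr opprK.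
have c0 : 0 < dt (cr a) e by rewrite ca pmulr_rgt0.
rewrite (gtr0_sg ae0); split; first by nra.
move=> E1; have ji : (j%:R - i%:R - 1) * dt (cr a) e = 0 by apply/eqP; rewrite eq_le; apply/andP; split; nra.
have jE : j%:R = i%:R + 1 :> K.
  by move/eqP: ji; rewrite mulf_eq0 (gt_eqF c0) orbF => /eqP; lra.
rewrite -h4; last by move: E1; rewrite jE; lra.
by rewrite jE -addrA -scalerBl; congr (_ + _ *: _); field.
Qed.

Lemma fsym a z j : a \in R -> wall G Q a z -> j \is a Num.int -> `|j| <= (m a)%:R ->
  psum x s (z + qv ((j / 2) *: a)) = psum x s (z - qv ((j / 2) *: a)).
Proof.
move=> aR az /intrP[[[|i]|i] ->].
- by rewrite mul0r scale0r qvec0 subr0 addr0.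
- by rewrite -pmulrn normr_nat ler_nat => im; apply: sQ.
rewrite NegzE mulrNz -pmulrn normrN normr_nat ler_nat => im.
by rewrite mulNr scaleNr qvecN opprK; apply/esym/sQ.
Qed.

Lemma X_shift b a z r : X b (z + qv (r *: a)) = X b z + f (r * dt (cr b) a).
Proof. by rewrite dcDr// dc_real dotZr. Qed.

Lemma X_reflect a b z h : a \in R ->
  X b (z - qv (h *: a)) = X (rf a b) (z + qv (h *: a)) + X a z * f (dt (cr b) a).
Proof.
move=> aR; rewrite -qvecN -scaleNr X_shift coroot_reflection// reflectionE.
rewrite qvecB (qvecZ Q _ (cr a)) [dc (_ - _) _]dcBl [dc (_ *: _) _]dcZl !X_shift.
rewrite (dot_coroot2' aR) mulNr rmorphN !rmorphM (rmorph_nat f).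
by move: (f h) (f (dt (cr b) a)) (X b z) (X a z) => *; ring.
Qed.

Lemma wall_Q a z : wall G Q a z -> Q (2 * X a z) = 1.
Proof. by []. Qed.

(** The multiplier has square 1, so it is a sign. *)
Lemma br_per k y c : Q (2 * k) = 1 -> c \is a Num.int -> br (y + k * f c) = Q (k * f c) * br y.
Proof.
move=> k1 ci; have : Q (k * f c) ^+ 2 = 1.
  by rewrite -qpMn mulrA [_ * f c]mulrC qp_intz.
rewrite /qbr opprD !qpD [Q (- (k * f c))]qpN => /eqP.
by rewrite sqrf_eq1 => /orP[/eqP->|/eqP->]; rewrite ?invrN invr1; ring.
Qed.

Lemma prod_odd_sign (phi : V -> C) (P : V -> bool) :
  (forall b, b \in R -> phi (- b) = - phi b) -> (forall b, b \in R -> P (- b) = ~~ P b) ->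
  \prod_(b <- R | P b) phi b = \prod_(b <- Rp) (-1) ^+ (~~ P b) * \prod_(b <- Rp) phi b.
Proof.
move=> op oP; rewrite big_mkcond (big_Rp hG hR rd RpE) /= -big_split.
apply: eq_big_seq => b /Rp_R bR /=; rewrite oP// op//.
by case: (P b); rewrite /= ?expr0 ?expr1 ?mul1r ?mulr1 ?mulN1r.
Qed.

(** In a positive system with the wall of [a], the reflection permutes all positive roots except the
    one proportional to [a], which costs the sign. The multipliers combine to $q^{-2(a^\vee,z)}=1$,
    because $(b^\vee,a)$ summed over that system is $-2$. *)
Lemma prod_reflection a z (phi psi : V -> C) : a \in R -> wall G Q a z ->
  (forall b, b \in R -> phi (- b) = - phi b) -> (forall b, b \in R -> psi (- b) = - psi b) ->
  (forall b, b \in R -> phi b = Q (X a z * f (dt (cr b) a)) * psi (rf a b)) ->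
  \prod_(b <- Rp) phi b = - \prod_(b <- Rp) psi b.
Proof.
move=> aR az ophi opsi H; have [e [d0 [e2 A]]] := wall_exists hG hR aR.
have [re _] := adj_reg A.
pose P b := 0 < dt b e; pose P' b := P (rf a b).
have oP b : b \in R -> P (- b) = ~~ P b.
  by move=> bR; rewrite /P dotNl oppr_gt0; have := re b bR; case: ltrgtP.
have rfN b : rf a (- b) = - rf a b by rewrite !reflectionE dotNl scaleNr opprD.
have oP' b : b \in R -> P' (- b) = ~~ P' b.
  by move=> bR; rewrite /P' rfN oP// reflection_root.
have sumP : \sum_(b <- R | P b) dt (cr b) a = - 2.
  have one_inv : kinv G R (fun=> 1 : K) by [].
  have := vtx_wall one_inv A; rewrite (vtx_Rp hG hR re erefl _ one_inv) dotZl dot_suml.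
  move=> /(congr1 (fun y => 2 * y)); rewrite mulrA divff ?pnatr_eq0// mul1r mulrN1 => <-.
  rewrite -big_filter (perm_big (enum_fset [fset b in R | 0 < dt b e]%fset)) /=.
    by apply: eq_big_seq => b; rewrite !inE => /andP[_ be]; rewrite (gtr0_sg be) mul1r scale1r.
  apply: uniq_perm; rewrite ?filter_uniq ?fset_uniq// => b.
  by rewrite mem_filter !inE andbC.
have e1 : \prod_(b <- R | P b) phi b = \prod_(b <- R | P' b) psi b.
  have -> : \prod_(b <- R | P b) phi b =
      \prod_(b <- R | P b) Q (X a z * f (dt (cr b) a)) * \prod_(b <- R | P b) psi (rf a b).
    rewrite -big_split big_seq_cond [RHS]big_seq_cond; apply: eq_bigr => b /andP[bR _].
    by rewrite H.
  have -> : \prod_(b <- R | P b) Q (X a z * f (dt (cr b) a)) = 1.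
    rewrite -qp_sum -mulr_sumr -rmorph_sum sumP rmorphN rmorph_nat mulrN qpN.
    by rewrite [X a z * 2]mulrC (wall_Q az) invr1.
  rewrite mul1r [RHS](big_reflection _ P' psi aR); apply: eq_bigl => b.
  by rewrite /P' reflectionK.
have [a' a'p aE] : exists2 a', a' \in Rp & a' = a \/ a' = - a.
  by case: (Rp_or hG hR rd RpE aR) => ?; [exists a|exists (- a)]; auto.
have a'R := Rp_R a'p.
(* The two positive systems differ only in the root proportional to [a]. *)
have sgn : \prod_(b <- Rp) (-1) ^+ (~~ P' b) = - \prod_(b <- Rp) (-1) ^+ (~~ P b) :> C.
  rewrite (big_rem a')//= [in RHS](big_rem a')//= -mulNr; congr (_ * _).
    have -> : P' a' = P (- a').
      by rewrite /P'; case: aE => ->; rewrite ?rfN reflection_self.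
    by rewrite oP//; case: (P a'); rewrite /= ?expr0 ?expr1 ?opprK.
  apply: eq_big_seq => b; rewrite mem_rem_uniq ?fset_uniq// inE => /andP[ba' bRp].
  have bR := Rp_R bRp; have bNa' : b != - a'.
    by apply: contraTneq bRp => ->; apply: (Rp_N RpE a'p).
  have [ba bNa] : b != a /\ b != - a by case: aE ba' bNa' => ->; rewrite ?opprK.
  suff -> : P' b = P b by [].
  rewrite /P' /P -[LHS]sgr_gt0 -[RHS]sgr_gt0.
  case: A => _ ad0 _ _ HA.
  have [_ -> _] := HA b bR ba bNa.
  have r1 : rf a b != a.
    by apply: contraNneq bNa => E1; rewrite -[b](reflectionK aR) E1 reflection_self.
  have r2 : rf a b != - a.
    by apply: contraNneq ba => E1; rewrite -[b](reflectionK aR) E1 rfN reflection_self ?opprK.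
  have rR : rf a b \in R by apply: (root_refl hR).
  have [_ -> _] := HA _ rR r1 r2.
  by rewrite reflection_dotl// reflection_fix.
have := e1; rewrite !prod_odd_sign// sgn mulNr -mulrN; apply: mulfI.
rewrite prodf_seq_neq0; apply/allP => b _; by rewrite signr_eq0.
Qed.

Section Quotients.
Variable tl : V -> seq (C * V).
Hypothesis tlE : forall a z, a \in R -> (0 < m a)%N ->
  psum x s (z + qv (2^-1 *: a)) - psum x s (z - qv (2^-1 *: a)) = br (X a z) * psum x (tl a) z.

(** Setup for clearing denominators. For [t] in the orbit, [B t] over [B 0] is the first product in
    $b_t$ and [Nf t] over [Kf t] is the second one; it is trivial unless [t] is a root with positive
    multiplicity. [Y t] is $\psi(z+t)-\psi(z)$ divided by [Kf t], again an exponential sum up to the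
    factor $q^{2(x,z)}$. *)
Let special t := (t \in R) && (0 < m t)%N.
Let Y t z := if special t then psum x (tl t) (z + qv (2^-1 *: t))
  else psum x s (z + qv t) - psum x s z.
Let Kf t z := if special t then br (X t z + 1) else 1.
Let Nf t z := if special t then br (X t z - (m t)%:R + 1) else 1.
Let B t z := \prod_(b <- Rp) br (X b z - f (Num.sg (dt (cr b) t) * (m b)%:R)).

Let mN a : a \in R -> m (- a) = m a.
Proof. by move=> aR; rewrite -(reflection_self aR) hm. Qed.

Let XN b z : b \in R -> X (- b) z = - X b z.
Proof. by move=> bR; rewrite corootN// qvecN dcNl. Qed.

Lemma quotientE t z : Kf t z * Y t z = psum x s (z + qv t) - psum x s z.
Proof.
rewrite /Kf /Y; case: ifP => [/andP[tR mt]|_]; last by rewrite mul1r.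
have := tlE (z + qv (2^-1 *: t)) tR mt; rewrite X_shift (dot_coroot2' tR).
rewrite mulVf ?pnatr_eq0// rmorph1 addrK -addrA -qvecD -scalerDl.
have -> : 2^-1 + 2^-1 = 1 :> K by field.
by rewrite scale1r.
Qed.

Lemma psum_line t z w N : psum x t (z + qv (N%:R *: w)) =
  \sum_(p <- t) (Q (2 * dc x z) * (p.1 * E p.2 z)) * (Q (2 * dc x (qv w)) * E p.2 (qv w)) ^+ N.
Proof.
rewrite /qpsum /qev mulr_sumr; apply: eq_bigr => p _.
rewrite (qvecZ Q _ w) rmorph_nat dcDr// dcZr// qexpDr// mulrDr [2 * (N%:R * _)]mulrCA qpD [Q (N%:R * _)]qpMn exprMn.
have -> : E p.2 (N%:R *: qv w) = E p.2 (qv w) ^+ N by rewrite /qexp dcZr// -qpMn; congr (Q _); ring.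
move: (Q (2 * dc x (qv w)) ^+ N) (E p.2 (qv w) ^+ N) => A F; rewrite /=; ring.
Qed.

Lemma psum_continuation t t' z z' w b b' :
  (forall N, (0 < N)%N -> b * psum x t (z + qv (N%:R *: w)) = b' * psum x t' (z' + qv (N%:R *: w))) ->
  b * psum x t z = b' * psum x t' z'.
Proof.
move=> H.
pose l r y (p : C * V) := (r * (Q (2 * dc x y) * (p.1 * E p.2 y)), Q (2 * dc x (qv w)) * E p.2 (qv w)).
pose u := [seq l b z p | p <- t] ++ [seq l (- b') z' p | p <- t'].
have uE N : \sum_(p <- u) p.1 * p.2 ^+ N =
    b * psum x t (z + qv (N%:R *: w)) - b' * psum x t' (z' + qv (N%:R *: w)).
  rewrite big_cat !big_map /= !psum_line !mulr_sumr -sumrN.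
  by congr (_ + _); apply: eq_bigr => p _; rewrite -mulrA// mulNr.
have u0 p : p \in u -> p.2 != 0.
  rewrite mem_cat => /orP[] /mapP[p' _ ->] /=; by rewrite mulf_neq0 ?qp_neq0 ?qexp_neq0.
apply/eqP; rewrite -subr_eq0; have := uE 0%N; rewrite !scale0r qvec0 !addr0 => <-.
apply/eqP; under eq_bigr do rewrite expr0 mulr1.
by apply: geometric_eq0 => // N N0; rewrite uE H// subrr.
Qed.

(** A bracket vanishing at $N=0$ vanishes for no positive $N$, since $q^{2N}\ne1$. Cancel there and
    continue back to $N=0$. *)
Lemma psum_cancel a c t t' z z' w b b' : dt (cr a) w = 1 ->
  (forall N, br (X a (z + qv (N%:R *: w)) + c) * (b * psum x t (z + qv (N%:R *: w))) =
     br (X a (z + qv (N%:R *: w)) + c) * (b' * psum x t' (z' + qv (N%:R *: w)))) ->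
  b * psum x t z = b' * psum x t' z'.
Proof.
move=> aw H; have [b0|b0] := eqVneq (br (X a z + c)) 0; last first.
  by have := H 0%N; rewrite !scale0r qvec0 !addr0 => /(mulfI b0).
apply: (@psum_continuation t t' z z' w) => N N0; apply: (mulfI _ (H N)).
rewrite X_shift aw mulr1 rmorph_nat addrAC br_eq0 mulrDr qpD.
move/eqP: b0; rewrite br_eq0 => /eqP ->; rewrite mul1r -natrM -(rmorph_nat f).
by apply: qp_int; rewrite ?rpred_nat// pnatr_eq0 muln_eq0 /= -lt0n.
Qed.

Lemma quotientN a z : a \in R -> (0 < m a)%N -> psum x (tl (- a)) z = psum x (tl a) z.
Proof.
move=> aR ma; rewrite -[LHS]mul1r -[RHS]mul1r.
apply: (@psum_cancel a 0 _ _ z z (2^-1 *: a)).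
  by rewrite dotZr (dot_coroot2' aR) mulVf ?pnatr_eq0.
move=> N; rewrite addr0 !mul1r; move: (z + _) => y.
rewrite -tlE//; have := @tlE (- a) y; rewrite rootNE// mN// XN// => /(_ aR ma).
by rewrite brN mulNr scalerN qvecN opprK => /esym/eqP; rewrite eqr_oppLR opprB => /eqP.
Qed.

Section Wall.
Variables (a : V) (z : VC).
Hypotheses (aR : a \in R) (az : wall G Q a z).
Let yv (h : K) : VC := z + qv (h *: a).

Let yvN h : z - qv (h *: a) = yv (- h).
Proof. by rewrite /yv scaleNr qvecN. Qed.

Let yvD h h' : yv h + qv (h' *: a) = yv (h + h').
Proof. by rewrite /yv -addrA -qvecD scalerDl. Qed.

Let X_yv h : X a (yv h) = X a z + f (h * 2).
Proof. by rewrite /yv X_shift (dot_coroot2' aR). Qed.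

Lemma wall_br u : br (X a z - u) = - br (X a z + u).
Proof.
have E1 : Q (X a z) ^+ 2 = 1 by rewrite -qpMn.
move/eqP: E1; rewrite sqrf_eq1 /qbr !opprD opprK !qpD !qpN.
by move=> /orP[/eqP->|/eqP->]; rewrite ?invrN invr1; ring.
Qed.

Let br0 : br (X a z) = 0.
Proof. by apply/eqP; rewrite br_eq0; apply/eqP. Qed.

(** Passing from $j$ to $-j$ changes the sign of the bracket on the wall, and that of the numerator
    by quasi-invariance for the shifts $j+1$ and $j-1$. *)
Lemma quotient_wall j : (0 < m a)%N -> j \is a Num.int -> `|j + 1| <= (m a)%:R ->
  `|j - 1| <= (m a)%:R -> psum x (tl a) (yv (j / 2)) = psum x (tl a) (yv (- (j / 2))).
Proof.
move=> ma ji j1 j2; have [->|j0] := eqVneq j 0; first by rewrite mul0r oppr0.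
have bj : br (X a z + f j) != 0.
  rewrite br_eq0 mulrDr qpD -[2 * X a z]/(2 * X a z).
  have -> : Q (2 * X a z) = 1 by [].
  rewrite mul1r -(rmorph_nat f) -rmorphM; apply: qp_int; first by rewrite rpredM ?rpred_nat.
  by rewrite mulf_neq0 ?pnatr_eq0.
have j2' : j / 2 * 2 = j by rewrite divfK ?pnatr_eq0.
have := tlE (yv (j / 2)) aR ma; have := tlE (yv (- (j / 2))) aR ma.
rewrite !X_yv mulNr j2' rmorphN wall_br -!qvecN -![- (_ *: a)]scaleNr !yvD.
have fs h : h \is a Num.int -> `|h| <= (m a)%:R -> psum x s (yv (- (h / 2))) = psum x s (yv (h / 2)).
  by move=> hi hm'; rewrite -yvN; apply/esym/fsym.
have -> : - (j / 2) + 2^-1 = - ((j - 1) / 2) by field.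
have -> : - (j / 2) - 2^-1 = - ((j + 1) / 2) by field.
rewrite !fs ?rpredB ?rpredD ?rpred1//.
have -> : j / 2 + 2^-1 = (j + 1) / 2 by field.
have -> : j / 2 - 2^-1 = (j - 1) / 2 by field.
move=> E1 E2; apply: (mulfI bj); rewrite -E2 -opprB E1; ring.
Qed.

(** The numerators [Nf] agree on the wall. At $j=1-m_a$ they vanish; for larger $j$ the shift $1-j$
    is within the range of [quotient_wall]. *)
Lemma NY_self j : (0 < m a)%N -> j \is a Num.int -> - (m a)%:R < j <= (m a)%:R ->
  Nf a (yv (- (j / 2))) * Y a (yv (- (j / 2))) = Nf (- a) (yv (j / 2)) * Y (- a) (yv (j / 2)).
Proof.
move=> ma ji /andP[j1 j2]; rewrite /Nf /Y /special rootNE// mN// aR ma /= XN// !X_yv.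
rewrite mulNr divfK ?pnatr_eq0// rmorphN.
have N1 : br (X a z - f j - (m a)%:R + 1) = - br (X a z + (f j + (m a)%:R - 1)).
  by rewrite -wall_br; congr (br _); ring.
have N2 : br (- (X a z + f j) - (m a)%:R + 1) = - br (X a z + (f j + (m a)%:R - 1)).
  by rewrite -brN; congr (br _); ring.
rewrite N1 N2; have [j0|j0] := eqVneq j (1 - (m a)%:R).
  by rewrite j0 rmorphB rmorph1 rmorph_nat subrK subrr addr0 br0 oppr0 !mul0r.
congr (_ * _); rewrite scalerN quotientN// -scaleNr !yvD.
have jm : - (m a)%:R + 2 <= j.
  have : 0 < j + (m a)%:R - 1.
    rewrite lt_neqAle; apply/andP; split.
      by rewrite eq_sym; apply: contra j0 => /eqP h; apply/eqP; lra.
    have : 1 <= j + (m a)%:R; last by lra.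
    by apply: int_gt0; [rewrite rpredD ?rpred_nat|lra].
  by move/int_gt0; rewrite rpredB ?rpredD ?rpred_nat ?rpred1// => /(_ isT); lra.
have -> : - (j / 2) + 2^-1 = (1 - j) / 2 by field.
rewrite quotient_wall ?rpredB ?rpred1//; last 2 first.
- by rewrite ler_norml; apply/andP; split; lra.
- by rewrite ler_norml; apply/andP; split; lra.
by congr (psum _ _ (yv _)); field.
Qed.

Lemma B_reflection t h : B t (yv (- h)) = - B (rf a t) (yv h).
Proof.
have oddB u y b : b \in R -> br (X (- b) y - f (Num.sg (dt (cr (- b)) u) * (m (- b))%:R)) =
    - br (X b y - f (Num.sg (dt (cr b) u) * (m b)%:R)).
  move=> bR; rewrite XN// mN// corootN// dotNl sgrN -brN; congr (br _).
  by rewrite mulNr rmorphN opprK opprB addrC.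
apply: (@prod_reflection a z (fun b => br (X b (yv (- h)) - f (Num.sg (dt (cr b) t) * (m b)%:R)))
  (fun b => br (X b (yv h) - f (Num.sg (dt (cr b) (rf a t)) * (m b)%:R)))) => // b bR.
- exact: oddB.
- exact: oddB.
rewrite -br_per//; last exact: dot_coroot_int.
rewrite -yvN (X_reflect b z h aR) hm// coroot_reflection// reflection_dot//.
by congr (br _); rewrite addrAC.
Qed.

(** For this [j] the factor of the positive root proportional to [a] becomes the bracket of
    $(a^\vee,z)$, up to sign, which is zero on the wall. This disposes of the extreme shifts not
    covered by quasi-invariance. *)
Lemma B_killed t j : j = - (Num.sg (dt t (cr a)) * (m a)%:R) -> B t (yv (- (j / 2))) = 0.
Proof.
move=> jE; have killed b : b = a \/ b = - a ->
    br (X b (yv (- (j / 2))) - f (Num.sg (dt (cr b) t) * (m b)%:R)) = 0.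
  have k0 : br (X a (yv (- (j / 2))) - f (Num.sg (dt (cr a) t) * (m a)%:R)) = 0.
    rewrite X_yv mulNr divfK ?pnatr_eq0// -addrA -rmorphB dot_sym.
    by rewrite -opprD {1}jE addNr oppr0 rmorph0 addr0 br0.
  case=> ->; rewrite // XN// mN// corootN// dotNl sgrN mulNr rmorphN -opprD brN.
  by rewrite k0 oppr0.
apply/eqP; rewrite prodf_seq_eq0; apply/hasP.
by case: (Rp_or hG hR rd RpE aR) => aRp; [exists a|exists (- a)] => //=; apply/eqP/killed; auto.
Qed.

(** Adding to [z] the component of [t] orthogonal to [a] stays on the wall, and quasi-invariance for
    the shift $(t,a^\vee)-j$ applies there. *)
Lemma psum_s_wall t j : dt t (cr a) \is a Num.int -> j \is a Num.int ->
  `|dt t (cr a) - j| <= (m a)%:R ->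
  psum x s (yv (- (j / 2)) + qv t) = psum x s (yv (j / 2) + qv (rf a t)).
Proof.
move=> ki ji kj; set k := dt t (cr a) in ki kj.
have z1w : wall G Q a (z + qv (t - (k / 2) *: a)).
  apply: (wallD hG) => //; rewrite /wall /qexp dc_real dotBr dotZr (dot_coroot2' aR).
  by rewrite (dot_sym (cr a)) divfK ?pnatr_eq0// subrr rmorph0 mulr0 qp0.
have kji : k - j \is a Num.int by rewrite rpredB.
have := fsym aR z1w kji kj; rewrite -!addrA -!qvecD -qvecN -qvecD /yv.
have -> : t - (k / 2) *: a + ((k - j) / 2) *: a = - (j / 2) *: a + t.
  by apply/rowP => l; rewrite !mxE; field.
have -> : t - (k / 2) *: a - ((k - j) / 2) *: a = (j / 2) *: a + rf a t.
  by rewrite /reflection -/k; apply/rowP => l; rewrite !mxE; field.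
by rewrite !qvecD !addrA.
Qed.

Lemma quotient_reflection t j : t \in R -> (0 < m t)%N -> dt t (cr a) \is a Num.int ->
  j \is a Num.int -> `|j| <= (m a)%:R -> `|dt t (cr a) - j| <= (m a)%:R ->
  br (X (rf a t) (yv (j / 2)) + 1) * psum x (tl (rf a t)) (yv (j / 2) + qv (2^-1 *: rf a t)) =
  br (X (rf a t) (yv (j / 2)) + 1) * (Q (X a z * f (dt (cr t) a)) *
    psum x (tl t) (yv (- (j / 2)) + qv (2^-1 *: t))).
Proof.
move=> tR mt ki ji jm kj.
have tR' : rf a t \in R by apply: (root_refl hR).
have := quotientE (rf a t) (yv (j / 2)); have := quotientE t (yv (- (j / 2))).
rewrite /Kf /Y /special tR tR' hm// mt /= psum_s_wall// => E1 E2.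
rewrite E2 mulrA [br _ * Q _]mulrC.
have -> : Q (X a z * f (dt (cr t) a)) * br (X (rf a t) (yv (j / 2)) + 1) =
    br (X t (yv (- (j / 2))) + 1).
  rewrite -br_per//; last exact: dot_coroot_int.
  by rewrite -yvN (X_reflect t z (j / 2) aR); congr (br _); rewrite addrAC.
by rewrite E1; congr (_ - _); rewrite /yv scaleNr qvecN; apply: fsym.
Qed.

End Wall.

(** The component of [t] orthogonal to [a], rescaled. Moving along it preserves the wall of [a]
    while changing the bracket of [t]. *)
Lemma transverse_vector a t : a \in R -> t \in R -> t != a -> t != - a ->
  exists2 w, dt a w = 0 & dt (cr t) w = 1.
Proof.
move=> aR tR ta tNa; have aa := dot_root_neq0 aR.
pose u := t - (dt t a / dt a a) *: a.
have au : dt a u = 0.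
  by rewrite /u dotBr dotZr (dot_sym a) divfK ?subrr.
have u0 : u != 0.
  apply/eqP => /eqP; rewrite subr_eq0 => /eqP tE.
  have /(root_reduced hR aR) : (dt t a / dt a a) *: a \in R by rewrite -tE.
  by case=> E1; move: ta tNa; rewrite tE E1 ?scale1r ?scaleN1r eqxx.
have tu : dt t u = dt u u.
  by rewrite {2}/u [dt (_ - _) _]dotBl dotZl au mulr0 subr0.
have cu : dt (cr t) u != 0.
  rewrite dot_corootl tu; apply: mulf_neq0; last by rewrite gt_eqF// dot_gt0.
  by rewrite mulf_neq0 ?invr_eq0 ?pnatr_eq0// dot_root_neq0.
exists ((dt (cr t) u)^-1 *: u); first by rewrite dotZr au mulr0.
by rewrite dotZr mulVf.
Qed.

(** For a root [t] other than $\pm a$ the identity of [quotient_reflection] is divided by its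
    bracket; where this vanishes, [psum_cancel] moves along a vector orthogonal to [a]. *)
Lemma NY_other a z t j : a \in R -> wall G Q a z -> t != a -> t != - a ->
  dt t (cr a) \is a Num.int -> j \is a Num.int ->
  `|j| <= (m a)%:R -> `|dt t (cr a) - j| <= (m a)%:R ->
  Nf t (z + qv (- (j / 2) *: a)) * Y t (z + qv (- (j / 2) *: a)) =
  Nf (rf a t) (z + qv ((j / 2) *: a)) * Y (rf a t) (z + qv ((j / 2) *: a)).
Proof.
move=> aR az ta tNa ki ji jm kj.
have st : special (rf a t) = special t.
  rewrite /special reflection_root//; case: (boolP (t \in R)) => //= tR; by rewrite hm.
rewrite /Nf /Y st; case: ifP => [/andP[tR mt]|_]; last first.
  rewrite !mul1r psum_s_wall//; congr (_ - _); rewrite scaleNr qvecN.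
  by apply/esym/fsym.
have tR' : rf a t \in R by apply: (root_refl hR).
have [||w aw tw] := transverse_vector aR tR'.
- by apply: contraNneq tNa => E1; rewrite -[t](reflectionK aR) E1 reflection_self.
- by apply: contraNneq ta => E1; rewrite -[t](reflectionK aR) E1 reflectionN reflection_self ?opprK.
have -> : X t (z + qv (- (j / 2) *: a)) = X (rf a t) (z + qv ((j / 2) *: a)) + X a z * f (dt (cr t) a).
  by rewrite scaleNr qvecN; apply: X_reflect.
rewrite hm// [_ - (m t)%:R]addrAC [_ + 1]addrAC br_per//; last exact: dot_coroot_int.
rewrite -mulrA mulrCA; congr (_ * _); rewrite -[RHS]mul1r; apply/esym.
apply: (@psum_cancel (rf a t) 0 _ _ _ _ w) => // N.
have wN : wall G Q a (z + qv (N%:R *: w)).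
  apply: (wallD hG) => //; rewrite /wall /qexp dc_real dotZr dot_corootl aw !mulr0.
  by rewrite rmorph0 mulr0 qp0.
have := quotient_reflection aR wN tR mt ki ji jm kj.
have -> : X a (z + qv (N%:R *: w)) = X a z.
  by rewrite X_shift dot_corootl aw !mulr0 rmorph0 addr0.
have AC (p q r u : VC) : p + q + r + u = p + u + q + r.
  by rewrite -!addrA; congr (_ + _); rewrite [RHS]addrC -!addrA.
rewrite addr0 mul1r [z + qv ((j / 2) *: a) + _ + _]AC [z + qv (- (j / 2) *: a) + _ + _]AC.
have -> : X (rf a t) (z + qv (N%:R *: w) + qv ((j / 2) *: a) + qv (2^-1 *: rf a t)) =
   X (rf a t) (z + qv (N%:R *: w) + qv ((j / 2) *: a)) + 1.
  by rewrite X_shift (dot_coroot2' tR') mulVf ?pnatr_eq0// rmorph1.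
by [].
Qed.
Hypothesis tlL : forall a q, a \in R -> (0 < m a)%N -> q \in tl a -> lat G R q.2.
Hypothesis tlH : forall a e q, a \in R -> (0 < m a)%N -> regular G R e -> q \in tl a ->
  dt q.2 e <= dt (vtx mk e - half_vtx G a e) e /\
  (dt q.2 e = dt (vtx mk e - half_vtx G a e) e -> q.2 = vtx mk e - half_vtx G a e).
Variable O : seq V.
Hypothesis uO : uniq O.
Hypothesis O_refl : forall t a, t \in O -> a \in R -> rf a t \in O.
Hypothesis O_int : forall t a, t \in O -> a \in R -> dt t (cr a) \is a Num.int.
Hypothesis O_small : forall t a, t \in O -> a \in R -> dt t (cr a) <= 1 \/ t = a.

Lemma orbit_cases t a : t \in O -> a \in R ->
  [\/ t = a, t = - a, dt t (cr a) = 0 | dt t (cr a) = 1 \/ dt t (cr a) = - 1].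
Proof.
move=> tO aR; case: (O_small tO aR) => [h1|->]; last by constructor 1.
case: (O_small tO (root_opp aR)) => [|->]; last by constructor 2.
rewrite corootN// dotNr => h2; have ki := O_int tO aR.
have [k0|k0|k0] := ltrgtP (dt t (cr a)) 0; last by constructor 3.
- constructor 4; right; apply/eqP; rewrite -eqr_oppLR; apply/eqP; apply: int_01.
    by rewrite rpredN.
  by rewrite oppr_gt0 k0.
- by constructor 4; left; apply: int_01; rewrite ?k0.
Qed.

(** Reflecting [t] and the shift reverses the sign of [B] and preserves [Nf] times [Y], except for
    an extreme shift, where both values of [B] are zero. *)
Lemma term_wall a z t j : a \in R -> wall G Q a z -> t \in O -> j \is a Num.int ->
  `|j| <= (m a)%:R ->
  B t (z + qv (- (j / 2) *: a)) * (Nf t (z + qv (- (j / 2) *: a)) * Y t (z + qv (- (j / 2) *: a))) =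
  - (B (rf a t) (z + qv ((j / 2) *: a)) *
     (Nf (rf a t) (z + qv ((j / 2) *: a)) * Y (rf a t) (z + qv ((j / 2) *: a)))).
Proof.
move=> aR az tO ji jm; have B1 := B_reflection aR az t (j / 2).
have [jE|jn] := eqVneq j (- (Num.sg (dt t (cr a)) * (m a)%:R)).
  have := B1; rewrite (B_killed aR az jE) => /eqP; rewrite eq_sym oppr_eq0 => /eqP ->.
  by rewrite !mul0r oppr0.
rewrite B1 mulNr; congr (- (_ * _)).
(* With the extreme shift excluded, each possible value of $(t,a^\vee)$ leaves $j$ within the bounds
   needed by [NY_self] or [NY_other]. *)
have := jm; rewrite ler_norml => /andP[j1 j2].
have c2 : dt a (cr a) = 2 by rewrite dot_sym dot_coroot2'.
have mpos (b : K) : - (m a)%:R <= b -> b <= (m a)%:R -> b != (m a)%:R -> (0 < m a)%N.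
  by case: (m a) => // h1 h2 h3; case/eqP: h3; apply/eqP; rewrite eq_le h2; lra.
case: (orbit_cases tO aR) => [tE|tE|k0|k1].
- move: jn; rewrite tE c2 gtr0_sg// mul1r => jn.
  rewrite reflection_self//; apply: (NY_self aR az) => //; last first.
    by rewrite lt_neqAle eq_sym jn j1.
  by apply: (mpos (- j)); lra.
- move: jn; rewrite tE dotNl c2 ltr0_sg ?oppr_lt0// mulN1r opprK => jn.
  rewrite reflectionN reflection_self// opprK.
  have -> : j / 2 = - (- j / 2) by rewrite mulNr opprK.
  rewrite opprK; apply/esym; apply: (NY_self aR az); rewrite ?rpredN//; last first.
    by rewrite ltrN2 lt_neqAle jn j2 lerNl.
  exact: (mpos j).
- have [ta|ta] := eqVneq t a; first by move: k0; rewrite ta c2 => /eqP; rewrite pnatr_eq0.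
  have [tNa|tNa] := eqVneq t (- a).
    by move: k0; rewrite tNa dotNl c2 => /eqP; rewrite oppr_eq0 pnatr_eq0.
  by apply: NY_other => //; [apply: O_int|rewrite k0 sub0r normrN].
have [ta|ta] := eqVneq t a; first by exfalso; move: k1; rewrite ta c2; case; lra.
have [tNa|tNa] := eqVneq t (- a); first by exfalso; move: k1; rewrite tNa dotNl c2; case; lra.
apply: NY_other => //; first exact: O_int.
have mi : (m a)%:R \is a @Num.int K by apply: rpred_nat.
case: k1 jn => ->; rewrite ?sgrN sgr1 ?mul1r ?mulN1r ?opprK => jn;
  rewrite ler_norml.
  have : 1 <= j + (m a)%:R.
    by apply: int_gt0; rewrite ?rpredD// lt_neqAle eq_sym -subr_eq0 subr0 addr_eq0 jn /=; lra.
  by move=> h; apply/andP; split; lra.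
have : 1 <= (m a)%:R - j.
  by apply: int_gt0; rewrite ?rpredB// subr_gt0 lt_neqAle jn.
by move=> h; apply/andP; split; lra.
Qed.

Let c0 := cf s (vtx mk d).
(** [GG] is [B 0] times the difference of the two sides of the z-equation; [k1] is the constant term
    of the operator minus the eigenvalue. *)
Let k1 := \sum_(t <- O) (E (vtx mk d) (- qv t) - Q (2 * dc x (qv t))).
Let GG z := \sum_(t <- O) B t z * (Nf t z * Y t z) + k1 * (B 0 z * psum x s z).

Lemma GG_wall a z j : a \in R -> wall G Q a z -> j \is a Num.int -> `|j| <= (m a)%:R ->
  GG (z + qv ((j / 2) *: a)) + GG (z - qv ((j / 2) *: a)) = 0.
Proof.
move=> aR az ji jm; rewrite -qvecN -scaleNr; apply/eqP; rewrite addrC addr_eq0; apply/eqP.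
rewrite /GG opprD -sumrN; congr (_ + _).
  transitivity (\sum_(t <- O) - (B (rf a t) (z + qv ((j / 2) *: a)) *
     (Nf (rf a t) (z + qv ((j / 2) *: a)) * Y (rf a t) (z + qv ((j / 2) *: a))))).
    by rewrite big_seq [RHS]big_seq; apply: eq_bigr => t tO; apply: term_wall.
  rewrite -[LHS](big_map (rf a) xpredT (fun t => - (B t (z + qv ((j / 2) *: a)) *
     (Nf t (z + qv ((j / 2) *: a)) * Y t (z + qv ((j / 2) *: a)))))).
  apply: perm_big; apply: uniq_perm; rewrite ?(map_inj_uniq (inv_inj (reflectionK aR)))// => t.
  rewrite -[t in LHS](reflectionK aR) (mem_map (inv_inj (reflectionK aR))).
  by apply/idP/idP => [/O_refl/(_ aR)|/O_refl]; rewrite ?reflectionK//; apply.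
have r0 : rf a 0 = 0 by rewrite reflectionE dot0l scale0r subr0.
have := B_reflection aR az 0 (j / 2); rewrite r0 => ->.
rewrite mulNr mulrN; congr (- (_ * (_ * _))).
by rewrite scaleNr qvecN; apply/esym/fsym.
Qed.

Lemma B_expsum t : expsum G Q R d (vtx (fun=> 1)) (B t)
  (\prod_(b <- Rp) Q (- f (Num.sg (dt (cr b) t) * (m b)%:R))).
Proof.
have one_inv : kinv G R (fun=> 1 : K) by [].
have H : expsum G Q R d (fun e => \sum_(b <- Rp) half_vtx G b e) (B t)
    (\prod_(b <- Rp) Q (- f (Num.sg (dt (cr b) t) * (m b)%:R))).
  apply: (expsum_prod rd) => b bRp.
  have := expsum_br hG Q hR rd (- f (Num.sg (dt (cr b) t) * (m b)%:R)) (Rp_R bRp).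
  by move: bRp; rewrite (mem_Rp RpE) => /andP[_ ->].
apply: (expsum_eq rd H) => // e re; rewrite (vtx_Rp hG hR rd RpE _ one_inv) scaler_sumr.
apply: eq_bigr => b _; rewrite /half_vtx mulr1.
by move: (cr b) => w; rewrite !scalerA; congr (_ *: _); rewrite mulrC.
Qed.

Lemma s_expsum : expsum G Q R d (vtx mk) (ev s) c0.
Proof.
exists s; split=> // p ps a aR.
by rewrite rpredM ?rpred_nat ?sI.
Qed.

Let kt t := c0 * (Q (2 * dc x (qv t)) * E (vtx mk d) (qv t) - 1) *
  (if special t then Q (- f (Num.sg (dt t d) * (m t)%:R)) else 1).

(** The brackets [Kf t] and [Nf t] have the same segment as Newton polytope, so exchanging one for
    the other keeps the polytope and multiplies the vertex coefficient by the ratio of theirs. *)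
Lemma NY_expsum t : exists2 F, expsum G Q R d (vtx mk) F (kt t) &
  forall z, Nf t z * Y t z = Q (2 * dc x z) * F z.
Proof.
have diff : expsum G Q R d (vtx mk) (fun z => ev s (z + qv t) * Q (2 * dc x (qv t)) + ev s z * (-1))
    (c0 * (Q (2 * dc x (qv t)) * E (vtx mk d) (qv t) - 1)).
  have := expsumD (expsumZ (Q (2 * dc x (qv t))) (expsum_shift hG (qv t) s_expsum)) (expsumZ (-1) s_expsum).
  by congr expsum; ring.
have diffE z : psum x s (z + qv t) - psum x s z =
    Q (2 * dc x z) * (ev s (z + qv t) * Q (2 * dc x (qv t)) + ev s z * (-1)).
  by rewrite /qpsum dcDr// mulrDr qpD; ring.
rewrite /kt /Nf /Y; case: ifP => [/andP[tR mt]|_]; last first.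
  exists (fun z => ev s (z + qv t) * Q (2 * dc x (qv t)) + ev s z * (-1)); first by rewrite mulr1.
  by move=> z; rewrite mul1r diffE.
pose h := qv (2^-1 *: t).
have T : expsum G Q R d (fun e => vtx mk e - half_vtx G t e) (ev (tl t))
    (cf (tl t) (vtx mk d - half_vtx G t d)).
  by exists (tl t); split=> // [q|e q re]; [apply: (tlL tR mt)|apply: (tlH tR mt)].
have T1 := expsumZ (Q (2 * dc x h)) (expsum_shift hG h T).
set kT := (X in expsum _ _ _ _ _ _ X) in T1.
have K1 := expsum_br hG Q hR rd 1 tR.
have N1 := expsum_br hG Q hR rd (1 - (m t)%:R) tR.
have psumE z : psum x (tl t) (z + h) = Q (2 * dc x z) * (ev (tl t) (z + h) * Q (2 * dc x h)).
  by rewrite /qpsum dcDr// mulrDr qpD; ring.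
have KT : (if 0 < dt t d then Q 1 else - Q (- 1)) * kT =
    c0 * (Q (2 * dc x (qv t)) * E (vtx mk d) (qv t) - 1).
  have P1 : expsum G Q R d (vtx mk)
      (fun z => br (X t z + 1) * (ev (tl t) (z + h) * Q (2 * dc x h)))
      ((if 0 < dt t d then Q 1 else - Q (- 1)) * kT).
    by apply: (expsum_eq rd (expsumM rd K1 T1)) => // e _; rewrite addrC subrK.
  apply: (expsum_top hG P1 diff) => z; apply: (mulfI (qp_neq0 Q (2 * dc x z))).
  rewrite -diffE -quotientE /Kf /Y /special tR mt /= mulrCA; congr (_ * _).
  by rewrite -/h psumE.
exists (fun z => br (X t z + (1 - (m t)%:R)) * (ev (tl t) (z + h) * Q (2 * dc x h))).
  have := expsumM rd N1 T1 => P2; rewrite -KT.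
  have kE : (if 0 < dt t d then Q (1 - (m t)%:R) else - Q (- (1 - (m t)%:R))) * kT =
     (if 0 < dt t d then Q 1 else - Q (-1)) * kT * Q (- f (Num.sg (dt t d) * (m t)%:R)).
    have := rd tR; case: (ltrgtP (dt t d) 0) => // td _.
      by rewrite (ltr0_sg td) mulN1r rmorphN opprK rmorph_nat opprB qpD; ring.
    by rewrite (gtr0_sg td) mul1r rmorph_nat qpD; ring.
  by rewrite -kE; apply: (expsum_eq rd P2) => // e _; rewrite addrC subrK.
by move=> z; rewrite -/h psumE mulrCA addrA; congr (_ * (br _ * _)); rewrite addrAC.
Qed.

(** The pairings $(b^\vee,t)$ are $0$ or $\pm1$, hence equal to their signs, except at $b=\pm t$
    where they are $\pm2$; there the extra factor supplies the missing half. *)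
Lemma top_coefficient t : t \in O ->
  \prod_(b <- Rp) Q (- f (Num.sg (dt (cr b) t) * (m b)%:R)) *
  (if special t then Q (- f (Num.sg (dt t d) * (m t)%:R)) else 1) = E (vtx mk d) (- qv t).
Proof.
move=> tO.
have -> : E (vtx mk d) (- qv t) = \prod_(b <- Rp) Q (- f (dt (cr b) t * (m b)%:R)).
  rewrite /qexp dcNr// dc_real mulrN -(rmorph_nat f) -rmorphM -qp_sum sumrN; congr (Q (- _)).
  rewrite -rmorph_sum; congr (f _); rewrite (vtx_Rp hG hR rd RpE _ mkinv) dotZl mulrA divff ?pnatr_eq0//.
  rewrite mul1r dot_suml; apply: eq_big_seq => b; rewrite (mem_Rp RpE) => /andP[_ bd].
  by rewrite (gtr0_sg bd) mul1r dotZl mulrC.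
have small b : b \in Rp -> b != t -> b != - t -> Num.sg (dt (cr b) t) = dt (cr b) t.
  move=> /Rp_R bR bt bNt; rewrite dot_sym; case: (orbit_cases tO bR) => [tE|tE|->|[]->].
  - by rewrite tE eqxx in bt.
  - by rewrite tE opprK eqxx in bNt.
  - by rewrite sgr0.
  - by rewrite sgr1.
  - by rewrite sgrN sgr1.
have [tR|tNR] := boolP (t \in R); last first.
  rewrite /special (negPf tNR) mulr1; apply: eq_big_seq => b bRp; rewrite small//.
    by apply: contraNneq tNR => <-; apply: Rp_R.
  by apply: contraNneq tNR => bE; rewrite -[t]opprK -bE rootNE// Rp_R.
have -> : (if special t then Q (- f (Num.sg (dt t d) * (m t)%:R)) else 1) =
    Q (- f (Num.sg (dt t d) * (m t)%:R)).
  by rewrite /special tR; case: (m t) => //=; rewrite mulr0 rmorph0 oppr0 qp0.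
have [b0 b0p bE] : exists2 b0, b0 \in Rp & b0 = t \/ b0 = - t.
  by case: (Rp_or hG hR rd RpE tR) => ?; [exists t|exists (- t)]; auto.
rewrite (big_rem b0)//= [in RHS](big_rem b0)//= mulrAC; congr (_ * _); last first.
  apply: eq_big_seq => b; rewrite mem_rem_uniq ?fset_uniq// inE => /andP[bb0 bRp].
  have bNb0 : b != - b0 by apply: contraTneq bRp => ->; apply: (Rp_N RpE b0p).
  rewrite small//; first by case: bE bb0 bNb0 => ->; rewrite ?opprK.
  by case: bE bb0 bNb0 => ->; rewrite ?opprK.
rewrite -qpD; congr (Q _); rewrite -opprD -rmorphD; congr (- f _).
have b0d : 0 < dt b0 d by move: b0p; rewrite (mem_Rp RpE) => /andP[].
have [m0 -> E0] : [/\ m b0 = m t, Num.sg (dt t d) = Num.sg (dt (cr b0) t) & dt (cr b0) t = 2 * Num.sg (dt (cr b0) t)].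
  case: bE b0d => ->.
    by move=> td; rewrite dot_coroot2'// !gtr0_sg// mulr1.
  rewrite dotNl oppr_gt0 => td; rewrite mN// corootN// dotNl dot_coroot2'// !ltr0_sg// ?oppr_lt0//.
  by rewrite mulrN1.
by rewrite [in RHS]E0 m0; move: (Num.sg _) => r; ring.
Qed.

(** Skewness for the shifts $0,\dots,m_a$ gives strings of length $m_a+1$, and the Newton polytope
    is the zonotope with multiplicities $m_a+1$. The value of [k1] makes the vertex coefficient
    zero, so [expsum_eq0] applies. *)
Lemma GG_eq0 z : GG z = 0.
Proof.
have [F FP] := boolp.choice (fun t => let: ex_intro2 F h1 h2 := NY_expsum t in
  ex_intro (fun F => expsum G Q R d (vtx mk) F (kt t) /\
    forall z, Nf t z * Y t z = Q (2 * dc x z) * F z) F (conj h1 h2)).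
pose F' z := \sum_(t <- O) B t z * F t z + B 0 z * ev s z * k1.
have GE y : GG y = Q (2 * dc x y) * F' y.
  rewrite /GG /F' mulrDr mulr_sumr; congr (_ + _); last by rewrite /qpsum; ring.
  by apply: eq_bigr => t _; have [_ ->] := FP t; ring.
have [Onil|On] := eqVneq O [::].
  by rewrite GE /F' /k1 Onil !big_nil mulr0 addr0 mulr0.
suff F0 y : F' y = 0 by rewrite GE F0 mulr0.
pose k b : K := (m b).+1%:R.
have kk : kinv G R k by move=> a b aR bR; rewrite /k hm.
have vtxD e : vtx (fun=> 1) e + vtx mk e = vtx k e.
  rewrite /vertex -scalerDr -big_split; congr (_ *: _); apply: eq_bigr => b _ /=.
  by rewrite -scalerDl -mulrDr /k -natr1 addrC.
have e1 : expsum G Q R d (fun e => vtx (fun=> 1) e + vtx mk e) F' 0.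
  have := expsumD (expsum_sum rd On (fun t _ => expsumM rd (B_expsum t) (FP t).1))
    (expsumZ k1 (expsumM rd (B_expsum 0) s_expsum)).
  congr expsum; have -> : \prod_(b <- Rp) Q (- f (Num.sg (dt (cr b) 0) * (m b)%:R)) = 1.
    by rewrite big1// => b _; rewrite dot0r sgr0 mul0r rmorph0 oppr0 qp0.
  rewrite mul1r /k1 mulr_sumr -big_split big_seq big1//= => t tO.
  rewrite /kt mulrCA top_coefficient// qexpNr//.
  have := qexp_neq0 G Q (vtx mk d) (qv t).
  by move: (E _ _) (Q _) => A A' A0; field.
have e2 : expsum G Q R d (vtx k) F' 0 by apply: (expsum_eq rd e1).
apply: (expsum_eq0 hG hR rd kk e2) => u uE ul; apply: (sym_strings hG hR gx ul) => a i y' aR im aw.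
have GP y1 : psum x u y1 = GG y1 by rewrite GE uE.
rewrite !GP; apply: (GG_wall aR aw); first exact: rpred_nat.
by rewrite normr_nat ler_nat.
Qed.

Definition zcoef t z := (\prod_(a <- R | 0 < dt (cr a) t) (br (X a z - (m a)%:R) / br (X a z))) *
  \prod_(a <- R | dt (cr a) t == 2) (br (X a z - (m a)%:R + 1) / br (X a z + 1)).

Lemma orbit_two t b : t \in O -> b \in R -> dt (cr b) t = 2 -> t = b.
Proof.
move=> tO bR; rewrite dot_sym; case: (orbit_cases tO bR) => [//|->|->|[]->].
- by rewrite dotNl dot_sym dot_coroot2'// => h; exfalso; lra.
- by move=> h; exfalso; lra.
- by move=> h; exfalso; lra.
- by move=> h; exfalso; lra.
Qed.

Lemma zcoef_quotient t z : t \in O -> (forall b, b \in R -> br (X b z) != 0) ->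
  (t \in R -> br (X t z + 1) != 0) ->
  zcoef t z * (psum x s (z + qv t) - psum x s z) = B t z * (Nf t z * Y t z) / B 0 z.
Proof.
move=> tO X0 K0; rewrite -quotientE.
have E1 : \prod_(a <- R | 0 < dt (cr a) t) (br (X a z - (m a)%:R) / br (X a z)) = B t z / B 0 z.
  rewrite /B -prodf_div big_mkcond (big_Rp hG hR rd RpE) /=.
  apply: eq_big_seq => b /Rp_R bR /=; have bX := X0 b bR.
  rewrite mN// XN// corootN// dotNl oppr_gt0 dot0r sgr0 mul0r rmorph0 subr0.
  have [k0|k0|k0] := ltrgtP (dt (cr b) t) 0.
  - by rewrite (ltr0_sg k0) mul1r mulN1r rmorphN opprK rmorph_nat -opprD !brN invrN mulrNN.
  - by rewrite (gtr0_sg k0) mulr1 mul1r rmorph_nat.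
  - by rewrite k0 sgr0 mul0r rmorph0 subr0 mulr1 divff.
have [tR|tNR] := boolP (t \in R); last first.
  rewrite /zcoef E1 [Z in _ * Z * _]big1_seq.
    by rewrite /Kf /Nf /special (negPf tNR) !mul1r mulr1 mulrAC.
  by move=> b /andP[/eqP b2 bR]; move: tNR; rewrite (orbit_two tO bR b2) bR.
have E2 : \prod_(a <- R | dt (cr a) t == 2) (br (X a z - (m a)%:R + 1) / br (X a z + 1)) =
    br (X t z - (m t)%:R + 1) / br (X t z + 1).
  rewrite big_seq_cond (eq_bigl (pred1 t)) => [|b].
    by rewrite -big_filter filter_pred1_uniq ?fset_uniq// big_seq1.
  apply/andP/eqP => [[bR /eqP b2]|->]; last by rewrite dot_coroot2'.
  exact/esym/(orbit_two tO bR b2).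
rewrite /zcoef E1 E2 /Kf /Nf /special tR /=; have K1 := K0 tR.
have [m0|m0] := posnP (m t).
  by rewrite m0 subr0 divff// !mul1r mulr1 mulrAC.
by have := K1; move: (br (X t z + 1)) (B 0 z)^-1 => k b k0; field.
Qed.

Lemma z_operator z : (forall b, b \in R -> br (X b z) != 0) ->
  (forall t, t \in O -> t \in R -> br (X t z + 1) != 0) ->
  \sum_(t <- O) zcoef t z * (psum x s (z + qv t) - psum x s z) +
  (\sum_(t <- O) E (vtx mk d) (- qv t)) * psum x s z =
  (\sum_(t <- O) Q (2 * dc x (qv t))) * psum x s z.
Proof.
move=> X0 K0; have B00 : B 0 z != 0.
  rewrite prodf_seq_neq0; apply/allP => b /Rp_R bR /=.
  by rewrite dot0r sgr0 mul0r rmorph0 subr0 X0.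
apply/eqP; rewrite -subr_eq0 -addrA -mulrBl -sumrB -/k1.
have := GG_eq0 z; rewrite /GG => /(congr1 (fun y => y / B 0 z)); rewrite mul0r mulrDl => E1.
apply/eqP; rewrite -[RHS]E1; congr (_ + _); last by field.
rewrite mulr_suml big_seq [RHS]big_seq; apply: eq_bigr => t tO.
by apply: zcoef_quotient => //; apply: K0.
Qed.
End Quotients.

Lemma z_operator_eigen (O : seq V) z : uniq O ->
  (forall t a, t \in O -> a \in R -> rf a t \in O) ->
  (forall t a, t \in O -> a \in R -> dt t (cr a) \is a Num.int) ->
  (forall t a, t \in O -> a \in R -> dt t (cr a) <= 1 \/ t = a) ->
  (forall b, b \in R -> br (X b z) != 0) ->
  (forall t, t \in O -> t \in R -> br (X t z + 1) != 0) ->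
  \sum_(t <- O) zcoef t z * (psum x s (z + qv t) - psum x s z) +
  (\sum_(t <- O) E (vtx mk d) (- qv t)) * psum x s z =
  (\sum_(t <- O) Q (2 * dc x (qv t))) * psum x s z.
Proof.
move=> uO Or Oi Os X0 K0.
have ex a : exists t : seq (C * V), a \in R -> (0 < m a)%N ->
    [/\ forall y, psum x s (y + qv (2^-1 *: a)) - psum x s (y - qv (2^-1 *: a)) =
          br (X a y) * psum x t y,
        forall q, q \in t -> lat G R q.2 &
        forall e q, regular G R e -> q \in t ->
        dt q.2 e <= dt (vtx mk e - half_vtx G a e) e /\
        (dt q.2 e = dt (vtx mk e - half_vtx G a e) e -> q.2 = vtx mk e - half_vtx G a e)].
  have [aR|/negP aR] := boolP (a \in R); last by exists [::].
  have [m0|m0] := posnP (m a); first by exists [::].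
  by have [t Ht] := quotient_exists aR m0; exists t.
have [tl Htl] := boolp.choice ex.
apply: (@z_operator tl) => //.
- by move=> a y aR ma; have [-> _ _] := Htl a aR ma.
- by move=> a q aR ma qt; have [_ h _] := Htl a aR ma; apply: h.
- by move=> a e q aR ma re qt; have [_ _ h] := Htl a aR ma; apply: h.
Qed.
End ZOperator.

(** * Passage from generic points to all regular points by continuity *)

Section Rays.
Local Open Scope classical_set_scope.
Context {K : realType} {C : numClosedFieldType} {n : nat}.
Local Notation V := 'rV[K]_n.
Local Notation VC := 'rV[C]_n.
Variables (G : 'M[K]_n) (hG : euclidean G) (Q : qchar K C) (R : {fset V}).
Hypothesis hR : reduced_irreducible_root_system G R.
Local Notation dt := (dot G).
Local Notation cr := (coroot G).
Local Notation rf := (reflection G).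
Local Notation f := (qemb Q).
Local Notation dc := (qdot G Q).
Local Notation qv := (qvec Q).
Local Notation E := (qexp G Q).
Local Notation psum := (qpsum G Q).
Local Notation br := (qbr Q).
Local Notation vtx := (vertex G R).

(** Continuity at parameter 0 along a real ray, enough to carry an identity from nearby points of
    the ray to its origin. *)
Definition cont0 (g : K -> C) := {for 0, continuous (g : K -> C^o)}.

Hypothesis f_cont : cont0 f.
Hypothesis Q_cont : forall w, cont0 (fun s => Q (f s * w)).
Hypothesis Q_small : forall w, w != 0 ->
  exists2 e : K, 0 < e & forall s, `|s| < e -> Q (f s * w) = 1 -> s = 0.

Lemma cont0_cst w : cont0 (fun=> w).
Proof. exact: cst_continuous. Qed.

Lemma cont0D g h : cont0 g -> cont0 h -> cont0 (fun s => g s + h s).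
Proof. by move=> gc hc; apply: cvgD. Qed.

Lemma cont0N g : cont0 g -> cont0 (fun s => - g s).
Proof. by move=> gc; apply: cvgN. Qed.

Lemma cont0M g h : cont0 g -> cont0 h -> cont0 (fun s => g s * h s).
Proof. by move=> gc hc; apply: (@cvgM _ _ _ _ (g : K -> C) (h : K -> C)). Qed.

Lemma cont0V g : g 0 != 0 -> cont0 g -> cont0 (fun s => (g s)^-1).
Proof. by move=> g0 gc; apply: (@cvgV _ _ _ _ (g : K -> C)). Qed.

Lemma cont0_sum (I : Type) (r : seq I) (g : I -> K -> C) :
  (forall i, cont0 (g i)) -> cont0 (fun s => \sum_(i <- r) g i s).
Proof.
move=> H; elim: r => [|i r IH].
  rewrite (_ : (fun s => _) = fun=> 0); first exact: cont0_cst.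
  by apply/funext => s; rewrite big_nil.
rewrite (_ : (fun s => _) = fun s => g i s + \sum_(j <- r) g j s); first exact: cont0D.
by apply/funext => s; rewrite big_cons.
Qed.

Lemma cont0_prod (I : eqType) (r : seq I) (P : pred I) (g : I -> K -> C) :
  (forall i, i \in r -> P i -> cont0 (g i)) -> cont0 (fun s => \prod_(i <- r | P i) g i s).
Proof.
elim: r => [|i r IH] H.
  rewrite (_ : (fun s => _) = fun=> 1); first exact: cont0_cst.
  by apply/funext => s; rewrite big_nil.
have IH' : cont0 (fun s => \prod_(j <- r | P j) g j s).
  by apply: IH => j jr; apply: H; rewrite inE jr orbT.
have [Pi|Pi] := boolP (P i); last first.
  by rewrite (_ : (fun s => _) = fun s => \prod_(j <- r | P j) g j s)//; apply/funext => s; rewrite big_cons (negPf Pi).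
rewrite (_ : (fun s => _) = fun s => g i s * \prod_(j <- r | P j) g j s).
  by apply: cont0M => //; apply: H; rewrite ?mem_head.
by apply/funext => s; rewrite big_cons Pi.
Qed.

Lemma cont0_horner (D : {poly C}) g : cont0 g -> cont0 (fun s => D.[g s]).
Proof.
move=> gc; elim/poly_ind: D => [|D c IH].
  rewrite (_ : (fun s => _) = fun=> 0); first exact: cont0_cst.
  by apply/funext => s; rewrite horner0.
rewrite (_ : (fun s => _) = fun s => D.[g s] * g s + c).
  by apply: cont0D; [apply: cont0M|apply: cont0_cst].
by apply/funext => s; rewrite hornerMXaddC.
Qed.

Lemma cont0_eq0 g : cont0 g -> (forall e, 0 < e -> exists s, [/\ 0 < s, s < e & g s = 0]) -> g 0 = 0.
Proof.
move=> gc H; apply/eqP; apply: contraT => g0.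
have /nbhs_ballP[e /= e0 He] : \forall s \near (0 : K), g s != 0.
  exact: (@cvgr_neq0 _ C^o _ _ _ _ _ gc g0).
have [s [s0 se gs]] := H e e0.
suff : g s != 0 by rewrite gs eqxx.
by apply: He; rewrite /ball /= sub0r normrN gtr0_norm.
Qed.

Lemma Q_cont_affine y w : cont0 (fun s => Q (y + f s * w)).
Proof.
rewrite (_ : (fun s => _) = fun s => Q y * Q (f s * w)).
  by apply: cont0M; [apply: cont0_cst|apply: Q_cont].
by apply/funext => s; rewrite qpD.
Qed.

Lemma br_cont_affine y w : cont0 (fun s => br (y + f s * w)).
Proof.
rewrite (_ : (fun s => _) = fun s => Q (y + f s * w) - Q (- y + f s * (- w))).
  by apply: cont0D; [|apply: cont0N]; apply: Q_cont_affine.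
by apply/funext => s; rewrite /qbr opprD mulrN.
Qed.

Lemma ray_cont (c : VC -> C) x v : continuous (c : 'rV[C^o]_n -> C^o) ->
  cont0 (fun s => c (x + f s *: v)).
Proof.
move=> cc; apply: (@continuous_comp K 'rV[C^o]_n C^o (fun s => x + f s *: v : 'rV[C^o]_n) c 0).
  apply: (@cvgD _ 'rV[C^o]_n); first exact: (@cvg_cst 'rV[C^o]_n).
  exact: (@cvgZr_tmp C 'rV[C^o]_n).
exact: cc.
Qed.

(** A countable set has Lebesgue measure zero, an interval of positive length has not. *)
Lemma positive_avoid (A : set K) e : 0 < e -> countable A ->
  exists s, [/\ 0 < s, s < e & ~ A s].
Proof.
move=> e0 cA; apply: contrapT => H.
have /countable_lebesgue_measure0 : countable (`]0, e[ : set K).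
  apply: sub_countable cA; apply: subset_card_le => s /= se.
  apply: contrapT => As; apply: H; exists s.
  by move: se; rewrite in_itv /= => /andP[].
rewrite lebesgue_measure_itv /= lte_fin e0 -EFinD subr0 => -[e1].
by move: e0; rewrite e1 ltxx.
Qed.

Lemma countable_subsingleton (A : set K) : (forall s s', A s -> A s' -> s = s') -> countable A.
Proof.
move=> H; have [[s As]|nA] := pselect (exists s, A s).
  by rewrite (_ : A = [set s]); [exact: countable1|rewrite eqEsubset; split=> [s' As'|_ ->]//=; apply: H].
by rewrite (_ : A = set0)//; rewrite eqEsubset; split=> // s As; apply: nA; exists s.
Qed.

Lemma small_list (I : eqType) (l : seq I) (w : I -> C) : (forall i, i \in l -> w i != 0) ->
  exists2 e : K, 0 < e & forall s i, i \in l -> `|s| < e -> Q (f s * w i) = 1 -> s = 0.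
Proof.
elim: l => [|i l IH] H; first by exists 1.
have [|e e0 He] := IH; first by move=> j jl; apply: H; rewrite inE jl orbT.
have [e' e0' He'] := Q_small (H i (mem_head _ _)).
exists (Num.min e e'); first by rewrite lt_min e0.
by move=> s j; rewrite lt_min inE => /orP[/eqP->|jl] /andP[h1 h2]; [apply: He'|apply: He].
Qed.

(** [Q] is injective on short real segments, so on a short interval each bad condition, one for
    every root and integer and one for every zero of [D], holds for at most one [s]. The bad set is
    countable. *)
Lemma dense_gen x v (D : {poly C}) T0 e : (forall a, a \in R -> dt v a != 0) ->
  D != 0 -> T0 != 0 -> 0 < e ->
  exists s, [/\ 0 < s, s < e, gen G Q R (x + f s *: qv v) & D.[T0 * Q (f s)] != 0].
Proof.
move=> v0 D0 T00 e0.
have w0 a : a \in enum_fset R -> 4 * f (dt v a) != 0.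
  by move=> aR; rewrite mulf_neq0 ?fmorph_eq0 ?v0// (nat_neq0 Q 3).
have [e1 e10 He1] := small_list w0.
have [e2 e20 He2] := Q_small (oner_neq0 C).
have [r rE] := closed_field_poly_normal D.
pose A1 (a : V) (k : int) := [set s : K | Q (4 * dc (x + f s *: qv v) (qv a)) = Q (f k%:~R)].
pose A2 (T : C) := [set s : K | T0 * Q (f s) = T].
pose e3 := Num.min e (Num.min e1 e2).
have e30 : 0 < e3 by rewrite !lt_min e0 e10.
pose I := `]0, e3[%classic : set K.
have near_I (s s' : K) : I s -> I s' -> `|s - s'| < e1 /\ `|s - s'| < e2.
  rewrite /I /= !in_itv /= => /andP[s0 s3] /andP[s0' s3'].
  have : `|s - s'| < e3 by rewrite ltr_norml; apply/andP; split; lra.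
  by rewrite !lt_min => /and3P[].
pose A := (\bigcup_(a in [set` R]) \bigcup_(k in [set: int]) (A1 a k `&` I)) `|`
  (\bigcup_(T in [set` r]) (A2 T `&` I)).
have Ac : countable A.
  rewrite /A -bigcup2E; apply: bigcup_countable => // -[|[|i]] _ //=.
    apply: bigcup_countable => [|a /= aR]; first exact: finite_set_countable.
    apply: bigcup_countable => // k _; apply: countable_subsingleton => s s' [h1 i1] [h2 i2].
    have [d1 _] := near_I s s' i1 i2; apply/eqP; rewrite -subr_eq0; apply/eqP.
    apply: (He1 _ a aR d1); move: h1; rewrite /A1 /= -h2 !dcDl !dcZl dc_real !mulrDr !qpD.
    move=> /(mulfI (qp_neq0 _ _)) h; rewrite rmorphB mulrBl qpB ![f _ * (4 * _)]mulrCA h.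
    by rewrite divff ?qp_neq0.
  apply: bigcup_countable => [|T _]; first by apply: finite_set_countable; apply: finite_seq.
  apply: countable_subsingleton => s s' [h1 i1] [h2 i2].
  have [_ d2] := near_I s s' i1 i2; apply/eqP; rewrite -subr_eq0; apply/eqP.
  apply: (He2 _ d2); move: h1; rewrite /A2 /= -h2 => /(mulfI T00) h.
  by rewrite mulr1 rmorphB qpB h divff ?qp_neq0.
have [s [s0 s3 As]] := positive_avoid e30 Ac.
have Is : I s by rewrite /I /= in_itv /= s0.
have se : s < e by move: s3; rewrite lt_min => /andP[].
exists s; split=> //.
  move=> a _ aR /intrP[k ->]; apply/eqP => h; apply: As; left; exists a => //.
  by exists k => //; split.
apply/eqP => DT; apply: As; right; exists (T0 * Q (f s)); last by split.
move: DT; rewrite /= rE hornerZ horner_prod => /eqP.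
rewrite mulf_eq0 lead_coef_eq0 (negPf D0) /= prodf_seq_eq0 => /hasP[T Tr /=].
by rewrite hornerXsubC subr_eq0 => /eqP ->.
Qed.

Variables (d : V) (Rp : {fset V}).
Hypothesis rd : regular G R d.
Hypothesis RpE : Rp = [fset a in R | 0 < dt a d]%fset.
Variable m : V -> nat.
Hypothesis hm : forall a b, a \in R -> b \in R -> m (rf a b) = m b.
Local Notation mk := (fun a => (m a)%:R : K).
Variables (S0 : seq V) (c : V -> VC -> C).
Hypothesis uS0 : uniq S0.
Hypothesis S0P : forall v, v \in S0 -> polytope G R m v.
Hypothesis S0I : forall v a, v \in S0 -> a \in R -> dt v a \is a Num.int.
Hypothesis S0v : forall e, regular G R e -> vtx mk e \in S0.
Hypothesis c_cont : forall v, v \in S0 -> continuous (c v : 'rV[C^o]_n -> C^o).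
Hypothesis Q_surj : forall w : C, w != 0 -> exists t, Q t = w.
Local Notation psi x z := (psum x (psi_seq S0 c x) z).
Hypothesis hQI : forall x a i z, a \in R -> (1 <= i <= m a)%N -> wall G Q a z ->
  psi x (z + qv ((i%:R / 2) *: a)) = psi x (z - qv ((i%:R / 2) *: a)).
Hypothesis htop : forall x, c (vtx mk d) x = vcoef G Q R m d x.
Let rt : V := vtx (kroot G m) d.

Lemma psi_cont x v z : cont0 (fun s => psi (x + f s *: qv v) z).
Proof.
rewrite (_ : (fun s => _) = fun s => Q (2 * dc x z + f s * (2 * dc (qv v) z)) *
    \sum_(u <- S0) (if u \in S0 then c u (x + f s *: qv v) * E u z else 0)).
  apply: cont0M; first exact: Q_cont_affine.
  apply: cont0_sum => u; case: (boolP (u \in S0)) => uS; last exact: cont0_cst.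
  by apply: cont0M; [apply: ray_cont; apply: c_cont|apply: cont0_cst].
apply/funext => s; rewrite /qpsum /qev big_map dcDl dcZl mulrDr [2 * (f s * _)]mulrCA.
by congr (_ * _); apply: eq_big_seq => u ->.
Qed.

(** Every [x] is taken as the origin of a line in the direction of the sum of the positive coroots;
    density and continuity provide the hypotheses of [F_const], which is used at $t=0$. *)
Lemma psi_const : exists2 k, k != 0 & forall x, psi x (qv rt) = k.
Proof.
pose w := \sum_(b <- Rp) cr b.
have w0 a : a \in R -> dt w a != 0.
  move=> aR; rewrite (dot_sym hG).
  case: (Rp_or hG hR rd RpE aR) => /(wt_gt0 hG hR rd RpE)[_ h]; first by rewrite gt_eqF.
  by move: h; rewrite dotNl oppr_gt0 => h; rewrite lt_eqF.
have step x t s : x + (t + f s) *: qv w = x + t *: qv w + f s *: qv w.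
  by rewrite scalerDl addrA.
have dense (D : {poly C}) : D != 0 -> forall x t e, 0 < e -> exists s,
    [/\ 0 < s, s < e, gen G Q R (x + (t + f s) *: qv w) & D.[Q (t + f s)] != 0].
  move=> D0 x t e e0.
  have [s [s0 se gs Ds]] := dense_gen (x + t *: qv w) w0 D0 (qp_neq0 Q t) e0.
  by exists s; split; rewrite ?step// qpD.
have Hd x (D : {poly C}) : D != 0 -> exists2 t, gen G Q R (x + t *: qv w) & D.[Q t] != 0.
  by move=> D0; have [s [_ _ gs Ds]] := dense D D0 x 0 1 ltr01; exists (0 + f s).
have He x (A B D : {poly C}) : D != 0 ->
    (forall t, gen G Q R (x + t *: qv w) -> D.[Q t] != 0 ->
       psi (x + t *: qv w) (qv rt) * A.[Q t] = B.[Q t]) ->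
    forall t, psi (x + t *: qv w) (qv rt) * A.[Q t] = B.[Q t].
  move=> D0 H t.
  pose g s := psi (x + t *: qv w + f s *: qv w) (qv rt) * A.[Q (t + f s)] - B.[Q (t + f s)].
  have Qc : cont0 (fun s => Q (t + f s)).
    rewrite (_ : (fun s => _) = fun s => Q (t + f s * 1)); first exact: Q_cont_affine.
    by apply/funext => s; rewrite mulr1.
  have gc : cont0 g.
    apply: cont0D; last by apply: cont0N; apply: cont0_horner.
    by apply: cont0M; [apply: psi_cont|apply: cont0_horner].
  have : g 0 = 0.
    apply: (cont0_eq0 gc) => e e0; have [s [s0 se gs Ds]] := dense D D0 x t e e0.
    by exists s; split=> //; rewrite /g -step H// subrr.
  by rewrite /g rmorph0 scale0r !addr0 => /eqP; rewrite subr_eq0 => /eqP.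
have [k k0 kE] : exists2 k, k != 0 & forall x, psi (x + 0 *: qv w) (qv rt) = k.
  eexists; first exact: (@kappa_neq0 _ _ _ _ hG Q _ hR _ _ rd RpE _ hm).
  move=> x; exact: (@F_const _ _ _ _ hG Q _ hR _ _ rd RpE _ hm _ _ uS0 S0P S0I S0v hQI htop
    Q_surj x (Hd x) (He x) 0).
by exists k => // x; rewrite -(kE x) scale0r addr0.
Qed.

Lemma gen_near x e : 0 < e -> exists s, [/\ 0 < s, s < e & gen G Q R (x + f s *: qv d)].
Proof.
have d0 a : a \in R -> dt d a != 0 by move=> aR; rewrite (dot_sym hG) rd.
move=> e0; have [s [s0 se gs _]] := dense_gen x d0 (oner_neq0 _) (oner_neq0 _) e0.
by exists s.
Qed.

Lemma br_ray_cont x a u : cont0 (fun s => br (dc (qv a) (x + f s *: qv d) + u)).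
Proof.
rewrite (_ : (fun s => _) = fun s => br (dc (qv a) x + u + f s * f (dt a d))).
  exact: br_cont_affine.
by apply/funext => s; rewrite (dcDr hG) (dcZr hG) dc_real addrAC.
Qed.

(** Generic points accumulate at [x] along direction [d], and all terms are continuous at [x] since
    the denominators do not vanish there. *)
Theorem x_operator_identity (O : seq V) x z : uniq O ->
  (forall t a, t \in O -> a \in R -> rf a t \in O) ->
  (forall t a, t \in O -> a \in R -> dt t a \is a Num.int) ->
  (forall t u, t \in O -> u \in O -> dt t t = dt u u) ->
  (forall t a, t \in O -> a \in R -> dt t a <= 1 \/ t = cr a) ->
  (forall t a, t \in O -> a \in R -> dt t a <= 1) \/ (forall t, t \in O -> inQ G R t) ->
  (forall t, t \in O -> t != 0) ->
  (forall t a, t \in O -> a \in R -> 0 < dt a t -> br (dc (qv a) x) != 0) ->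
  (forall t a, t \in O -> a \in R -> dt a t = 2 -> br (dc (qv a) x + 1) != 0) ->
  \sum_(t <- O) xcoef G Q R m t x * (psi (x + qv t) z - psi x z) +
    (\sum_(t <- O) E t (qv rt)) * psi x z = (\sum_(t <- O) E t z) * psi x z.
Proof.
move=> uO O1 O2 O3 O4 O5 O6 x1 x2; have [k k0 kE] := psi_const.
pose X s := x + f s *: qv d.
pose g s := \sum_(t <- O) (if t \in O then xcoef G Q R m t (X s) *
      (psi (x + qv t + f s *: qv d) z - psi (X s) z) else 0) +
    (\sum_(t <- O) E t (qv rt)) * psi (X s) z - (\sum_(t <- O) E t z) * psi (X s) z.
have X0 : X 0 = x by rewrite /X rmorph0 scale0r addr0.
have gE s : g s = \sum_(t <- O) xcoef G Q R m t (X s) * (psi (X s + qv t) z - psi (X s) z) +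
    (\sum_(t <- O) E t (qv rt)) * psi (X s) z - (\sum_(t <- O) E t z) * psi (X s) z.
  congr (_ + _ - _); apply: eq_big_seq => t ->; by rewrite /X [x + qv t + _]addrAC.
apply/eqP; rewrite -subr_eq0; apply/eqP.
have := gE 0; rewrite X0 => <-; apply: cont0_eq0; last first.
  move=> e e0; have [s [s0 se gs]] := gen_near x e0; exists s; split=> //.
  apply/eqP; rewrite gE subr_eq0; apply/eqP; apply: (x_operator_normalized k0 kE).
  exact: (x_operator_eigen hG hR rd hm uS0 S0P S0I S0v hQI htop uO O1 O2 O3 O4 O5 O6 gs).
have psic y : cont0 (fun s => psi (y + f s *: qv d) z) by apply: psi_cont.
have mulc w y : cont0 (fun s => w * psi (y + f s *: qv d) z).
  by apply: cont0M => //; apply: cont0_cst.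
apply: cont0D; last by apply: cont0N; apply: mulc.
apply: cont0D; last exact: mulc.
apply: cont0_sum => t; case: (boolP (t \in O)) => tO; last exact: cont0_cst.
apply: cont0M; last by apply: cont0D; [apply: psic|apply: cont0N; apply: psic].
have brc a u : cont0 (fun s => br (dc (qv a) (X s) + u)) by apply: br_ray_cont.
have brc0 a : cont0 (fun s => br (dc (qv a) (X s))).
  rewrite (_ : (fun s => _) = fun s => br (dc (qv a) (X s) + 0)); first exact: brc.
  by apply/funext => s; rewrite addr0.
rewrite /xcoef; apply: cont0M; apply: cont0_prod => a aR ta.
  apply: cont0M; first exact: brc.
  by apply: cont0V => //; rewrite X0; apply: x1 ta.
apply: cont0M.
  rewrite (_ : (fun s => _) = fun s => br (dc (qv a) (X s) + (- (m a)%:R + 1))); first exact: brc.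
  by apply/funext => s; rewrite addrA.
by apply: cont0V => //; rewrite X0; apply: (x2 t a) => //; apply/eqP.
Qed.

(** Only [x] has to be moved to a generic position; [z] stays fixed, so the coefficients of the
    operator are constants along the ray. *)
Theorem z_operator_identity (O : seq V) x z : uniq O ->
  (forall t a, t \in O -> a \in R -> rf a t \in O) ->
  (forall t a, t \in O -> a \in R -> dt t (cr a) \is a Num.int) ->
  (forall t a, t \in O -> a \in R -> dt t (cr a) <= 1 \/ t = a) ->
  (forall b, b \in R -> br (dc (qv (cr b)) z) != 0) ->
  (forall t, t \in O -> t \in R -> br (dc (qv (cr t)) z + 1) != 0) ->
  \sum_(t <- O) zcoef G Q R m t z * (psi x (z + qv t) - psi x z) +
  (\sum_(t <- O) E (vtx mk d) (- qv t)) * psi x z =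
  (\sum_(t <- O) Q (2 * dc x (qv t))) * psi x z.
Proof.
move=> uO O1 O2 O3 z1 z2.
pose X s := x + f s *: qv d.
pose g s := \sum_(t <- O) zcoef G Q R m t z * (psi (X s) (z + qv t) - psi (X s) z) +
  (\sum_(t <- O) E (vtx mk d) (- qv t)) * psi (X s) z -
  (\sum_(t <- O) Q (2 * dc (X s) (qv t))) * psi (X s) z.
have X0 : X 0 = x by rewrite /X rmorph0 scale0r addr0.
suff : g 0 = 0 by rewrite /g X0 => /eqP; rewrite subr_eq0 => /eqP.
have psic y : cont0 (fun s => psi (X s) y) by apply: psi_cont.
apply: cont0_eq0.
  apply: cont0D; last first.
    apply: cont0N; apply: cont0M => //; apply: cont0_sum => t.
    rewrite (_ : (fun s => _) = fun s => Q (2 * dc x (qv t) + f s * (2 * dc (qv d) (qv t)))).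
      exact: Q_cont_affine.
    by apply/funext => s; rewrite dcDl dcZl mulrDr [2 * (f s * _)]mulrCA.
  apply: cont0D; last by apply: cont0M => //; apply: cont0_cst.
  apply: cont0_sum => t; apply: cont0M; first exact: cont0_cst.
  by apply: cont0D; [apply: psic|apply: cont0N; apply: psic].
move=> e e0; have [s [s0 se gs]] := gen_near x e0; exists s; split=> //.
apply/eqP; rewrite subr_eq0; apply/eqP.
apply: (z_operator_eigen hG hR rd RpE hm gs) => //.
- by move=> p a /mapP[v vS ->] aR; apply: S0I.
- by move=> e' p re /mapP[v vS ->] /=; apply: (S0_hull hG hR S0P re vS).
- by move=> a i y aR im ay; apply: hQI.
Qed.

End Rays.

(** * Weyl orbits of (quasi)minuscule weights and coweights *)

Section WeylOrbits.
Local Open Scope classical_set_scope.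
Context {K : realType} {n : nat}.
Local Notation V := 'rV[K]_n.
Variables (G : 'M[K]_n) (hG : euclidean G) (R : {fset V}).
Hypothesis hR : reduced_irreducible_root_system G R.
Local Notation dt := (dot G).
Local Notation cr := (coroot G).
Local Notation rf := (reflection G).
Local Notation dot_sym := (dot_sym hG).
Local Notation dotZr := (dotZr hG).
Local Notation dotNr := (dotNr hG).
Local Notation dotBr := (dotBr hG).
Local Notation dot_gt0 := (dot_gt0 hG).
Local Notation corootN := (corootN hG).
Local Notation dot_root_neq0 := (dot_root_neq0 hG hR).
Local Notation dot_coroot2 := (dot_coroot2 hG hR).
Local Notation dot_coroot2' := (dot_coroot2' hG hR).
Local Notation reflection_self := (reflection_self hG hR).
Local Notation reflectionK := (reflectionK hG hR).
Local Notation reflection_dot := (reflection_dot hG hR).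
Local Notation reflection_dotl := (reflection_dotl hG hR).
Local Notation reflection_root := (reflection_root hG hR).
Local Notation coroot_reflection := (coroot_reflection hG hR).
Local Notation root_span0 := (root_span0 hG hR).
Local Notation inQ := (inQ G R).
Local Notation orbit := (weyl_orbit G R).

Lemma orbit_ind (P : V -> Prop) p : P p ->
  (forall t a, a \in R -> P t -> P (rf a t)) -> forall t, orbit p t -> P t.
Proof.
move=> P0 PS t [w [s sR ->] <-]; elim: s sR => //= a s IH sR.
apply: PS; first by apply: sR; rewrite mem_head.
by apply: IH => b bs; apply: sR; rewrite inE bs orbT.
Qed.

Lemma orbit_id p : orbit p p.
Proof. by exists id => //; exists [::]. Qed.

Lemma orbit_reflection p t a : orbit p t -> a \in R -> orbit p (rf a t).
Proof.
move=> [w [s sR ->] <-] aR; exists (fun v => foldr rf v (a :: s)) => //.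
by exists (a :: s) => // b; rewrite inE => /orP[/eqP->|/sR].
Qed.

(** The roots span the space, so a vector is determined by its pairings with the finitely many
    roots. *)
Lemma finite_values (vals : seq K) :
  finite_set [set t : V | forall a, a \in R -> dt t a \in vals].
Proof.
pose g (t : V) := [ffun a : R => if dt t (val a) \in vals then
  (inord (index (dt t (val a)) vals) : 'I_(size vals).+1) else ord0].
set A := [set t : V | _].
have inj t u : A t -> A u -> g t = g u -> t = u.
  move=> At Au E; apply/eqP; rewrite -subr_eq0; apply/eqP; apply: root_span0 => a aR.
  have /ffunP/(_ [` aR]%fset) := E; rewrite !ffunE /= At// Au// => /(congr1 val).
  rewrite /= !inordK ?ltnS ?index_size// => /(congr1 (nth 0 vals)).
  by rewrite !nth_index ?At ?Au// dotBr !(dot_sym a) => ->; rewrite subrr.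
apply: (@sub_finite_set _ _ ((fun h => xget 0 [set t | A t /\ g t = h]) @` setT)).
  move=> t At; exists (g t) => //; case: xgetP => [u _ [Au gu]|/(_ t)]; first exact: inj.
  by case.
by apply: finite_image; apply: finite_finset.
Qed.

Lemma orbit_finite p : finite_set (orbit p).
Proof.
apply: sub_finite_set (finite_values [seq dt p b | b <- enum_fset R]) => t.
apply: (orbit_ind (P := fun t => forall a, a \in R -> dt t a \in _)) => [a aR|{}t b bR H a aR].
  exact: map_f.
by rewrite reflection_dotl// H// reflection_root.
Qed.

(** Pairings of lattice points of the polytope with roots are integers bounded by the single
    constant [M]. *)
Lemma polytope_lattice_finite m Rp (d : V) : regular G R d -> Rp = [fset a in R | 0 < dt a d]%fset ->
  (forall a b, a \in R -> b \in R -> m (rf a b) = m b) ->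
  finite_set (support_polytope G m Rp `&` coweight_lattice G R).
Proof.
move=> rd RpE hm.
pose M : K := \sum_(a <- R) \sum_(b <- R) (m b)%:R * `|dt (cr b) a|.
pose N := Num.truncn M.
pose vals : seq K := [seq k%:R | k <- iota 0 N.+1] ++ [seq - k%:R | k <- iota 0 N.+1].
apply: sub_finite_set (finite_values vals) => v [/(polytopeP hG hR rd RpE hm)[g Hg vE] vI] a aR.
have M0 : 0 <= M by rewrite sumr_ge0// => ? _; rewrite sumr_ge0// => ? _; rewrite mulr_ge0.
have vM : `|dt v a| <= M.
  apply: (@le_trans _ _ (\sum_(b <- R) (m b)%:R * `|dt (cr b) a|)).
    rewrite vE dotZl dot_suml normrM (ger0_norm (_ : 0 <= 4^-1))//.
    apply: (@le_trans _ _ (\sum_(b <- R) `|dt (g b *: cr b) a|)).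
      apply: le_trans (ler_norm_sum _ _ _); rewrite ler_piMl// invf_le1//; lra.
    rewrite big_seq [leRHS]big_seq; apply: ler_sum => b bR.
    by rewrite dotZl normrM ler_wpM2r// Hg.
  rewrite /M [leRHS](big_rem a)//= lerDl; apply: sumr_ge0 => a' _; apply: sumr_ge0 => b _.
  by apply: mulr_ge0.
have := vI a aR; move: vM; move: (dt v a) => y yM /intrP[z zE].
have kN k : k%:R <= M -> k \in iota 0 N.+1.
  by move=> kM; rewrite mem_iota add0n ltnS /N truncn_ge_nat.
rewrite mem_cat; case: z zE => k yE.
  apply/orP; left; rewrite yE -pmulrn; apply: (map_f (fun k : nat => k%:R : K)); apply: kN.
  by move: yM; rewrite yE -pmulrn normr_nat.
apply/orP; right; rewrite yE NegzE mulrNz -pmulrn; apply: (map_f (fun k : nat => - k%:R : K)); apply: kN.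
by move: yM; rewrite yE NegzE mulrNz -pmulrn normrN normr_nat.
Qed.

Definition orbit_seq p : seq V := enum_fset (fset_set (orbit p)).

Lemma orbit_seq_uniq p : uniq (orbit_seq p).
Proof. exact: fset_uniq. Qed.

Lemma mem_orbit_seq p t : t \in orbit_seq p <-> orbit p t.
Proof.
rewrite /orbit_seq -[t \in _]/(t \in fset_set (orbit p)) in_fset_set ?inE//.
exact: orbit_finite.
Qed.

Lemma sum_orbit (T : nmodType) p (F : V -> T) :
  \sum_(t \in orbit p) F t = \sum_(t <- orbit_seq p) F t.
Proof. by rewrite fsbig_finite//; apply: orbit_finite. Qed.

Lemma orbit_seq_reflection p t a : t \in orbit_seq p -> a \in R -> rf a t \in orbit_seq p.
Proof. by move=> /mem_orbit_seq tO aR; apply/mem_orbit_seq/orbit_reflection. Qed.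

Lemma orbit_norm p t : orbit p t -> dt t t = dt p p.
Proof. by apply: (orbit_ind (P := fun t => dt t t = dt p p)) => // {}t a aR <-; rewrite reflection_dot. Qed.

Lemma orbit_neq0 p t : p != 0 -> orbit p t -> t != 0.
Proof.
by move=> p0 /orbit_norm E; apply: contraNneq (lt0r_neq0 (dot_gt0 p0)) => t0; rewrite -E t0 dot0l.
Qed.

Lemma orbit_lattice p t : (forall a, a \in R -> dt p a \is a Num.int) -> orbit p t ->
  forall a, a \in R -> dt t a \is a Num.int.
Proof.
move=> pI; apply: (orbit_ind (P := fun t => forall a, a \in R -> dt t a \is a Num.int)) => //.
by move=> {}t b bR H a aR; rewrite reflection_dotl// H// reflection_root.
Qed.

Lemma orbit_weight p t : (forall a, a \in R -> dt p (cr a) \is a Num.int) -> orbit p t ->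
  forall a, a \in R -> dt t (cr a) \is a Num.int.
Proof.
move=> pI; apply: (orbit_ind (P := fun t => forall a, a \in R -> dt t (cr a) \is a Num.int)) => //.
by move=> {}t b bR H a aR; rewrite reflection_dotl// -coroot_reflection// H// reflection_root.
Qed.

Lemma corootK a : a \in R -> cr (cr a) = a.
Proof.
move=> aR; have aa := dot_root_neq0 aR; rewrite {1}/coroot dot_corootl (dot_coroot2 aR).
by rewrite /coroot scalerA -[RHS]scale1r; congr (_ *: _); field.
Qed.

Lemma minuscule_small p : minuscule G R p -> forall t, orbit p t ->
  forall a, a \in R -> dt t a <= 1.
Proof.
move=> pm t tO a aR.
have : -1 <= dt t a <= 1; last by case/andP.
move: t tO a aR; apply: orbit_ind => // t b bR H a aR.
by rewrite reflection_dotl// H// reflection_root.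
Qed.

(** The orbit consists of coroots, and reflections transport the bound, together with its
    exceptional pair of roots, from one orbit element to the next. *)
Lemma quasiminuscule_small b : b \in R -> quasiminuscule G R (cr b) ->
  forall t, orbit (cr b) t -> inQ t /\ forall a, a \in R -> dt t a <= 1 \/ t = cr a.
Proof.
move=> bR [_ H] t tO.
have [b' [b'R tE H']] : exists b', [/\ b' \in R, t = cr b' & forall a, a \in R -> a != b' ->
    a != - b' -> -1 <= dt t a <= 1].
  move: t tO; apply: orbit_ind.
    by exists b; split=> // a aR ab aNb; apply: H; rewrite ?corootK.
  move=> t a aR [b' [b'R tE H']]; exists (rf a b'); split.
  - exact: (root_refl hR).
  - by rewrite tE coroot_reflection.
  - move=> e eR eb eNb; rewrite reflection_dotl//; apply: H'.
    + by rewrite reflection_root.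
    + by apply: contraNneq eb => <-; rewrite reflectionK.
    + by apply: contraNneq eNb => E; rewrite -[e](reflectionK aR) E reflectionN.
split; first by rewrite tE; apply: inQ_coroot.
move=> a aR; have [->|ab] := eqVneq a b'; first by right.
have [->|aNb] := eqVneq a (- b').
  by left; rewrite dotNr tE dot_coroot2'//; lra.
by left; case/andP: (H' a aR ab aNb).
Qed.

Lemma coweight_orbit_small p : quasi_or_minuscule G R p ->
  (forall t a, orbit p t -> a \in R -> dt t a <= 1 \/ t = cr a) /\
  ((forall t a, orbit p t -> a \in R -> dt t a <= 1) \/ forall t, orbit p t -> inQ t).
Proof.
case=> _ [pm|[pD pq]].
  have H t a : orbit p t -> a \in R -> dt t a <= 1 by move=> tO; apply: minuscule_small tO a.
  by split; [move=> t a tO aR; left; apply: H|left].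
have [b bR pE] : exists2 b, b \in R & p = cr b by move/imfsetP: pD => [b bR ->]; exists b.
subst p; have H := quasiminuscule_small bR (conj pD pq).
by split; [move=> t a tO aR; apply: (H t tO).2|right => t tO; apply: (H t tO).1].
Qed.

Lemma weight_orbit_small p : quasi_or_minuscule G (dual_roots G R) p ->
  forall t a, orbit p t -> a \in R -> dt t (cr a) <= 1 \/ t = a.
Proof.
have dual a : a \in R -> cr a \in dual_roots G R by move=> aR; apply/imfsetP; exists a.
case=> _ [pm|[pD pq]] t a tO aR.
  left; have : -1 <= dt t (cr a) <= 1; last by case/andP.
  move: t tO a aR; apply: orbit_ind => [a aR|t b bR H a aR]; first exact/pm/dual.
  by rewrite reflection_dotl// -coroot_reflection// H// reflection_root.
have [b bR pE] : exists2 b, b \in R & p = b.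
  by move/imfsetP: pD => /= [c /imfsetP[b /= bR ->] ->]; exists b; rewrite ?corootK.
have [b' [b'R tE H']] : exists b', [/\ b' \in R, t = b' & forall a, a \in R -> a != b' ->
    a != - b' -> -1 <= dt t (cr a) <= 1].
  move: t tO; apply: orbit_ind.
    exists b; split=> // e eR eb eNb; apply: pq; rewrite ?dual// pE.
      by apply: contraNneq eb => E; rewrite -[e]corootK// E corootK.
    by apply: contraNneq eNb => E; rewrite -[e]corootK// E corootN ?corootK.
  move=> t e eR [b' [b'R tE H']]; exists (rf e b'); split.
  - exact: (root_refl hR).
  - by rewrite tE.
  - move=> c cR cb cNb; rewrite reflection_dotl// -coroot_reflection//; apply: H'.
    + by rewrite reflection_root.
    + by apply: contraNneq cb => <-; rewrite reflectionK.
    + by apply: contraNneq cNb => E; rewrite -[c](reflectionK eR) E reflectionN.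
have [->|ab] := eqVneq a b'; first by right.
have [->|aNb] := eqVneq a (- b').
  by left; rewrite corootN// dotNr tE dot_sym dot_coroot2'//; lra.
by left; case/andP: (H' a aR ab aNb).
Qed.

(* Irreducibility: the roots orthogonal to the orbit and the others form an
   orthogonal decomposition of the root system. *)
Lemma orbit_meets_root p b : p != 0 -> b \in R -> exists2 t, orbit p t & 0 < dt (cr b) t.
Proof.
move=> p0 bR; apply: contrapT => Hn.
pose perp a := forall t, orbit p t -> dt a t = 0.
have bp : perp b.
  move=> t tO; have le t' : orbit p t' -> dt (cr b) t' <= 0.
    by move=> t'O; rewrite leNgt; apply/negP => h; apply: Hn; exists t'.
  have h1 := le t tO; have := le _ (orbit_reflection tO bR).
  rewrite -reflection_dotl// -coroot_reflection// reflection_self// corootN// dotNl oppr_le0 => h2.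
  have : dt (cr b) t = 0 by apply/eqP; rewrite eq_le h1.
  by move/eqP; rewrite dot_corootl mulf_eq0 mulf_eq0 invr_eq0 pnatr_eq0 (negPf (dot_root_neq0 bR)) => /eqP.
pose A := [fset a in R | `[< perp a >]]%fset; pose B := [fset a in R | ~~ `[< perp a >]]%fset.
have AB a c : a \in A -> c \in B -> dt a c = 0.
  rewrite !inE => /andP[aR /asboolP ap] /andP[cR /asboolP cp].
  apply: contrapT => ac; apply: cp => t tO; have := ap _ (orbit_reflection tO cR).
  rewrite /reflection dotBr dotZr ap// sub0r => /eqP; rewrite oppr_eq0 mulf_eq0.
  case/orP => [|/eqP//]; rewrite dot_sym dot_corootl mulf_eq0 mulf_eq0 invr_eq0 pnatr_eq0.
  by rewrite (negPf (dot_root_neq0 cR)) => /eqP.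
have RE : R = (A `|` B)%fset.
  by apply/fsetP => a; rewrite !inE; case: (a \in R) => //=; case: `[< _ >].
case: (root_irreducible hR RE AB) => [A0|B0].
  have : b \in A by rewrite !inE bR; apply/asboolP.
  by rewrite A0 inE.
move/eqP: p0; apply; apply: root_span0 => a aR.
have : a \notin B by rewrite B0 inE.
rewrite !inE aR /= negbK => /asboolP; apply; exact: orbit_id.
Qed.

End WeylOrbits.

(** * The complex power function as an instance of the character interface *)

Section ComplexCharacter.
Local Open Scope classical_set_scope.
Local Open Scope complex_scope.
Context {K : realType}.
Local Notation C := K[i].

Lemma real_complex_cont (k : K -> K) : {for 0, continuous k} -> cont0 (fun s => (k s)%:C : C).
Proof.
move=> kc; apply/cvgrPdist_lt => e e0 /=.
have re0 : 0 < complex.Re e by move: e0; rewrite ltcE => /andP[].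
have eE : e = (complex.Re e)%:C.
  by move: e0; rewrite ltcE /= => /andP[/eqP ie _]; case: (e) ie => a b /= ->.
near=> s; rewrite -rmorphB /= normc_def /= expr0n addr0 sqrtr_sqr eE ltcR.
by near: s; move/cvgrPdist_lt: kc => /(_ _ re0).
Unshelve. all: by end_near. Qed.

Lemma complex_cont (g h : K -> K) : {for 0, continuous g} -> {for 0, continuous h} ->
  cont0 (fun s => g s +i* h s : C).
Proof.
move=> gc hc; rewrite (_ : (fun s => _) = fun s => (g s)%:C + 'i * (h s)%:C).
  by apply: cont0D; [|apply: cont0M; first exact: cont0_cst]; apply: real_complex_cont.
by apply/funext => s; apply: complexE.
Qed.

Lemma cexp_ray_cont (w : C) : cont0 (fun s => cexp (s%:C * w)).
Proof.
case: w => a b.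
rewrite (_ : (fun s => _) = fun s => expR (s * a) * cos (s * b) +i* (expR (s * a) * sin (s * b))).
  have lin u : {for 0, continuous (fun s : K => s * u)} by apply: cvgMl; exact: cvg_id.
  by apply: complex_cont; apply: cvgM; apply: (continuous_comp (lin _));
    [exact: continuous_expR|exact: continuous_cos|exact: continuous_expR|exact: continuous_sin].
by apply/funext => s; rewrite /cexp /=; simpc.
Qed.

(** $\cos 2\pi r=1$ forces $\sin\pi r=0$, and the sine does not vanish strictly between consecutive
    multiples of $\pi$. *)
Lemma cexp_period_int (r : K) : cexp (r%:C * (0 +i* (2 * pi))) = 1 -> r \is a Num.int.
Proof.
rewrite /cexp /=; simpc; rewrite expR0 !mul1r => -[rc rs].
have s0 : sin (`|r| * pi) = 0.
  have : sin (r * pi) = 0.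
    move: rc; rewrite mulrCA mulr_natl mulr2n cosD -!expr2 => rc.
    have := cos2Dsin2 (r * pi); move=> cs.
    by apply/eqP; rewrite -sqrf_eq0; apply/eqP; lra.
  by case: (ger0P r) => // _; rewrite mulNr sinN => ->; rewrite oppr0.
have r0 := normr_ge0 r; have /andP[k1 k2] := truncn_itv r0.
set k := Num.truncn `|r| in k1 k2.
suff rk : `|r| = k%:R.
  have : `|r| \is a Num.int by rewrite rk rpred_nat.
  by case: (ger0P r) => //; rewrite rpredN.
apply/eqP; rewrite eq_le k1 andbT leNgt; apply/negP => rk.
have y1 : 0 < (`|r| - k%:R) * pi < pi.
  by rewrite mulr_gt0 ?subr_gt0 ?pi_gt0//= gtr_pMl ?pi_gt0// ltrBlDl natr1.
have := sin_gt0_pi y1; have := alternatingn (@sinDpi K) k ((`|r| - k%:R) * pi).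
rewrite -[pi *+ k]mulr_natl -mulrDl subrK s0 => /esym/eqP.
by rewrite mulf_eq0 signr_eq0 /= => /eqP ->; rewrite ltxx.
Qed.

End ComplexCharacter.
Section ComplexCharacterStructure.
Local Open Scope classical_set_scope.
Local Open Scope complex_scope.
Context {K : realType}.
Local Notation C := K[i].
Variable logq : C.
Hypothesis hq : forall k : nat, (0 < k)%N -> cexp logq ^+ k != 1.

Lemma cexp_mulrn k : cexp (k%:R%:C * logq) = cexp logq ^+ k.
Proof. by rewrite -cexp_nat rmorph_nat mulr_natl. Qed.

Lemma logq_neq0 : logq != 0.
Proof. by apply: contraTneq (hq (ltn0Sn 0)) => ->; rewrite cexp0 expr1 negbK. Qed.

Lemma qpowD (a b : C) : qpow logq (a + b) = qpow logq a * qpow logq b.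
Proof. by rewrite /qpow mulrDl cexpD. Qed.

Lemma qpow_neq0 (a : C) : qpow logq a != 0.
Proof. exact: cexp_neq0. Qed.

Lemma qpow_int (r : K) : r \is a Num.int -> r != 0 -> qpow logq (real_complex K r) != 1.
Proof.
move=> /intrP[[[|k]|k] ->]; first by rewrite eqxx.
  by rewrite -pmulrn => _; rewrite /qpow cexp_mulrn hq.
rewrite NegzE mulrNz -pmulrn => _; rewrite /qpow rmorphN mulNr cexpN cexp_mulrn.
by rewrite invr_eq1 hq.
Qed.

Lemma qpow_period : exists2 k : C, qpow logq k = 1 &
  forall r, qpow logq (real_complex K r * k) = 1 -> r \is a Num.int.
Proof.
(* The period is $2\pi i/\log q$. *)
exists ((0 +i* (2 * pi)) / logq).
  rewrite /qpow divfK ?logq_neq0// /cexp /= expR0 -[2]/(1 + 1) mulrDl mul1r -mulr2n.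
  by rewrite cos2pi sin2pi; simpc.
move=> r; rewrite /qpow mulrA divfK ?logq_neq0//; exact: cexp_period_int.
Qed.

Definition complex_qchar : qchar K C :=
  @QChar K C (real_complex K) (qpow logq) qpowD qpow_neq0 qpow_int qpow_period.

Lemma qchar_small w : w != 0 -> exists2 e : K, 0 < e &
  forall s, `|s| < e -> complex_qchar (qemb complex_qchar s * w) = 1 -> s = 0.
Proof.
move=> w0; pose M := `|complex.Im (w * logq)| + 1.
have M0 : 0 < M by rewrite ltr_pwDr.
exists (pi / M); first by rewrite divr_gt0 ?pi_gt0.
move=> s sM; rewrite /= /qpow -mulrA => /cexp_eq1_small H.
have : s%:C * (w * logq) = 0.
  apply: H; have -> : complex.Im (s%:C * (w * logq)) = s * complex.Im (w * logq).
    by case: (w * logq) => a b /=; rewrite mul0r addr0.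
  rewrite normrM; move: sM; rewrite ltr_pdivlMr//; apply: le_lt_trans.
  by rewrite ler_wpM2l// lerDl.
move/eqP; rewrite mulf_eq0 mulf_eq0 (negPf w0) (negPf logq_neq0) !orbF.
by rewrite eq_complex /= eqxx andbT => /eqP.
Qed.

Lemma qchar_surj (w : C) : w != 0 -> exists t, complex_qchar t = w.
Proof.
by move=> /cexp_surj[u <-]; exists (u / logq); rewrite /= /qpow divfK ?logq_neq0.
Qed.

Lemma qchar_cont w : cont0 (fun s => complex_qchar (qemb complex_qchar s * w)).
Proof.
rewrite (_ : (fun s => _) = fun s => cexp (s%:C * (w * logq))); first exact: cexp_ray_cont.
by apply/funext => s; rewrite /= /qpow mulrA.
Qed.

Lemma qemb_cont : cont0 (qemb complex_qchar).
Proof. by apply: (@real_complex_cont K id); exact: cvg_id. Qed.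

(** Stated existentially so that the main proof sees only an abstract [Q] with the listed properties
    and never unfolds the exponential. *)
Lemma complex_qchar_exists : exists Q : qchar K C,
  [/\ forall a, qpow logq a = Q a, forall r, real_complex K r = qemb Q r,
    [/\ cont0 (qemb Q), forall w, cont0 (fun s => Q (qemb Q s * w)) &
      forall w, w != 0 -> exists2 e : K, 0 < e & forall s, `|s| < e -> Q (qemb Q s * w) = 1 -> s = 0]
    & forall w, w != 0 -> exists t, Q t = w].
Proof.
exists complex_qchar; split=> //; last exact: qchar_surj.
by split; [apply: qemb_cont|apply: qchar_cont|apply: qchar_small].
Qed.

End ComplexCharacterStructure.

(** * Translation between the definitions of the statement and the abstract ones *)

Section Rho.
Context {K : realType} {n : nat}.
Local Notation V := 'rV[K]_n.
Variables (G : 'M[K]_n) (hG : euclidean G) (R : {fset V}).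
Hypothesis hR : reduced_irreducible_root_system G R.
Variables (d : V) (Rp : {fset V}).
Hypothesis rd : regular G R d.
Hypothesis RpE : Rp = [fset a in R | 0 < dot G a d]%fset.
Variable m : V -> nat.
Hypothesis hm : forall a b, a \in R -> b \in R -> m (reflection G a b) = m b.

Lemma rhov_vtx : rhov G m Rp = vertex G R (fun a => (m a)%:R) d.
Proof.
rewrite (vtx_Rp hG hR rd RpE _ (mk_inv hm)); congr (_ *: _); apply: eq_big_seq => b.
by rewrite (mem_Rp RpE) => /andP[_ bd]; rewrite (gtr0_sg bd) mul1r.
Qed.

Lemma rho_vtx : rho m Rp = vertex G R (kroot G m) d.
Proof.
rewrite (vtx_Rp hG hR rd RpE _ (kroot_inv hG hR hm)); congr (_ *: _); apply: eq_big_seq => b.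
rewrite (mem_Rp RpE) => /andP[bR bd]; rewrite (gtr0_sg bd) mul1r.
by rewrite (kroot_coroot hG hR m bR).
Qed.

End Rho.

Section Identification.
Local Open Scope classical_set_scope.
Local Open Scope complex_scope.
Context {K : realType} {n : nat}.
Local Notation C := K[i].
Local Notation V := 'rV[K]_n.
Local Notation VC := 'rV[C]_n.
Variables (G : 'M[K]_n) (hG : euclidean G) (R : {fset V}) (logq : C) (m : V -> nat) (Q : qchar K C).
Hypothesis qE : forall a, qpow logq a = Q a.
Hypothesis fE : forall r, real_complex K r = qemb Q r.

Lemma dotCE (x z : VC) : dotC G x z = qdot G Q x z.
Proof. by rewrite /dotC /qdot (eq_map_mx _ fE). Qed.

Lemma toVCE (v : V) : toVC v = qvec Q v.
Proof. exact: eq_map_mx. Qed.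

Lemma qbracketE a : qbracket logq a = qbr Q a.
Proof. by rewrite /qbracket !qE. Qed.

Lemma macdonald_coef_z t z : macdonald_coef G R logq m (coroot G) t z = zcoef G Q R m t z.
Proof.
rewrite /macdonald_coef /zcoef; congr (_ * _); apply: eq_bigr => a _;
  by rewrite !qbracketE dotCE toVCE.
Qed.

Lemma macdonald_coef_x t x : macdonald_coef G R logq m id t x = xcoef G Q R m t x.
Proof.
rewrite /macdonald_coef /xcoef; congr (_ * _); apply: eq_bigr => a _;
  by rewrite !qbracketE dotCE toVCE.
Qed.

End Identification.

(** * The two difference equations *)

Theorem corollary4p8 (K : realType) (n : nat)
  (G : 'M[K]_n) (hG : euclidean G)
  (R Rp : {fset 'rV[K]_n})
  (hR : reduced_irreducible_root_system G R)
  (hRp : positive_roots G R Rp)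
  (q logq : K[i]) (hlogq : cexp logq = q)
  (hq : forall k : nat, (0 < k)%N -> q ^+ k != 1)
  (m : 'rV[K]_n -> nat) (hm : weyl_invariant G R m)
  (psi : 'rV[K[i]]_n -> 'rV[K[i]]_n -> K[i])
  (hpsi : normalized_BA G R logq m Rp psi)
  (omega pi : 'rV[K]_n)
  (homega : weight_lattice G R omega)
  (homega_min : quasi_or_minuscule G (dual_roots G R) omega)
  (hpi : coweight_lattice G R pi)
  (hpi_min : quasi_or_minuscule G R pi) :
  (forall x z, macdonald_regular G R logq (coroot G) omega z ->
     macdonald_z G R logq m Rp omega (fun z' => psi x z') z
     = orbit_sum G R logq omega x * psi x z) /\
  (forall x z, macdonald_regular G R logq id pi x ->
     macdonald_x G R logq m Rp pi (fun x' => psi x' z) x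
     = orbit_sum G R logq pi z * psi x z).
Proof.
have hq' k : (0 < k)%N -> cexp logq ^+ k != 1 by rewrite hlogq; apply: hq.
have [Q [qE fE [f_cont Q_cont Q_small] Q_surj]] := complex_qchar_exists hq'.
have [d rd RpE] := hRp.
have hm' a b : a \in R -> b \in R -> m (reflection G a b) = m b.
  move=> aR bR; apply: (hm (reflection G a)) => //.
  by exists [:: a] => // c; rewrite inE => /eqP ->.
have [c [c_cont psiE psiQ c_top]] := hpsi.
have finS := polytope_lattice_finite hG hR rd RpE hm'.
pose S0 := enum_fset (fset_set (support_polytope G m Rp `&` coweight_lattice G R)%classic).
have memS v : v \in S0 <-> support_polytope G m Rp v /\ coweight_lattice G R v.
  by rewrite /S0 -[v \in _]/(v \in fset_set _) in_fset_set ?inE.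
have psi_psum x z : psi x z = qpsum G Q x (psi_seq S0 c x) z.
  rewrite psiE fsbig_finite//= qE (dotCE G fE) /qpsum /qev big_map; congr (_ * _).
  by apply: eq_bigr => v _; rewrite qE (dotCE G fE) (toVCE fE).
have uS0 : uniq S0 by apply: fset_uniq.
have S0P v : v \in S0 -> polytope G R m v.
  by move=> /memS[vP _]; apply: (polytopeP hG hR rd RpE hm' vP).
have S0I v a : v \in S0 -> a \in R -> dot G v a \is a Num.int.
  by move=> /memS[_ vI]; apply: vI.
have S0v e : regular G R e -> vertex G R (fun a => (m a)%:R) e \in S0.
  move=> re; apply/memS; split; first exact: (vtx_polytope hG hR rd RpE hm' re).
  by move=> a aR; apply: (vtx_int hG hR rd RpE hm' re aR).
have c_cont' v : v \in S0 -> continuous (c v : 'rV[K[i]^o]_n -> K[i]^o).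
  by move=> /memS vS; apply: c_cont.
have hQI x a i z : a \in R -> (1 <= i <= m a)%N -> wall G Q a z ->
    qpsum G Q x (psi_seq S0 c x) (z + qvec Q ((i%:R / 2) *: a)) =
    qpsum G Q x (psi_seq S0 c x) (z - qvec Q ((i%:R / 2) *: a)).
  move=> aR im; rewrite /wall /qexp -qE -(toVCE fE) -(dotCE G fE) => az.
  by rewrite -!psi_psum -(toVCE fE); apply: psiQ.
have rhoE := rhov_vtx hG hR rd RpE hm'.
have htop x : c (vertex G R (fun a => (m a)%:R) d) x = vcoef G Q R m d x.
  rewrite -rhoE c_top /vcoef -[RHS]big_filter; apply: etrans.
    by apply: eq_bigr => a _; apply: eq_bigr => j _; rewrite (qbracketE qE) (dotCE G fE) (toVCE fE).
  apply: perm_big; apply: uniq_perm; rewrite ?filter_uniq ?fset_uniq// => a.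
  by rewrite mem_filter (mem_Rp RpE) andbC.
split=> x z reg.
- have orbE p (F : _ -> K[i]) : \sum_(t \in weyl_orbit G R p) F t = \sum_(t <- orbit_seq G R p) F t.
    exact: (sum_orbit hG hR).
  have w0 := homega_min.1.
  (* Regularity of [z] speaks only of coroots pairing positively with some orbit element; by
     irreducibility ([orbit_meets_root]) every coroot does. *)
  have X0 b : b \in R -> qbr Q (qdot G Q (qvec Q (coroot G b)) z) != 0.
    move=> bR; have [t tO tb] := orbit_meets_root hG hR w0 bR.
    by rewrite -(qbracketE qE) -(toVCE fE) -(dotCE G fE); apply: (reg t b tO bR).1.
  have K0 t : t \in orbit_seq G R omega -> t \in R ->
      qbr Q (qdot G Q (qvec Q (coroot G t)) z + 1) != 0.
    move=> /(mem_orbit_seq hG hR) tO tR.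
    rewrite -(qbracketE qE) -(toVCE fE) -(dotCE G fE); apply: (reg t t tO tR).2.
    exact: (dot_coroot2' hG hR tR).
  have O1 t a : t \in orbit_seq G R omega -> a \in R -> reflection G a t \in orbit_seq G R omega.
    exact: (orbit_seq_reflection hG hR).
  have O2 t a : t \in orbit_seq G R omega -> a \in R -> dot G t (coroot G a) \is a Num.int.
    by move=> /(mem_orbit_seq hG hR) tO; apply: (orbit_weight hG hR homega tO).
  have O3 t a : t \in orbit_seq G R omega -> a \in R -> dot G t (coroot G a) <= 1 \/ t = a.
    by move=> /(mem_orbit_seq hG hR) tO; apply: (weight_orbit_small hG hR homega_min tO).
  have := z_operator_identity hG hR f_cont Q_cont Q_small rd RpE hm' S0P
    S0I c_cont' hQI x (orbit_seq_uniq G R omega) O1 O2 O3 X0 K0.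
  move=> H; rewrite /macdonald_z /macdonald_op /orbit_sum.
  transitivity ((\sum_(t <- orbit_seq G R omega) Q (2 * qdot G Q x (qvec Q t))) *
      qpsum G Q x (psi_seq S0 c x) z).
    rewrite -H rhoE; congr (_ + _ * _); [rewrite [LHS]orbE; apply: eq_bigr => t _|rewrite [LHS]orbE; apply: eq_bigr => t _|exact: psi_psum].
      by rewrite (macdonald_coef_z G R m qE fE) !(toVCE fE) !psi_psum.
    rewrite /qexp !(toVCE fE) (dotCE G fE) qE qvecN.
    by rewrite dcNl dcNr.
  congr (_ * _); last exact/esym/psi_psum.
  by rewrite [RHS]orbE; apply: eq_bigr => t _; rewrite qE (dotCE G fE) (toVCE fE) dcC.
have orbE p (F : _ -> K[i]) : \sum_(t \in weyl_orbit G R p) F t = \sum_(t <- orbit_seq G R p) F t.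
  exact: (sum_orbit hG hR).
have [small type] := coweight_orbit_small hG hR hpi_min.
have O1 t a : t \in orbit_seq G R pi -> a \in R -> reflection G a t \in orbit_seq G R pi.
  exact: (orbit_seq_reflection hG hR).
have O2 t a : t \in orbit_seq G R pi -> a \in R -> dot G t a \is a Num.int.
  by move=> /(mem_orbit_seq hG hR) tO; apply: (orbit_lattice hG hR hpi tO).
have O3 t u : t \in orbit_seq G R pi -> u \in orbit_seq G R pi -> dot G t t = dot G u u.
  by move=> /(mem_orbit_seq hG hR)/(orbit_norm hG hR) -> /(mem_orbit_seq hG hR)/(orbit_norm hG hR) ->.
have O4 t a : t \in orbit_seq G R pi -> a \in R -> dot G t a <= 1 \/ t = coroot G a.
  by move=> /(mem_orbit_seq hG hR); apply: small.
have O5 : (forall t a, t \in orbit_seq G R pi -> a \in R -> dot G t a <= 1) \/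
    (forall t, t \in orbit_seq G R pi -> inQ G R t).
  case: type => h; [left=> t a /(mem_orbit_seq hG hR)|right=> t /(mem_orbit_seq hG hR)]; exact: h.
have O6 t : t \in orbit_seq G R pi -> t != 0.
  by move=> /(mem_orbit_seq hG hR); apply: (orbit_neq0 hG hR hpi_min.1).
have X1 t a : t \in orbit_seq G R pi -> a \in R -> 0 < dot G a t ->
    qbr Q (qdot G Q (qvec Q a) x) != 0.
  move=> /(mem_orbit_seq hG hR) tO aR ta.
  by rewrite -(qbracketE qE) -(toVCE fE) -(dotCE G fE); apply: (reg t a tO aR).1.
have X2 t a : t \in orbit_seq G R pi -> a \in R -> dot G a t = 2 ->
    qbr Q (qdot G Q (qvec Q a) x + 1) != 0.
  move=> /(mem_orbit_seq hG hR) tO aR ta.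
  by rewrite -(qbracketE qE) -(toVCE fE) -(dotCE G fE); apply: (reg t a tO aR).2.
have := x_operator_identity hG hR f_cont Q_cont Q_small rd RpE hm' uS0 S0P
  S0I S0v c_cont' Q_surj hQI htop z (orbit_seq_uniq G R pi) O1 O2 O3 O4 O5 O6 X1 X2.
move=> H; rewrite /macdonald_x /macdonald_op /orbit_sum.
transitivity ((\sum_(t <- orbit_seq G R pi) qexp G Q t z) * qpsum G Q x (psi_seq S0 c x) z).
  rewrite -H (rho_vtx hG hR rd RpE hm').
  congr (_ + _ * _); [rewrite [LHS]orbE; apply: eq_bigr => t _|rewrite [LHS]orbE; apply: eq_bigr => t _|exact: psi_psum].
    by rewrite (macdonald_coef_x G R m qE fE) !(toVCE fE) !psi_psum.
  by rewrite /qexp !(toVCE fE) (dotCE G fE) qE dcC.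
congr (_ * _); last exact/esym/psi_psum.
by rewrite [RHS]orbE; apply: eq_bigr => t _; rewrite qE (dotCE G fE) (toVCE fE).
Qed.
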